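(* Consider a networked system with graph $\mathcal G=(\mathcal V,\mathcal E)$ and matrices $A,B,Q,R$ as in the context. Let $L_0>1$, $\gamma_0,\alpha_0\in(0,1)$, let $\{\mathcal V_k\}_{k\in\mathcal K}$ be a partition of $\mathcal V$, and let $D\ge0$ be an integer. Consider the following conditions. (U1) For all $k\ne k'$ in $\mathcal K$: $Q_{\mathcal V_k,\mathcal V_{k'}}=0$, $R_{\mathcal V_k,\mathcal V_{k'}}=0$, $B_{\mathcal V_k,\mathcal V_{k'}}=0$. (U2) For all $k,k'\in\mathcal K$: $\|Q_{\mathcal V_k,\mathcal V_{k'}}\|,\|R_{\mathcal V_k,\mathcal V_{k'}}\|,\|A_{\mathcal V_k,\mathcal V_{k'}}\|,\|B_{\mathcal V_k,\mathcal V_{k'}}\|\le L_0$. (U3) For all $k\in\mathcal K$: $R_{\mathcal V_k,\mathcal V_k}\succeq\gamma_0I$. (U4) For all $k\in\mathcal K$, $(A_{\mathcal V_k,\mathcal V_k},B_{\mathcal V_k,\mathcal V_k})$ is $(L_0,\alpha_0)$-stabilizable, and for all $k'\ne k$ there is $\overline K_{\mathcal V_k,\mathcal V_{k'}}$ with $\|\overline K_{\mathcal V_k,\mathcal V_{k'}}\|\le L_0$ and $A_{\mathcal V_k,\mathcal V_{k'}}=B_{\mathcal V_k,\mathcal V_k}\overline K_{\mathcal V_k,\mathcal V_{k'}}$. (U5) For all $k\in\mathcal K$, $Q_{\mathcal V_k,\mathcal V_k}\succeq0$, $(A_{\mathcal V_k,\mathcal V_k},Q_{\mathcal V_k,\mathcal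 V_k}^{1/2})$ is $(L_0,\alpha_0)$-detectable, and for all $k'\ne k$ there is $\overline K'_{\mathcal V_{k'},\mathcal V_k}$ with $\|\overline K'_{\mathcal V_{k'},\mathcal V_k}\|\le L_0$ and $A_{\mathcal V_{k'},\mathcal V_k}=\overline K'_{\mathcal V_{k'},\mathcal V_k}Q_{\mathcal V_k,\mathcal V_k}^{1/2}$. (D) For all $k\in\mathcal K$: $\big|\{k'\in\mathcal K:\exists\,\{i,j\}\in\mathcal E\text{ such that }i\in\mathcal V_k,\ j\in\mathcal V_{k'}\}\big|\le D$. Set $\alpha:=\alpha_0$, $\gamma:=\gamma_0$, $L:=L_0D$. Then: (a) (U1), (U2), (D) imply $\|A\|,\|B\|,\|Q\|,\|R\|\le L$. (b) (U1), (U3) imply $R\succeq\gamma I$. (c) (U1), (U2), (U4), (D) imply that $(A,B)$ is $(L,\alpha)$-stabilizable. (d) (U1), (U2), (U5), (D) imply that $Q\succeq0$ and $(A,Q^{1/2})$ is $(L,\alpha)$-detectable. Therefore, if (U1)–(U5) and (D) hold and $p$ is a subexponential function with $|\{j\in\mathcal V:d_{\mathcal G}(i,j)=d\}|\le p(d)$ for all $i\in\mathcal V$ and integers $d\ge0$, then, with the constants of the context computed from these $L,\alpha,\gamma$ and $p$: (i) $\|K^\star_{ij}\|\le\Upsilon\rho^{d_{\mathcal G}(i,j)}$ for all $i,j\in\mathcal V$, with $\rho\in(0,1)$ and $\Upsilon\ge1$; (ii) $\|K^\star-K^\kappa\|\le\Psi\delta^\kappa$ for all integers $\kappa\ge0$,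 with $\delta\in(0,1)$; (iii) for all integers $\kappa\ge0$ with $\kappa\ge\overline\kappa$, $A-BK^\kappa$ is $(\Omega,\beta)$-stable, with $\beta\in(0,1)$; (iv) for all integers $\kappa\ge0$ with $\kappa\ge\overline\kappa$ and all initial states $\overline x$, $J(\pi^\kappa(\cdot);\overline x)-J(\pi^\star(\cdot);\overline x)\le\Gamma\delta^\kappa\|\overline x\|^2$, where $\pi^\kappa(x)=-K^\kappa x$ and $\pi^\star(x)=-K^\star x$.
   Context: Setting. $\mathcal G=(\mathcal V,\mathcal E)$ is a finite undirected graph without self-loops, $\mathcal V=\{1,\dots,N\}$, $\mathcal E\subseteq\{\{i,j\}\subseteq\mathcal V:i\ne j\}$; $d_{\mathcal G}(i,j)$ is the number of edges in a shortest path from $i$ to $j$ (with $d_{\mathcal G}(i,j)=+\infty$ and $\rho^{+\infty}:=0$ if there is no path). Each node $i$ has a state $x_i(t)\in\mathbb R^{n_{x_i}}$ and control $u_i(t)\in\mathbb R^{n_{u_i}}$. Real blocks $A_{ij}\in\mathbb R^{n_{x_i}\times n_{x_j}}$, $B_{ij}\in\mathbb R^{n_{x_i}\times n_{u_j}}$, $Q_{ij}\in\mathbb R^{n_{x_i}\times n_{x_j}}$, $R_{ij}\in\mathbb R^{n_{u_i}\times n_{u_j}}$ are given, with $Q_{ij}=Q_{ji}^\top$, $R_{ij}=R_{ji}^\top$, and all four blocks equal to zero whenever $i\ne j$ and $\{i,j\}\notin\mathcal E$. Set $A=\{A_{ij}\}$, $B=\{B_{ij}\}$, $Q=\{Q_{ij}\}$,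 $R=\{R_{ij}\}$ (block matrices indexed by $i,j\in\mathcal V$), $x=\{x_i\}_{i\in\mathcal V}$, $u=\{u_i\}_{i\in\mathcal V}$. For $\mathcal V',\mathcal V''\subseteq\mathcal V$ and $M\in\{A,B,Q,R\}$, $M_{\mathcal V',\mathcal V''}:=\{M_{ij}\}_{i\in\mathcal V',j\in\mathcal V''}$. $\|\cdot\|$ is the Euclidean norm for vectors and the induced 2-norm for matrices; $M\succeq M'$ means $M-M'$ is positive semidefinite. A function $p:\mathbb Z_{\ge0}\to[0,\infty)$ is subexponential if $p(d)r^d\to0$ as $d\to\infty$ for every $r\in(0,1)$. Stability notions, for $L>0$, $\alpha\in[0,1)$: a square matrix $\Phi$ is $(L,\alpha)$-stable if $\|\Phi^t\|\le L\alpha^t$ for all integers $t\ge 0$; $(A,B)$ is $(L,\alpha)$-stabilizable if there is $\overline K$ with $\|\overline K\|\le L$ and $A-B\overline K$ $(L,\alpha)$-stable; $(A,C)$ is $(L,\alpha)$-detectable if $(A^\top,C^\top)$ is $(L,\alpha)$-stabilizable. Linear-quadratic regulator (LQR): minimize $\sum_{t=0}^\infty \tfrac12 x(t)^\top Qx(t)+\tfrac12u(t)^\top Ru(t)$ subject to $x(0)=\overline x$, $x(t+1)=Ax(t)+Bu(t)$ for $t\ge0$. When $Q\succeq0$, $R\succ0$, $(A,B)$ is stabilizable and $(A,Q^{1/2})$ is detectable, the optimal policy is the linear feedback $u=-K^\star x$; explicitly $K^\star=(R+B^\top P^\star B)^{-1}B^\top P^\star A$, where $P^\star$ is the unique positive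 semidefinite solution of $P=A^\top PA-A^\top PB(R+B^\top PB)^{-1}B^\top PA+Q$. $K^\star$ is partitioned into blocks $K^\star_{ij}\in\mathbb R^{n_{u_i}\times n_{x_j}}$. The $\kappa$-truncated gain $K^\kappa=\{K^\kappa_{ij}\}$ has $K^\kappa_{ij}=K^\star_{ij}$ if $d_{\mathcal G}(i,j)\le\kappa$ and $K^\kappa_{ij}=0$ otherwise. Closed-loop performance index: for a policy $\pi(\cdot)$ and initial state $\overline x$, $J(\pi(\cdot);\overline x):=\sum_{t=0}^\infty\tfrac12x(t)^\top Qx(t)+\tfrac12u(t)^\top Ru(t)$, where $x(0)=\overline x$, $u(t)=\pi(x(t))$, $x(t+1)=Ax(t)+Bu(t)$. Constants (in terms of $L,\alpha,\gamma,p$): $\gamma_F=\frac{(1-\alpha)^2}{L^2(1+L)^2}$, $\gamma_G=\frac{(1-\alpha)^2\gamma}{2L^4(1+L)^2}$, $L_P=\frac{L^3(1+L^2)}{1-\alpha^2}$, $L_H=\max(2L+1,\,L_P+1)$, $\overline\mu=\big(2L_H^2/\gamma_G+\gamma_G+L_H\big)/\gamma_F$, $\gamma_H=\Big(\frac{2}{\gamma_G}+\big(1+\frac{4L_H}{\gamma_G}+\frac{4L_H^2}{\gamma_G^2}\big)\frac{L_H(1+\overline\mu L_H)}{\gamma_F}+\overline\mu\Big)^{-1}$, $\rho=\Big(\frac{L_H^2-\gamma_H^2}{L_H^2+\gamma_H^2}\Big)^{1/2}$, $\Upsilon=\frac{L_H}{\gamma_H^2\,\rho}$, $\delta=\frac{\rho+1}{2}$,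 $\Psi=\big(\sup_{d\in\mathbb Z_{\ge0}}p(d)(\rho/\delta)^d\big)\frac{\Upsilon\delta}{1-\delta}$, $\beta=\big(1-\frac{1-\rho^2}{2\Upsilon^2}\big)^{1/2}$, $\Omega=\big(\frac{\Upsilon^2}{1-\rho^2}\big)^{1/2}$, $\overline\kappa=\frac{1}{\log\delta}\log\Big(\frac{1-\rho^2}{2\Upsilon^2\Psi L(L\Psi+2L(1+L_PL^2/\gamma))}\Big)$, $\Gamma=\frac{\Omega^2L\Psi((1+LL_P)(2L_PL^2/\gamma+\Psi)+2LL_P)}{1-\beta^2}$.
   Formalization: Condition (D) is read so that each cluster always counts as its own neighbour (''i=j or {i,j} in E''); read literally it is false: one node, no edge, D=0, A=B=Q=R=1 satisfies (U1), (U2), (D), but (a) would give ||A|| <= 0. *)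

(* Defs.v *)
From HB Require Import structures.
From mathcomp Require Import all_boot all_order all_algebra.
From mathcomp Require Import all_classical all_reals all_analysis.
Import Order.TTheory GRing.Theory Num.Theory.
Import numFieldNormedType.Exports.

Set Implicit Arguments.
Unset Strict Implicit.
Unset Printing Implicit Defensive.

Local Open Scope ring_scope.

(* MathComp-Analysis equips matrices with the max norm; the norms below are the
   Euclidean norm and the operator norm it induces. *)
Definition norm2 (F : realType) n (x : 'cV[F]_n) : F :=
  Num.sqrt (\sum_i x i 0 ^+ 2).

Definition mxnorm2 (F : realType) m n (M : 'M[F]_(m, n)) : F :=
  sup [set norm2 (M *m x) | x in [set x : 'cV[F]_n | norm2 x <= 1]]%classic.

Definition psd (F : realType) n (M : 'M[F]_n) : Prop :=
  M^T = M /\ forall x : 'cV[F]_n, 0 <= (x^T *m M *m x) 0 0.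

(* The positive semidefinite square root; meaningful when psd M, in which case
   it exists and is unique. *)
Definition psd_sqrt (F : realType) n (M : 'M[F]_n) : 'M[F]_n :=
  xget 0 [set S : 'M[F]_n | psd S /\ S *m S = M]%classic.

Definition stable (F : realType) (L alpha : F) n (Phi : 'M[F]_n) : Prop :=
  forall t : nat, mxnorm2 (Phi ^+ t) <= L * alpha ^+ t.

Definition stabilizable (F : realType) (L alpha : F) n m
    (A : 'M[F]_n) (B : 'M[F]_(n, m)) : Prop :=
  exists K : 'M[F]_(m, n), mxnorm2 K <= L /\ stable L alpha (A - B *m K).

Definition detectable (F : realType) (L alpha : F) n m
    (A : 'M[F]_n) (C : 'M[F]_(m, n)) : Prop :=
  stabilizable L alpha A^T C^T.

(* A graph on the nodes 'I_N is a symmetric irreflexive relation e. *)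

Definition walk N (e : rel 'I_N) (i j : 'I_N) (d : nat) : bool :=
  [exists w : d.-tuple 'I_N, path e i w && (last i w == j)].

(* Graph distance; None stands for +oo. *)
Definition gdist N (e : rel 'I_N) (i j : 'I_N) : option nat :=
  if pselect (exists d, walk e i j d) is left h then Some (ex_minn h) else None.

Definition gdist_le N (e : rel 'I_N) (i j : 'I_N) (k : nat) : bool :=
  if gdist e i j is Some d then (d <= k)%N else false.

(* r ^ d(i,j), with r ^ +oo = 0 *)
Definition expgdist (F : realType) (r : F) N (e : rel 'I_N) (i j : 'I_N) : F :=
  if gdist e i j is Some d then r ^+ d else 0.

Definition subexponential (F : realType) (p : nat -> F) : Prop :=
  (forall d, 0 <= p d) /\
  forall r : F, 0 < r -> r < 1 -> ((fun d => p d * r ^+ d) @ \oo --> (0 : F))%classic.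

Definition graph_sparse (F : realType) N (e : rel 'I_N) (p q : 'I_N -> nat)
    (M : forall i j, 'M[F]_(p i, q j)) : Prop :=
  forall i j, i != j -> ~~ e i j -> M i j = 0.

Definition cdim N (p : 'I_N -> nat) (S : {set 'I_N}) : nat :=
  (\sum_(i < #|S|) p (enum_val i))%N.

(* The block submatrix M_{S,T} of the block family M. *)
Definition cblock (F : realType) N (p q : 'I_N -> nat)
    (M : forall i j, 'M[F]_(p i, q j)) (S T : {set 'I_N}) :
    'M[F]_(cdim p S, cdim q T) :=
  \mxblock_(i < #|S|, j < #|T|) M (enum_val i) (enum_val j).

Definition riccati (F : realType) n m (A : 'M[F]_n) (B : 'M[F]_(n, m))
    (Q : 'M[F]_n) (R : 'M[F]_m) (P : 'M[F]_n) : Prop :=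
  P = A^T *m P *m A
      - A^T *m P *m B *m invmx (R + B^T *m P *m B) *m B^T *m P *m A + Q.

Definition Pstar (F : realType) n m (A : 'M[F]_n) (B : 'M[F]_(n, m))
    (Q : 'M[F]_n) (R : 'M[F]_m) : 'M[F]_n :=
  xget 0 [set P : 'M[F]_n | psd P /\ riccati A B Q R P]%classic.

Definition Kstar (F : realType) n m (A : 'M[F]_n) (B : 'M[F]_(n, m))
    (Q : 'M[F]_n) (R : 'M[F]_m) : 'M[F]_(m, n) :=
  let P := Pstar A B Q R in
  invmx (R + B^T *m P *m B) *m B^T *m P *m A.

Definition truncate (F : realType) N (e : rel 'I_N) (nu nx : 'I_N -> nat)
    (K : 'M[F]_(\sum_i nu i, \sum_i nx i)) (kappa : nat) :
    'M[F]_(\sum_i nu i, \sum_i nx i) :=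
  \mxblock_(i, j) (if gdist_le e i j kappa then submxblock K i j else 0).

Definition trajectory (F : realType) n m (A : 'M[F]_n) (B : 'M[F]_(n, m))
    (policy : 'cV[F]_n -> 'cV[F]_m) (x0 : 'cV[F]_n) (t : nat) : 'cV[F]_n :=
  iter t (fun x => A *m x + B *m policy x) x0.

Definition stage_cost (F : realType) n m (Q : 'M[F]_n) (R : 'M[F]_m)
    (x : 'cV[F]_n) (u : 'cV[F]_m) : F :=
  2^-1 * (x^T *m Q *m x) 0 0 + 2^-1 * (u^T *m R *m u) 0 0.

Definition cost (F : realType) n m (A : 'M[F]_n) (B : 'M[F]_(n, m))
    (Q : 'M[F]_n) (R : 'M[F]_m)
    (policy : 'cV[F]_n -> 'cV[F]_m) (x0 : 'cV[F]_n) : \bar F :=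
  (\sum_(0 <= t <oo)
    (let x := trajectory A B policy x0 t in stage_cost Q R x (policy x))%:E)%E.

Definition gammaF (F : realType) (L alpha : F) : F :=
  (1 - alpha) ^+ 2 / (L ^+ 2 * (1 + L) ^+ 2).

Definition gammaG (F : realType) (L alpha gamma : F) : F :=
  (1 - alpha) ^+ 2 * gamma / (2 * L ^+ 4 * (1 + L) ^+ 2).

Definition LP (F : realType) (L alpha : F) : F :=
  L ^+ 3 * (1 + L ^+ 2) / (1 - alpha ^+ 2).

Definition LH (F : realType) (L alpha : F) : F :=
  Num.max (2 * L + 1) (LP L alpha + 1).

Definition mubar (F : realType) (L alpha gamma : F) : F :=
  let gF := gammaF L alpha in
  let gG := gammaG L alpha gamma in
  let lH := LH L alpha in
  (2 * lH ^+ 2 / gG + gG + lH) / gF.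

Definition gammaH (F : realType) (L alpha gamma : F) : F :=
  let gF := gammaF L alpha in
  let gG := gammaG L alpha gamma in
  let lH := LH L alpha in
  let mu := mubar L alpha gamma in
  (2 / gG
   + (1 + 4 * lH / gG + 4 * lH ^+ 2 / gG ^+ 2) * (lH * (1 + mu * lH) / gF)
   + mu)^-1.

Definition rho (F : realType) (L alpha gamma : F) : F :=
  let lH := LH L alpha in
  let gH := gammaH L alpha gamma in
  Num.sqrt ((lH ^+ 2 - gH ^+ 2) / (lH ^+ 2 + gH ^+ 2)).

Definition Upsilon (F : realType) (L alpha gamma : F) : F :=
  LH L alpha / (gammaH L alpha gamma ^+ 2 * rho L alpha gamma).

Definition delta (F : realType) (L alpha gamma : F) : F :=
  (rho L alpha gamma + 1) / 2.

Definition Psi (F : realType) (L alpha gamma : F) (p : nat -> F) : F :=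
  let r := rho L alpha gamma in
  let d := delta L alpha gamma in
  sup (range (fun n : nat => p n * (r / d) ^+ n))
  * (Upsilon L alpha gamma * d / (1 - d)).

Definition beta (F : realType) (L alpha gamma : F) : F :=
  Num.sqrt
    (1 - (1 - rho L alpha gamma ^+ 2) / (2 * Upsilon L alpha gamma ^+ 2)).

Definition Omega (F : realType) (L alpha gamma : F) : F :=
  Num.sqrt (Upsilon L alpha gamma ^+ 2 / (1 - rho L alpha gamma ^+ 2)).

Definition kappabar (F : realType) (L alpha gamma : F) (p : nat -> F) : F :=
  let ps := Psi L alpha gamma p in
  (ln (delta L alpha gamma))^-1
  * ln ((1 - rho L alpha gamma ^+ 2)
        / (2 * Upsilon L alpha gamma ^+ 2 * ps * L
           * (L * ps + 2 * L * (1 + LP L alpha * L ^+ 2 / gamma)))).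

Definition Gamma (F : realType) (L alpha gamma : F) (p : nat -> F) : F :=
  let ps := Psi L alpha gamma p in
  let lP := LP L alpha in
  Omega L alpha gamma ^+ 2 * L * ps
  * ((1 + L * lP) * (2 * lP * L ^+ 2 / gamma + ps) + 2 * L * lP)
  / (1 - beta L alpha gamma ^+ 2).

(* The index set of the clusters is the partition Pi itself. *)

Definition condU1 (F : realType) N (nx nu : 'I_N -> nat) (Pi : {set {set 'I_N}})
    (B : forall i j, 'M[F]_(nx i, nu j)) (Q : forall i j, 'M[F]_(nx i, nx j))
    (R : forall i j, 'M[F]_(nu i, nu j)) : Prop :=
  forall S T, S \in Pi -> T \in Pi -> S != T ->
    [/\ cblock Q S T = 0, cblock R S T = 0 & cblock B S T = 0].

Definition condU2 (F : realType) (L0 : F) N (nx nu : 'I_N -> nat)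
    (Pi : {set {set 'I_N}})
    (A : forall i j, 'M[F]_(nx i, nx j)) (B : forall i j, 'M[F]_(nx i, nu j))
    (Q : forall i j, 'M[F]_(nx i, nx j)) (R : forall i j, 'M[F]_(nu i, nu j)) :
    Prop :=
  forall S T, S \in Pi -> T \in Pi ->
    [/\ mxnorm2 (cblock Q S T) <= L0, mxnorm2 (cblock R S T) <= L0,
        mxnorm2 (cblock A S T) <= L0 & mxnorm2 (cblock B S T) <= L0].

Definition condU3 (F : realType) (gamma0 : F) N (nu : 'I_N -> nat)
    (Pi : {set {set 'I_N}}) (R : forall i j, 'M[F]_(nu i, nu j)) : Prop :=
  forall S, S \in Pi -> psd (cblock R S S - gamma0%:M).

Definition condU4 (F : realType) (L0 alpha0 : F) N (nx nu : 'I_N -> nat)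
    (Pi : {set {set 'I_N}})
    (A : forall i j, 'M[F]_(nx i, nx j)) (B : forall i j, 'M[F]_(nx i, nu j)) :
    Prop :=
  forall S, S \in Pi ->
    stabilizable L0 alpha0 (cblock A S S) (cblock B S S) /\
    forall T, T \in Pi -> T != S ->
      exists K : 'M[F]_(cdim nu S, cdim nx T),
        mxnorm2 K <= L0 /\ cblock A S T = cblock B S S *m K.

Definition condU5 (F : realType) (L0 alpha0 : F) N (nx : 'I_N -> nat)
    (Pi : {set {set 'I_N}})
    (A : forall i j, 'M[F]_(nx i, nx j)) (Q : forall i j, 'M[F]_(nx i, nx j)) :
    Prop :=
  forall S, S \in Pi ->
    [/\ psd (cblock Q S S),
        detectable L0 alpha0 (cblock A S S) (psd_sqrt (cblock Q S S)) &
        forall T, T \in Pi -> T != S ->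
          exists K : 'M[F]_(cdim nx T, cdim nx S),
            mxnorm2 K <= L0 /\ cblock A T S = K *m psd_sqrt (cblock Q S S)].

(* As in graph_sparse, a node counts as adjacent to itself, so a cluster is one
   of its own neighbours and D bounds the number of possibly nonzero blocks
   A_{S,T} for given S.  If S were counted only when it contains an edge,
   L0 * D would not bound the norms: one node, no edge, D = 0, A = 1. *)
Definition condD N (e : rel 'I_N) (Pi : {set {set 'I_N}}) (D : nat) : Prop :=
  forall S, S \in Pi ->
    (#|[set T in Pi | [exists i in S, exists j in T, (i == j) || e i j]]|
       <= D)%N.

(* Main.v *)
Require Import Defs.
From HB Require Import structures.
From mathcomp Require Import all_boot all_order all_algebra.
From mathcomp Require Import all_classical all_reals all_analysis.
From mathcomp Require Import ring lra zify.
Import Order.TTheory GRing.Theory Num.Theory.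
Import numFieldNormedType.Exports.

Local Open Scope ring_scope.

(* Clusters.  Selecting the coordinates of the clusters (or of the nodes) yields
   matrices E_S with E_S E_S^T = 1 and sum_S E_S^T E_S = 1.  A Schur test on the
   blocks gives the norm bounds; the feedback that cancels the off-diagonal blocks
   of A makes the closed loop block diagonal, and detectability is the dual
   statement.

   Decay.  Let P = Pstar and Phi = A - B K.  For every horizon T the optimality
   system of the problem with terminal cost P has a symmetric matrix H with
   gammaH |v| <= |H v| <= LH |v|, and it is solved by x_t = Phi^t x_0, u_t = - K x_t
   with multipliers - P x_t.  Writing X = 1 - 2 H^2 / (LH^2 + gammaH^2), which has
   norm at most rho^2, one has
   v = X^k v + 2 / (LH^2 + gammaH^2) * sum_(j < k) X^j H (H v).
   H has bandwidth one in space and, since P only appears at time T, in time; so the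
   components of v at distance d >= 2 k from the source H v are those of X^k v,
   hence of order rho^d.  Distance in space bounds the blocks of K, distance in time
   bounds Phi^t; the horizon only has to exceed the distance, so no limit in T is
   needed.

   Truncation.  K - K^kappa is small by the Schur test.  A Lyapunov function of Phi
   is still one for A - B K^kappa, and completing the square in the cost with P
   expresses the loss of optimality as a sum over the perturbed trajectory. *)

Set Implicit Arguments.
Unset Strict Implicit.
Unset Printing Implicit Defensive.

(** * Euclidean norms and positive semidefinite matrices *)

(** Squaring is forced because H is indefinite: only H^2 has its spectrum on one side of 0. Each
    factor H^2 costs two steps of bandwidth, hence the even indices [k.*2] and the factor 1 / rho in
    [Upsilon]. The lower bound on |H v| is where system theory enters: stabilizability gives a
    bounded right inverse of the dynamics ([gammaF]), and detectability gives coercivity of the cost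
    on trajectories starting at 0 ([gammaG]). Both bounds must be uniform in T. The terminal weight
    P is dense in space, which is harmless as long as no signal started at time 0 reaches time T.

    [Pstar] and [psd_sqrt] are choices from a set, so existence must be shown for both. For roots
    uniqueness matters as well, since the root of a block diagonal Q has to be identified block by
    block. Both objects are monotone limits of symmetric matrices. No eigenvalues appear: spectral
    estimates are inequalities between quadratic forms, and polarization turns a bound on |<X v, v>|
    into one on |X v|. *)

Section Euclid.
Variable F : realType.

Definition dot n (x y : 'cV[F]_n) : F := (x^T *m y) 0 0.

Lemma dotE n (x y : 'cV[F]_n) : dot x y = \sum_i x i 0 * y i 0.
Proof. by rewrite /dot mxE; apply: eq_bigr => i _; rewrite mxE. Qed.

Lemma dotC n (x y : 'cV[F]_n) : dot x y = dot y x.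
Proof. by rewrite !dotE; apply: eq_bigr => i _; rewrite mulrC. Qed.

Lemma dotDl n (x y z : 'cV[F]_n) : dot (x + y) z = dot x z + dot y z.
Proof. by rewrite /dot linearD mulmxDl mxE. Qed.

Lemma dotZl n a (x z : 'cV[F]_n) : dot (a *: x) z = a * dot x z.
Proof. by rewrite /dot linearZ -scalemxAl mxE. Qed.

Lemma dotDr n (x y z : 'cV[F]_n) : dot z (x + y) = dot z x + dot z y.
Proof. by rewrite /dot mulmxDr mxE. Qed.

Lemma dotZr n a (x z : 'cV[F]_n) : dot z (a *: x) = a * dot z x.
Proof. by rewrite /dot -scalemxAr mxE. Qed.

Lemma dotNl n (x z : 'cV[F]_n) : dot (- x) z = - dot x z.
Proof. by rewrite -scaleN1r dotZl mulN1r. Qed.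

Lemma dotNr n (x z : 'cV[F]_n) : dot z (- x) = - dot z x.
Proof. by rewrite -scaleN1r dotZr mulN1r. Qed.

Lemma dotBl n (x y z : 'cV[F]_n) : dot (x - y) z = dot x z - dot y z.
Proof. by rewrite dotDl dotNl. Qed.

Lemma dotBr n (x y z : 'cV[F]_n) : dot z (x - y) = dot z x - dot z y.
Proof. by rewrite dotDr dotNr. Qed.

Lemma dot0l n (z : 'cV[F]_n) : dot 0 z = 0.
Proof. by rewrite -(scale0r 0) dotZl mul0r. Qed.

Lemma dot0r n (z : 'cV[F]_n) : dot z 0 = 0.
Proof. by rewrite dotC dot0l. Qed.

Lemma dot_sumr n I (r : seq I) (P : pred I) (f : I -> 'cV[F]_n) z :
  dot z (\sum_(i <- r | P i) f i) = \sum_(i <- r | P i) dot z (f i).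
Proof.
by elim/big_rec2: _ => [|i a b _ <-]; rewrite ?dot0r ?dotDr.
Qed.

Lemma dotM m n (M : 'M[F]_(m, n)) x y : dot (M *m x) y = dot x (M^T *m y).
Proof. by rewrite /dot trmx_mul mulmxA. Qed.

Lemma dot_quad n (M : 'M[F]_n) x : (x^T *m M *m x) 0 0 = dot x (M *m x).
Proof. by rewrite /dot mulmxA. Qed.

Lemma dot_ge0 n (x : 'cV[F]_n) : 0 <= dot x x.
Proof. by rewrite dotE sumr_ge0// => i _; rewrite -expr2 sqr_ge0. Qed.

Lemma norm2_dot n (x : 'cV[F]_n) : norm2 x = Num.sqrt (dot x x).
Proof. by rewrite dotE. Qed.

Lemma norm2_ge0 n (x : 'cV[F]_n) : 0 <= norm2 x.
Proof. exact: sqrtr_ge0. Qed.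

Lemma sqr_norm2 n (x : 'cV[F]_n) : norm2 x ^+ 2 = dot x x.
Proof. by rewrite norm2_dot sqr_sqrtr ?dot_ge0. Qed.

Lemma dot_eq0 n (x : 'cV[F]_n) : dot x x = 0 -> x = 0.
Proof.
rewrite dotE => /eqP; rewrite psumr_eq0; last first.
  by move=> i _; rewrite -expr2 sqr_ge0.
move=> /allP h; apply/matrixP => i j; rewrite ord1 mxE.
by have := h i (mem_index_enum _); rewrite /= mulf_eq0 orbb => /eqP.
Qed.

Lemma norm2_eq0 n (x : 'cV[F]_n) : norm2 x = 0 -> x = 0.
Proof. by move=> h; apply: dot_eq0; rewrite -sqr_norm2 h expr0n. Qed.

Lemma norm20 n : norm2 (0 : 'cV[F]_n) = 0.
Proof. by rewrite norm2_dot dot0l sqrtr0. Qed.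

Lemma norm2Z n a (x : 'cV[F]_n) : norm2 (a *: x) = `|a| * norm2 x.
Proof.
by rewrite !norm2_dot dotZl dotZr mulrA -expr2 sqrtrM ?sqr_ge0// sqrtr_sqr.
Qed.

Lemma norm2N n (x : 'cV[F]_n) : norm2 (- x) = norm2 x.
Proof. by rewrite -scaleN1r norm2Z normrN1 mul1r. Qed.

Lemma CauchySchwarz_dot n (x y : 'cV[F]_n) : dot x y <= norm2 x * norm2 y.
Proof.
have [/norm2_eq0->|x0] := eqVneq (norm2 x) 0; first by rewrite dot0l norm20 mul0r.
have [/norm2_eq0->|y0] := eqVneq (norm2 y) 0; first by rewrite dot0r norm20 mulr0.
have xp : 0 < norm2 x by rewrite lt_neqAle eq_sym x0 norm2_ge0.
have yp : 0 < norm2 y by rewrite lt_neqAle eq_sym y0 norm2_ge0.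
have := dot_ge0 (norm2 y *: x - norm2 x *: y).
rewrite !dotBl !dotBr !dotZl !dotZr -!sqr_norm2 (dotC y x) => h.
have h' : 0 <= (2 * norm2 x * norm2 y) * (norm2 x * norm2 y - dot x y) by lra.
by move: h'; rewrite pmulr_rge0 ?subr_ge0 ?mulr_gt0.
Qed.

Lemma normr_dot n (x y : 'cV[F]_n) : `|dot x y| <= norm2 x * norm2 y.
Proof.
rewrite ler_norml lerNl CauchySchwarz_dot andbT -dotNl -(norm2N x).
exact: CauchySchwarz_dot.
Qed.

Lemma ler_norm2D n (x y : 'cV[F]_n) : norm2 (x + y) <= norm2 x + norm2 y.
Proof.
rewrite -(@ler_pXn2r _ 2)// ?nnegrE ?addr_ge0 ?norm2_ge0//.
rewrite sqrrD !sqr_norm2 !dotDl !dotDr (dotC y x).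
have := CauchySchwarz_dot x y; lra.
Qed.

Lemma ler_norm2_sum n I (r : seq I) (P : pred I) (f : I -> 'cV[F]_n) :
  norm2 (\sum_(i <- r | P i) f i) <= \sum_(i <- r | P i) norm2 (f i).
Proof.
elim/big_rec2: _ => [|i a b _ h]; first by rewrite norm20.
by rewrite (le_trans (ler_norm2D _ _))// lerD2l.
Qed.

(** [sup] is an upper bound only for sets that are bounded. Coordinates of a vector in the unit ball
    are at most 1 in absolute value, so the column norms add up to a bound. *)
Lemma mxnorm2_has_sup m n (M : 'M[F]_(m, n)) :
  has_sup [set norm2 (M *m x) | x in [set x : 'cV[F]_n | norm2 x <= 1]]%classic.
Proof.
split; first by exists (norm2 (M *m 0)), 0 => //=; rewrite norm20 ler01.
exists (\sum_j norm2 (col j M)) => _ /= [x x1 <-].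
have -> : M *m x = \sum_j x j 0 *: col j M.
  apply/matrixP => i k; rewrite ord1 mxE summxE; apply: eq_bigr => j _.
  by rewrite !mxE mulrC.
apply: (le_trans (ler_norm2_sum _ _ _)); apply: ler_sum => j _.
rewrite norm2Z ler_piMl ?norm2_ge0//; apply: le_trans x1.
rewrite -sqrtr_sqr norm2_dot ler_wsqrtr// dotE (bigD1 j)//= expr2 lerDl.
by rewrite sumr_ge0// => i _; rewrite -expr2 sqr_ge0.
Qed.

Lemma mxnorm2_ge0 m n (M : 'M[F]_(m, n)) : 0 <= mxnorm2 M.
Proof.
apply: (le_trans (norm2_ge0 (M *m 0))).
apply: ub_le_sup; first exact: (mxnorm2_has_sup M).2.
by exists 0 => //=; rewrite norm20 ler01.
Qed.

Lemma norm2_mulmx m n (M : 'M[F]_(m, n)) x :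
  norm2 (M *m x) <= mxnorm2 M * norm2 x.
Proof.
have [/norm2_eq0->|x0] := eqVneq (norm2 x) 0.
  by rewrite mulmx0 !norm20 mulr0.
have xp : 0 < norm2 x by rewrite lt_neqAle eq_sym x0 norm2_ge0.
rewrite -ler_pdivrMr// -[X in X <= _](_ : norm2 (M *m ((norm2 x)^-1 *: x)) = _).
  apply: ub_le_sup; first exact: (mxnorm2_has_sup M).2.
  exists ((norm2 x)^-1 *: x) => //=.
  by rewrite norm2Z ger0_norm ?invr_ge0 ?norm2_ge0// mulVf.
by rewrite -scalemxAr norm2Z ger0_norm ?invr_ge0 ?norm2_ge0// mulrC.
Qed.

Lemma norm2_mulmx_le m n (M : 'M[F]_(m, n)) c x :
  mxnorm2 M <= c -> norm2 (M *m x) <= c * norm2 x.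
Proof.
by move=> h; rewrite (le_trans (norm2_mulmx _ _))// ler_wpM2r ?norm2_ge0.
Qed.

Lemma mxnorm2_le m n (M : 'M[F]_(m, n)) c :
  0 <= c -> (forall x, norm2 (M *m x) <= c * norm2 x) -> mxnorm2 M <= c.
Proof.
move=> c0 h; apply: ge_sup; first exact: (mxnorm2_has_sup M).1.
move=> _ /= [x x1 <-]; apply: (le_trans (h x)).
by rewrite -[leRHS]mulr1 ler_wpM2l.
Qed.

Lemma mxnorm20 m n : mxnorm2 (0 : 'M[F]_(m, n)) = 0.
Proof.
apply/eqP; rewrite eq_le mxnorm2_ge0 andbT mxnorm2_le// => x.
by rewrite mul0mx norm20 mul0r.
Qed.

Lemma mxnorm2M m n p (M : 'M[F]_(m, n)) (M' : 'M[F]_(n, p)) :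
  mxnorm2 (M *m M') <= mxnorm2 M * mxnorm2 M'.
Proof.
apply: mxnorm2_le => [|x]; first by rewrite mulr_ge0 ?mxnorm2_ge0.
rewrite -mulmxA -mulrA (le_trans (norm2_mulmx _ _))//.
by rewrite ler_wpM2l ?mxnorm2_ge0// norm2_mulmx.
Qed.

Lemma mxnorm2M_le m n p (M : 'M[F]_(m, n)) (M' : 'M[F]_(n, p)) a b :
  mxnorm2 M <= a -> mxnorm2 M' <= b -> mxnorm2 (M *m M') <= a * b.
Proof.
by move=> ha hb; rewrite (le_trans (mxnorm2M _ _))// ler_pM ?mxnorm2_ge0.
Qed.

Lemma mxnorm2D m n (M M' : 'M[F]_(m, n)) :
  mxnorm2 (M + M') <= mxnorm2 M + mxnorm2 M'.
Proof.
apply: mxnorm2_le => [|x]; first by rewrite addr_ge0 ?mxnorm2_ge0.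
rewrite mulmxDl mulrDl (le_trans (ler_norm2D _ _))//.
by rewrite lerD ?norm2_mulmx.
Qed.

Lemma mxnorm2N m n (M : 'M[F]_(m, n)) : mxnorm2 (- M) = mxnorm2 M.
Proof.
by congr sup; apply: eq_imagel => x _; rewrite mulNmx norm2N.
Qed.

Lemma dot_mxnorm2 m n (M : 'M[F]_(m, n)) c x y : mxnorm2 M <= c ->
  `|dot x (M *m y)| <= c * norm2 x * norm2 y.
Proof.
move=> h; rewrite (le_trans (normr_dot _ _))// mulrAC mulrC.
by rewrite ler_wpM2r ?norm2_ge0 ?norm2_mulmx_le.
Qed.

(** |M^T y|^2 = <M M^T y, y> <= |M| |M^T y| |y|, divided by |M^T y|. *)
Lemma mxnorm2_tr_le m n (M : 'M[F]_(m, n)) : mxnorm2 M^T <= mxnorm2 M.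
Proof.
apply: mxnorm2_le => [|y]; first exact: mxnorm2_ge0.
have [->|y0] := eqVneq (norm2 (M^T *m y)) 0.
  by rewrite mulr_ge0 ?mxnorm2_ge0 ?norm2_ge0.
have yp : 0 < norm2 (M^T *m y) by rewrite lt_neqAle eq_sym y0 norm2_ge0.
rewrite -(ler_pM2l yp) -expr2 sqr_norm2 -dotM.
rewrite (le_trans (CauchySchwarz_dot _ _))//.
rewrite mulrA ler_wpM2r ?norm2_ge0//.
by rewrite [leRHS]mulrC norm2_mulmx.
Qed.

Lemma mxnorm2_tr m n (M : 'M[F]_(m, n)) : mxnorm2 M^T = mxnorm2 M.
Proof.
by apply/eqP; rewrite eq_le mxnorm2_tr_le -{1}[M]trmxK mxnorm2_tr_le.
Qed.

Lemma sqr_le_norm2 m n (x : 'cV[F]_m) (y : 'cV[F]_n) c : 0 <= c ->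
  dot x x <= c ^+ 2 * dot y y -> norm2 x <= c * norm2 y.
Proof.
move=> c0; rewrite -!sqr_norm2 -exprMn ler_pXn2r// ?nnegrE ?mulr_ge0 ?norm2_ge0//.
Qed.

Lemma norm2_le_sqr m n (x : 'cV[F]_m) (y : 'cV[F]_n) c : 0 <= c ->
  norm2 x <= c * norm2 y -> dot x x <= c ^+ 2 * dot y y.
Proof.
by move=> c0 h; rewrite -!sqr_norm2 -exprMn lerXn2r ?nnegrE ?mulr_ge0 ?norm2_ge0.
Qed.

Lemma psd_sym n (M : 'M[F]_n) : psd M -> M^T = M.
Proof. by case. Qed.

Lemma psd_ge0 n (M : 'M[F]_n) x : psd M -> 0 <= dot x (M *m x).
Proof. by move=> [_ /(_ x)]; rewrite dot_quad. Qed.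

Lemma psdP n (M : 'M[F]_n) :
  M^T = M -> (forall x, 0 <= dot x (M *m x)) -> psd M.
Proof. by move=> hs h; split => // x; rewrite dot_quad. Qed.

Lemma dot_symmx n (M : 'M[F]_n) x y : M^T = M -> dot x (M *m y) = dot y (M *m x).
Proof. by move=> s; rewrite dotC dotM s. Qed.

Lemma quad_inj n (M M' : 'M[F]_n) : M^T = M -> M'^T = M' ->
  (forall x, dot x (M *m x) = dot x (M' *m x)) -> M = M'.
Proof.
move=> s s' h; have hb x y : dot x (M *m y) = dot x (M' *m y).
  have := h (x + y); rewrite !mulmxDr !dotDl !dotDr !h (dot_symmx y x s).
  by rewrite (dot_symmx y x s'); lra.
apply/matrixP => i j.
have := hb (delta_mx i 0) (delta_mx j 0).
by rewrite -!colE /dot trmx_delta -!rowE !mxE.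
Qed.

Lemma psd0 n : psd (0 : 'M[F]_n).
Proof. by apply: psdP => [|x]; rewrite ?trmx0// mul0mx dot0r. Qed.

Lemma psdD n (M M' : 'M[F]_n) : psd M -> psd M' -> psd (M + M').
Proof.
move=> h h'; apply: psdP => [|x].
  by rewrite linearD /= (psd_sym h) (psd_sym h').
by rewrite mulmxDl dotDr addr_ge0 ?psd_ge0.
Qed.

Lemma psdZ n a (M : 'M[F]_n) : 0 <= a -> psd M -> psd (a *: M).
Proof.
move=> a0 h; apply: psdP => [|x]; first by rewrite linearZ /= (psd_sym h).
by rewrite -scalemxAl dotZr mulr_ge0 ?psd_ge0.
Qed.

Lemma psd_congr m n (M : 'M[F]_m) (W : 'M[F]_(m, n)) : psd M -> psd (W^T *m M *m W).
Proof.
move=> h; apply: psdP => [|x].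
  by rewrite !trmx_mul trmxK (psd_sym h) mulmxA.
by rewrite -!mulmxA -dotM psd_ge0.
Qed.

Lemma psd_subge n (M : 'M[F]_n) g x :
  psd (M - g%:M) -> g * dot x x <= dot x (M *m x).
Proof.
move=> /(psd_ge0 x); rewrite mulmxBl dotBr mul_scalar_mx dotZr; lra.
Qed.

Lemma unitmx_inj n (M : 'M[F]_n) :
  (forall x : 'cV[F]_n, M *m x = 0 -> x = 0) -> M \in unitmx.
Proof.
move=> h; rewrite -unitmx_tr -row_free_unit -kermx_eq0.
apply/eqP/row_matrixP => i; rewrite row0.
apply: trmx_inj; rewrite trmx0; apply: h; apply: trmx_inj.
by rewrite trmx0 trmx_mul trmxK -row_mul mulmx_ker row0.
Qed.

End Euclid.

(* Polarization in the degenerate inner product space given by [f]. *)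
Lemma polarization_bound (F : realType) (V : lmodType F) (f : V -> V -> F)
    (X : V -> V) r :
  (forall u v w, f (u + v) w = f u w + f v w) ->
  (forall a u v, f (a *: u) v = a * f u v) ->
  (forall u v, f u v = f v u) ->
  (forall u v, X (u + v) = X u + X v) -> (forall a u, X (a *: u) = a *: X u) ->
  (forall u v, f (X u) v = f u (X v)) ->
  0 < r -> (forall v, `|f (X v) v| <= r * f v v) ->
  forall v, f (X v) (X v) <= r ^+ 2 * f v v.
Proof.
move=> fD fZ fC XD XZ Xs r0 hX v.
have fDr u w z : f u (w + z) = f u w + f u z by rewrite fC fD !(fC u).
have fZr a u w : f u (a *: w) = a * f u w by rewrite fC fZ (fC u).
have XN u : X (- u) = - X u by rewrite -scaleN1r XZ scaleN1r.
have fN u w : f (- u) w = - f u w by rewrite -scaleN1r fZ mulN1r.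
have fNr u w : f u (- w) = - f u w by rewrite fC fN (fC u).
(* The form bound is tested at v + w and v - w. This scaling of w makes the difference of the two
   bounds read 2 |X v|^2 <= r^2 |v|^2 + |X v|^2 after multiplication by r. *)
set w := r^-1 *: X v.
have h1 := hX (v + w); have h2 := hX (v - w).
move: h1 h2; rewrite !XD !XN !fD !fDr !fN !fNr !ler_norml => /andP[_ h1] /andP[h2 _].
have e1 : f (X w) v = f (X v) w by rewrite Xs fC.
have e2 : f w v = f v w by rewrite fC.
have h3 : 2 * f (X v) w <= r * (f v v + f w w) by rewrite e1 e2 in h1 h2; lra.
have ew : f (X v) w = r^-1 * f (X v) (X v) by rewrite /w fZr.
have eww : f w w = r^-1 * (r^-1 * f (X v) (X v)) by rewrite /w fZ fZr.
rewrite ew eww in h3.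
have rn : r != 0 by rewrite gt_eqF.
have := ler_wpM2l (ltW r0) h3.
have -> : r * (2 * (r^-1 * f (X v) (X v))) = 2 * f (X v) (X v) by field.
have -> : r * (r * (f v v + r^-1 * (r^-1 * f (X v) (X v)))) =
  r ^+ 2 * f v v + f (X v) (X v) by field.
lra.
Qed.

(** * Monotone limits of matrices and square roots *)

Section MatrixLimits.
Variable F : realType.

Definition mcvg m n (u : nat -> 'M[F]_(m, n)) (M : 'M[F]_(m, n)) :=
  forall i j, ((fun k => u k i j) @ \oo --> M i j)%classic.

Lemma mcvg_cst m n (M : 'M[F]_(m, n)) : mcvg (fun=> M) M.
Proof. by move=> i j; exact: cvg_cst. Qed.

Lemma mcvgD m n (u v : nat -> 'M[F]_(m, n)) M M' :
  mcvg u M -> mcvg v M' -> mcvg (fun k => u k + v k) (M + M').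
Proof.
move=> hu hv i j; rewrite mxE; under eq_fun do rewrite mxE.
exact: cvgD.
Qed.

Lemma cvgn_sum I (r : seq I) (f : I -> nat -> F) (g : I -> F) :
  (forall i, (f i k @[k --> \oo] --> g i)%classic) ->
  ((fun k => \sum_(i <- r) f i k) @ \oo --> \sum_(i <- r) g i)%classic.
Proof.
move=> hf; elim: r => [|i r IH].
  by rewrite big_nil; under [X in (X @ _)%classic]eq_fun do rewrite big_nil; exact: cvg_cst.
rewrite big_cons; under [X in (X @ _)%classic]eq_fun do rewrite big_cons.
exact: cvgD.
Qed.

Lemma mcvgM m n p (u : nat -> 'M[F]_(m, n)) (v : nat -> 'M[F]_(n, p)) M M' :
  mcvg u M -> mcvg v M' -> mcvg (fun k => u k *m v k) (M *m M').
Proof.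
move=> hu hv i j; rewrite mxE; under eq_fun do rewrite mxE.
by apply: cvgn_sum => k; apply: cvgM.
Qed.

Lemma mcvgZ m n a (u : nat -> 'M[F]_(m, n)) M :
  mcvg u M -> mcvg (fun k => a *: u k) (a *: M).
Proof.
move=> hu i j; rewrite mxE; under eq_fun do rewrite mxE.
by apply: cvgM => //; exact: cvg_cst.
Qed.

Lemma mcvg_tr m n (u : nat -> 'M[F]_(m, n)) M :
  mcvg u M -> mcvg (fun k => (u k)^T) M^T.
Proof. by move=> hu i j; rewrite mxE; under eq_fun do rewrite mxE; exact: hu. Qed.

Lemma mcvg_uniq m n (u : nat -> 'M[F]_(m, n)) M M' :
  mcvg u M -> mcvg u M' -> M = M'.
Proof.
by move=> h h'; apply/matrixP => i j; exact: (cvg_unique _ (h i j) (h' i j)).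
Qed.

Lemma mcvgS m n (u : nat -> 'M[F]_(m, n)) M :
  mcvg u M -> mcvg (fun k => u k.+1) M.
Proof.
move=> h i j; have := h i j.
by rewrite -(cvg_shiftS (fun k => u k i j)).
Qed.

Lemma mcvg_dot m n (u : nat -> 'M[F]_(m, n)) M x y : mcvg u M ->
  ((fun k => dot x (u k *m y)) @ \oo --> dot x (M *m y))%classic.
Proof.
move=> h; rewrite /dot.
have := mcvgM (@mcvg_cst _ _ x^T) (mcvgM h (@mcvg_cst _ _ y)).
by move=> /(_ 0 0).
Qed.

(** Each quadratic form is a bounded nondecreasing real sequence; polarization at the basis vectors
    recovers the entries from these scalar limits. *)
Lemma monotone_mcvg n (u : nat -> 'M[F]_n) (c : F) :
  (forall k, (u k)^T = u k) ->
  (forall k x, dot x (u k *m x) <= dot x (u k.+1 *m x)) ->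
  (forall k x, dot x (u k *m x) <= c * dot x x) ->
  exists M, mcvg u M.
Proof.
move=> us um ub.
have hq x : exists l, ((fun k => dot x (u k *m x)) @ \oo --> (l : F))%classic.
  exists (limn (fun k => dot x (u k *m x))).
  apply: nondecreasing_is_cvgn.
    by apply/nondecreasing_seqP => k; exact: um.
  by exists (c * dot x x) => _ [k _ <-]; exact: ub.
have /choice[q hq'] := hq.
pose d i : 'cV[F]_n := delta_mx i 0.
exists (\matrix_(i, j) (2^-1 * (q (d i + d j) - q (d i) - q (d j)))).
move=> i j; rewrite mxE.
have -> : (fun k => u k i j) = (fun k =>
    2^-1 * (dot (d i + d j) (u k *m (d i + d j)) - dot (d i) (u k *m d i)
       - dot (d j) (u k *m d j))).
  apply/funext => k.
  rewrite !mulmxDr !dotDl !dotDr (dot_symmx (d j) (d i) (us k)).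
  have -> : u k i j = dot (d i) (u k *m d j).
    by rewrite /d -colE /dot trmx_delta -rowE !mxE.
  by field.
apply: cvgM; first exact: cvg_cst.
by apply: cvgB; [apply: cvgB|]; exact: hq'.
Qed.

Lemma mcvg_sym n (u : nat -> 'M[F]_n) M :
  (forall k, (u k)^T = u k) -> mcvg u M -> M^T = M.
Proof.
move=> us h; apply: (mcvg_uniq (u := u)) => //.
rewrite (_ : u = (fun k => (u k)^T)); first exact: mcvg_tr.
by apply/funext => k; rewrite us.
Qed.

Lemma mcvg_quad_le n (u : nat -> 'M[F]_n) M x c :
  mcvg u M -> (forall k, dot x (u k *m x) <= c) -> dot x (M *m x) <= c.
Proof.
move=> h hb; by have /cvgr_to_le := @mcvg_dot _ _ _ _ x x h; apply; exact: nearW.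
Qed.

Lemma mcvg_quad_ge n (u : nat -> 'M[F]_n) M x c :
  mcvg u M -> (forall k, c <= dot x (u k *m x)) -> c <= dot x (M *m x).
Proof.
move=> h hb; by have /cvgr_to_ge := @mcvg_dot _ _ _ _ x x h; apply; exact: nearW.
Qed.

End MatrixLimits.

(** * Existence and uniqueness of positive semidefinite square roots *)

Section PsdSqrt.
Variable F : realType.

(* The matrices p(N), for p a polynomial with nonnegative coefficients. *)
Inductive ncone n (N : 'M[F]_n) : 'M[F]_n -> Prop :=
| ncone0 : ncone N 0
| nconeX a k X : 0 <= a -> ncone N X -> ncone N (a *: N ^+ k + X).

Lemma nconeD n (N X Y : 'M[F]_n) : ncone N X -> ncone N Y -> ncone N (X + Y).
Proof.
move=> hX hY; elim: hX => [|a k Z a0 _ IH]; first by rewrite add0r.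
by rewrite -addrA; apply: nconeX.
Qed.

Lemma nconeZ n (N X : 'M[F]_n) b : 0 <= b -> ncone N X -> ncone N (b *: X).
Proof.
move=> b0; elim => [|a k Z a0 _ IH]; first by rewrite scaler0; exact: ncone0.
by rewrite scalerDr scalerA; apply: nconeX => //; rewrite mulr_ge0.
Qed.

Lemma nconeM n (N X Y : 'M[F]_n) : ncone N X -> ncone N Y -> ncone N (X *m Y).
Proof.
move=> hX hY; elim: hX => [|a k Z a0 _ IH]; first by rewrite mul0mx; exact: ncone0.
rewrite mulmxDl -scalemxAl; apply: nconeD => //; apply: nconeZ => //.
elim: hY => [|b l W b0 _ IH2]; first by rewrite mulmx0; exact: ncone0.
rewrite mulmxDr -scalemxAr.
have -> : N ^+ k *m N ^+ l = N ^+ (k + l) by rewrite exprD.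
by apply: nconeX.
Qed.

Lemma ncone_id n (N : 'M[F]_n) : ncone N N.
Proof.
by rewrite -[X in ncone _ X]addr0 -[X in X + _]scale1r -[X in _ *: X]expr1;
  apply: nconeX => //; exact: ncone0.
Qed.

Lemma ncone_commutes n (N X W : 'M[F]_n) :
  comm_mx W N -> ncone N X -> comm_mx W X.
Proof.
move=> hW; elim => [|a k Z a0 _ IH]; first by rewrite /comm_mx mulmx0 mul0mx.
rewrite /comm_mx mulmxDr mulmxDl IH -scalemxAl -scalemxAr; congr (_ *: _ + _).
exact: (@commrX _ W N k hW).
Qed.

Lemma psdX n (N : 'M[F]_n) k : psd N -> psd (N ^+ k).
Proof.
move=> hN; rewrite -(odd_double_half k) exprD -addnn exprD.
have ht j : (N ^+ j)^T = N ^+ j.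
  elim: j => [|j IH]; first by rewrite expr0 [1](_ : _ = 1%:M)// trmx1.
  by rewrite exprS trmx_mul IH (psd_sym hN) -[LHS]exprSr exprS.
case: (odd k); rewrite ?expr1 ?expr0 ?mul1r.
  have -> : N * (N ^+ k./2 * N ^+ k./2) = (N ^+ k./2)^T *m N *m N ^+ k./2.
    by rewrite ht mulrA -exprS exprSr.
  exact: psd_congr.
have -> : N ^+ k./2 * N ^+ k./2 = (N ^+ k./2)^T *m 1%:M *m N ^+ k./2.
  by rewrite ht mulmx1.
by apply/psd_congr/psdP => [|x]; rewrite ?trmx1// mul1mx dot_ge0.
Qed.

Lemma ncone_psd n (N X : 'M[F]_n) : psd N -> ncone N X -> psd X.
Proof.
move=> hN; elim => [|a k Z a0 _ IH]; first exact: psd0.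
by apply: psdD => //; apply: psdZ => //; exact: psdX.
Qed.

(** Fixed point iteration for Y = (N + Y^2) / 2, an equation equivalent to (1 - Y)^2 = 1 - N. With N
    = 1 - M / c, the matrix 1 - Y is a square root of M / c. *)
Fixpoint sqrt_iter n (N : 'M[F]_n) k : 'M[F]_n :=
  if k is k'.+1 then 2^-1 *: (N + sqrt_iter N k' *m sqrt_iter N k') else 0.

Lemma sqrt_iter_ncone n (N : 'M[F]_n) k : ncone N (sqrt_iter N k).
Proof.
elim: k => [|k IH] /=; first exact: ncone0.
apply: nconeZ; first by rewrite invr_ge0.
by apply: nconeD; [exact: ncone_id|apply: nconeM].
Qed.

(** The iterates commute, so an increment is half the product of the previous increment with the sum
    of two iterates. Nonnegative coefficients are thus preserved, which makes the iteration
    monotone. *)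
Lemma sqrt_iter_incr n (N : 'M[F]_n) k :
  ncone N (sqrt_iter N k.+1 - sqrt_iter N k).
Proof.
elim: k => [|k IH].
  rewrite /= mul0mx addr0 subr0; apply: nconeZ; first by rewrite invr_ge0.
  exact: ncone_id.
have -> : sqrt_iter N k.+2 - sqrt_iter N k.+1 = 2^-1 *:
    ((sqrt_iter N k.+1 - sqrt_iter N k) *m (sqrt_iter N k.+1 + sqrt_iter N k)).
  have hc : comm_mx (sqrt_iter N k.+1) (sqrt_iter N k).
    apply: ncone_commutes (sqrt_iter_ncone _ _).
    by apply/esym/(ncone_commutes _ (sqrt_iter_ncone _ _)).
  rewrite [sqrt_iter N k.+2]/= -/(sqrt_iter N k.+1) {2}[sqrt_iter N k.+1]/=.
  rewrite -scalerBr; congr (_ *: _).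
  rewrite mulmxBl !mulmxDr hc.
  set X := _ *m _; set Y := sqrt_iter N k *m sqrt_iter N k; set Z := _ *m _.
  by rewrite opprD addrACA subrr add0r opprD addrA addrK.
apply: nconeZ; first by rewrite invr_ge0.
by apply: nconeM => //; apply: nconeD; exact: sqrt_iter_ncone.
Qed.

Lemma sqrt_iter_norm n (N : 'M[F]_n) k : mxnorm2 N <= 1 -> mxnorm2 (sqrt_iter N k) <= 1.
Proof.
move=> hN; elim: k => [|k IH]; first by rewrite mxnorm20.
apply: mxnorm2_le => //= x; rewrite -scalemxAl norm2Z mulmxDl.
rewrite ger0_norm ?invr_ge0// mul1r ler_pdivrMl//.
rewrite (le_trans (ler_norm2D _ _))// mulr_natl mulr2n.
rewrite -{1 2}(mul1r (norm2 x)); apply: lerD; apply: norm2_mulmx_le => //.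
by rewrite -(mulr1 1) mxnorm2M_le.
Qed.

Lemma sym_mxnorm2_le n (M : 'M[F]_n) r : M^T = M -> 0 < r ->
  (forall x, `|dot x (M *m x)| <= r * dot x x) -> mxnorm2 M <= r.
Proof.
move=> hs r0 h; apply: mxnorm2_le => [|x]; first exact: ltW.
apply: sqr_le_norm2; first exact: ltW.
apply: (polarization_bound (f := @dot F n) (X := mulmx M)) => //.
- by move=> u v w; rewrite dotDl.
- by move=> a u v; rewrite dotZl.
- exact: dotC.
- by move=> u v; rewrite mulmxDr.
- by move=> a u; rewrite -scalemxAr.
- by move=> u v; rewrite dotM hs.
- by move=> v; rewrite dotC.
Qed.

(** The last clause, commutation with whatever commutes with M, passes to the limit from polynomials
    in N; uniqueness rests on it. The summand 1 in [c] keeps [c] positive when M = 0. *)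
Lemma psd_sqrt_exists n (M : 'M[F]_n) : psd M ->
  exists S, [/\ psd S, S *m S = M & forall W, comm_mx W M -> comm_mx W S].
Proof.
move=> hM; pose c := mxnorm2 M + 1.
have c0 : 0 < c by rewrite ltr_wpDl ?mxnorm2_ge0.
have cn : c != 0 by rewrite gt_eqF.
pose N := 1%:M - c^-1 *: M.
have qM x : dot x (M *m x) <= c * dot x x.
  have /ler_normlW := dot_mxnorm2 x x (lexx (mxnorm2 M)).
  rewrite -mulrA -expr2 sqr_norm2 => /le_trans; apply.
  by rewrite ler_wpM2r ?dot_ge0// lerDl.
have qN x : dot x (N *m x) = dot x x - c^-1 * dot x (M *m x).
  by rewrite mulmxBl mul1mx -scalemxAl dotBr dotZr.
have qN0 x : 0 <= dot x (N *m x).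
  by rewrite qN subr_ge0 ler_pdivrMl.
have qN1 x : dot x (N *m x) <= dot x x.
  by rewrite qN gerBl mulr_ge0 ?invr_ge0 ?psd_ge0// ltW.
have hN : psd N.
  by apply: psdP => //; rewrite linearB /= trmx1 linearZ /= (psd_sym hM).
have nN : mxnorm2 N <= 1.
  apply: sym_mxnorm2_le => // [|x]; first exact: psd_sym.
  by rewrite ger0_norm// mul1r.
have sY k := psd_sym (ncone_psd hN (sqrt_iter_ncone N k)).
have bY k x : dot x (sqrt_iter N k *m x) <= 1 * dot x x.
  have /ler_normlW := dot_mxnorm2 x x (sqrt_iter_norm k nN).
  by rewrite -mulrA -expr2 sqr_norm2.
have [|Y hY] := monotone_mcvg sY _ bY.
  move=> k x; rewrite -subr_ge0 -dotBr -mulmxBl.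
  exact/psd_ge0/(ncone_psd hN)/sqrt_iter_incr.
have eY : Y = 2^-1 *: (N + Y *m Y).
  apply: mcvg_uniq (mcvgS hY) _ => /=.
  by apply/mcvgZ/mcvgD; [exact: mcvg_cst|apply: mcvgM].
have cY W : comm_mx W M -> comm_mx W Y.
  move=> hW; have hWN : comm_mx W N.
    by rewrite /comm_mx mulmxBr mulmxBl mulmx1 mul1mx -scalemxAl -scalemxAr hW.
  apply: (mcvg_uniq (u := fun k => W *m sqrt_iter N k)).
    by apply: mcvgM => //; exact: mcvg_cst.
  have -> : (fun k => W *m sqrt_iter N k) = (fun k => sqrt_iter N k *m W).
    by apply/funext => k; exact: ncone_commutes hWN (sqrt_iter_ncone _ _).
  by apply: mcvgM => //; exact: mcvg_cst.
exists (Num.sqrt c *: (1%:M - Y)); split.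
- apply: psdZ; first exact: sqrtr_ge0.
  apply: psdP => [|x]; first by rewrite linearB /= trmx1 (mcvg_sym sY hY).
  rewrite mulmxBl mul1mx dotBr subr_ge0; apply: mcvg_quad_le hY _ => k.
  by rewrite (le_trans (bY k x))// mul1r.
- rewrite -scalemxAl -scalemxAr scalerA -expr2 sqr_sqrtr ?ltW//.
  have -> : (1%:M - Y) *m (1%:M - Y) = 1%:M - N.
    rewrite mulmxBl mul1mx mulmxBr mulmx1 opprB.
    have e2 : 2 *: Y = N + Y *m Y.
      have n2 : (2 : F) != 0 by rewrite pnatr_eq0.
      by rewrite {1}eY scalerA (mulfV n2) scale1r.
    have -> : Y *m Y = 2 *: Y - N by rewrite e2 addrC addKr.
    rewrite scaler_nat mulr2n -!addrA; congr (_ + _).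
    by rewrite !addrA addNr add0r -addrA [- N + _]addrC addrA subrr add0r.
  by rewrite /N opprB addrC subrK scalerA mulfV// scale1r.
- move=> W hW; rewrite /comm_mx -scalemxAl -scalemxAr mulmxBl mulmxBr.
  by rewrite mulmx1 mul1mx (cY W hW).
Qed.

(** With D = S - S', commutation gives D (S + S') = 0. The psd matrices D S D and D S' D then add up
    to 0, so both vanish. Their difference is D^3, and a symmetric D with D^3 = 0 is 0. *)
Lemma psd_sqrt_inj n (S S' : 'M[F]_n) : psd S -> psd S' -> comm_mx S S' ->
  S *m S = S' *m S' -> S = S'.
Proof.
move=> hS hS' hc h; pose D := S - S'.
have sD : D^T = D by rewrite linearB /= (psd_sym hS) (psd_sym hS').
have hD : D *m (S + S') = 0.
  by rewrite mulmxBl !mulmxDr hc h [X in X - _]addrC subrr.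
have h0 x : dot x (D *m S *m D *m x) = 0 /\ dot x (D *m S' *m D *m x) = 0.
  have e W : dot x (D *m W *m D *m x) = dot (D *m x) (W *m (D *m x)).
    by rewrite -!mulmxA -{1}sD -dotM.
  have : dot x (D *m S *m D *m x) + dot x (D *m S' *m D *m x) = 0.
    by rewrite -dotDr -!mulmxDl -mulmxDr hD !mul0mx dot0r.
  move/eqP; rewrite !e paddr_eq0 ?psd_ge0// => /andP[/eqP-> /eqP->//].
have z W : W^T = W -> (forall x, dot x (D *m W *m D *m x) = 0) -> D *m W *m D = 0.
  move=> hW hx; apply: quad_inj => [||x]; rewrite ?trmx0// ?mul0mx ?dot0r//.
  by rewrite !trmx_mul sD hW mulmxA.
have d3 : D *m D *m D = 0.
  have -> : D *m D *m D = D *m S *m D - D *m S' *m D.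
    by rewrite -mulmxBl -mulmxBr.
  rewrite (z S (psd_sym hS)) => [|x]; last by case: (h0 x).
  by rewrite (z S' (psd_sym hS')) ?subrr// => x; case: (h0 x).
have sq0 (x : 'cV_n) : D *m (D *m x) = 0.
  by apply: dot_eq0; rewrite dotM sD !mulmxA d3 !mul0mx dot0r.
have d0 (x : 'cV_n) : D *m x = 0 by apply: dot_eq0; rewrite dotM sD sq0 dot0r.
apply/subr0_eq/quad_inj => [||x]; rewrite ?trmx0 -/D ?sD// d0 mul0mx.
by rewrite dot0r.
Qed.

Lemma psd_sqrtP n (M : 'M[F]_n) : psd M ->
  psd (psd_sqrt M) /\ psd_sqrt M *m psd_sqrt M = M.
Proof.
move=> /psd_sqrt_exists[S [hS eS _]]; rewrite /psd_sqrt.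
by case: xgetP => [? -> //|/(_ S)[]].
Qed.

(** Two arbitrary roots are not known to commute with each other. Each commutes with M, its own
    square, hence with the constructed root [S0], and is compared with that one. *)
Lemma psd_sqrt_eq n (M S : 'M[F]_n) : psd S -> S *m S = M -> psd_sqrt M = S.
Proof.
move=> hS eS; have hM : psd M.
  rewrite -eS -{1}(psd_sym hS) -[X in X *m _]mulmx1; apply: psd_congr.
  by apply: psdP => [|x]; rewrite ?trmx1// mul1mx dot_ge0.
have [S0 [hS0 eS0 cS0]] := psd_sqrt_exists hM.
have [hR eR] := psd_sqrtP hM.
have key X : psd X -> X *m X = M -> X = S0.
  move=> hX eX; apply: psd_sqrt_inj; rewrite ?eS0//.
  by apply: cS0; rewrite /comm_mx -eX mulmxA.
by rewrite (key _ hR eR) (key _ hS eS).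
Qed.

End PsdSqrt.

(** * Block decompositions *)

Section Resolutions.
Variable F : realType.

(** An orthogonal decomposition of the coordinate space. The blocks [E i *m M *m (E j)^T] are taken
    from an ordinary matrix of fixed size, so products and powers need no arithmetic of dependent
    block sizes. Nodes and clusters are both instances. *)
Definition resolution (I : finType) (P : pred I) n (d : I -> nat)
    (E : forall i, 'M[F]_(d i, n)) :=
  [/\ forall i, P i -> E i *m (E i)^T = 1%:M,
      forall i j, P i -> P j -> i != j -> E i *m (E j)^T = 0 &
      \sum_(i | P i) (E i)^T *m E i = 1%:M].

Definition selector m n (f : 'I_m -> 'I_n) : 'M[F]_(m, n) := rowsub f 1%:M.

Lemma selector_mul m n p (f : 'I_m -> 'I_n) (M : 'M[F]_(n, p)) :
  selector f *m M = rowsub f M.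
Proof. by rewrite mul_rowsub_mx mul1mx. Qed.

Lemma selector_mxsub m n m' n' (f : 'I_m' -> 'I_m) (g : 'I_n' -> 'I_n)
    (M : 'M[F]_(m, n)) : selector f *m M *m (selector g)^T = mxsub f g M.
Proof.
rewrite selector_mul; apply: trmx_inj; rewrite trmx_mul trmxK selector_mul.
by apply/matrixP => i j; rewrite !mxE.
Qed.

Lemma resolution_selector (I : finType) (P : pred I) n (d : I -> nat)
    (f : forall i, 'I_(d i) -> 'I_n) :
  (forall a, exists i b, P i /\ f i b = a) ->
  (forall i j b c, P i -> P j -> f i b = f j c ->
    Tagged (fun i => 'I_(d i)) b = Tagged (fun i => 'I_(d i)) c) ->
  resolution P (fun i => selector (f i)).
Proof.
move=> hs hi.
have h i j b c : (selector (f i) *m (selector (f j))^T) b c = (f i b == f j c)%:R.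
  by rewrite selector_mul !mxE eq_sym.
have h1 i : P i -> selector (f i) *m (selector (f i))^T = 1%:M.
  move=> Pi; apply/matrixP => b c; rewrite h !mxE; congr ((nat_of_bool _)%:R).
  apply/eqP/eqP => [/(hi _ _ _ _ Pi Pi)/eqP|->//].
  by rewrite eq_Tagged => /eqP.
have h2 i j : P i -> P j -> i != j -> selector (f i) *m (selector (f j))^T = 0.
  move=> Pi Pj ij; apply/matrixP => b c; rewrite h mxE.
  case: eqP => // /(hi _ _ _ _ Pi Pj) /(congr1 tag) /= e.
  by rewrite e eqxx in ij.
split=> //; set Z := \sum_(i | _) _.
(* Every selector absorbs Z, and every row index is selected by some [f i]; so Z agrees with the
   identity row by row. *)
have hZ i : P i -> selector (f i) *m Z = selector (f i).
  move=> Pi; rewrite /Z mulmx_sumr (bigD1 i)//= mulmxA h1// mul1mx.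
  rewrite big1 ?addr0// => j /andP[Pj ji].
  by rewrite mulmxA h2 1?eq_sym// mul0mx.
apply/matrixP => a a'; have [i [b [Pi <-]]] := hs a.
have /matrixP/(_ b a') := hZ _ Pi; rewrite selector_mul !mxE.
by move=> ->.
Qed.

Section Schur.
Variables (I J : finType) (P : pred I) (P' : pred J) (m n : nat).
Variables (d : I -> nat) (d' : J -> nat).
Variables (E : forall i, 'M[F]_(d i, m)) (E' : forall j, 'M[F]_(d' j, n)).
Hypotheses (hE : resolution P E) (hE' : resolution P' E').

Lemma resolution_dot x : dot x x = \sum_(i | P i) dot (E i *m x) (E i *m x).
Proof.
have [_ _ h] := hE; rewrite -{2}[x]mul1mx -h mulmx_suml dot_sumr.
by apply: eq_bigr => i _; rewrite -mulmxA dotM.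
Qed.

Lemma resolution_split p (M : 'M[F]_(m, p)) :
  M = \sum_(i | P i) (E i)^T *m (E i *m M).
Proof.
have [_ _ h] := hE; rewrite -[LHS]mul1mx -h mulmx_suml.
by apply: eq_bigr => i _; rewrite mulmxA.
Qed.

Lemma resolution_inj p (M M' : 'M[F]_(m, p)) :
  (forall i, P i -> E i *m M = E i *m M') -> M = M'.
Proof.
move=> h; rewrite [M]resolution_split [M']resolution_split.
by apply: eq_bigr => i Pi; rewrite h.
Qed.

End Schur.

Lemma resolution_inj2 (I J : finType) (P : pred I) (P' : pred J) m n
    (d : I -> nat) (d' : J -> nat)
    (E : forall i, 'M[F]_(d i, m)) (E' : forall j, 'M[F]_(d' j, n))
    (M M' : 'M[F]_(m, n)) : resolution P E -> resolution P' E' ->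
  (forall i j, P i -> P' j -> E i *m M *m (E' j)^T = E i *m M' *m (E' j)^T) ->
  M = M'.
Proof.
move=> hE hE' h; apply: (resolution_inj hE) => i Pi; apply: trmx_inj.
apply: (resolution_inj hE') => j Pj; apply: trmx_inj.
by rewrite !trmx_mul !trmxK h.
Qed.

(** Expand |y|^2 for y = M x as the sum of <y_i, M_ij x_j>, and split each product by Young's
    inequality with weight r: row sums then multiply |y_i|^2 and column sums multiply |x_j|^2. *)
Lemma schur_test (I J : finType) (P : pred I) (P' : pred J) m n
    (d : I -> nat) (d' : J -> nat)
    (E : forall i, 'M[F]_(d i, m)) (E' : forall j, 'M[F]_(d' j, n))
    (M : 'M[F]_(m, n)) (c : I -> J -> F) r :
  resolution P E -> resolution P' E' -> 0 < r ->
  (forall i j, P i -> P' j -> mxnorm2 (E i *m M *m (E' j)^T) <= c i j) ->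
  (forall i, P i -> \sum_(j | P' j) c i j <= r) ->
  (forall j, P' j -> \sum_(i | P i) c i j <= r) ->
  mxnorm2 M <= r.
Proof.
move=> hE hE' r0 hc hi hj.
apply: mxnorm2_le => [|x]; first exact: ltW.
apply: sqr_le_norm2; first exact: ltW.
set y := M *m x; have rn : r != 0 by rewrite gt_eqF.
(* Row sums contribute at most r * r^-1 |y|^2 and column sums at most r * r |x|^2; one copy of |y|^2
   is then absorbed on the left. *)
have key : 2 * dot y y <= dot y y + r ^+ 2 * dot x x; last by lra.
have e1 : dot y y = \sum_(i | P i) \sum_(j | P' j)
    dot (E i *m y) (E i *m M *m (E' j)^T *m (E' j *m x)).
  rewrite {1}(resolution_dot hE); apply: eq_bigr => i _; rewrite -dot_sumr.
  congr (dot _ _); rewrite {1}/y mulmxA (resolution_split hE' x) mulmx_sumr.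
  by apply: eq_bigr => j _; rewrite -(resolution_split hE') !mulmxA.
have e2 : dot y y + r ^+ 2 * dot x x = \sum_(i | P i) dot (E i *m y) (E i *m y)
   + r ^+ 2 * \sum_(j | P' j) dot (E' j *m x) (E' j *m x).
  by rewrite -(resolution_dot hE) -(resolution_dot hE').
rewrite {1}e1 e2.
apply: (@le_trans _ _ (\sum_(i | P i) \sum_(j | P' j)
   c i j * (r^-1 * dot (E i *m y) (E i *m y) + r * dot (E' j *m x) (E' j *m x)))).
  rewrite mulr_sumr; apply: ler_sum => i Pi; rewrite mulr_sumr.
  apply: ler_sum => j Pj.
  have /ler_normlW h := dot_mxnorm2 (E i *m y) (E' j *m x) (hc i j Pi Pj).
  have c0 : 0 <= c i j := le_trans (mxnorm2_ge0 _) (hc i j Pi Pj).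
  apply: (le_trans (ler_wpM2l _ h)) => //; rewrite -!sqr_norm2.
  set a := norm2 _; set b := norm2 _.
  rewrite (_ : 2 * _ = c i j * (2 * (a * b))); last by ring.
  apply: ler_wpM2l => //; rewrite -subr_ge0.
  have -> : r^-1 * a ^+ 2 + r * b ^+ 2 - 2 * (a * b) = r^-1 * (a - r * b) ^+ 2.
    by field.
  by rewrite mulr_ge0 ?sqr_ge0// invr_ge0 ltW.
under eq_bigr do under eq_bigr do rewrite mulrDr.
under eq_bigr do rewrite big_split /=.
rewrite big_split /=; apply: lerD.
  apply: ler_sum => i Pi; rewrite -mulr_suml.
  apply: (le_trans (ler_wpM2r _ (hi i Pi))).
    by rewrite mulr_ge0 ?dot_ge0// invr_ge0 ltW.
  by rewrite mulrA mulfV// mul1r.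
rewrite exchange_big /= mulr_sumr; apply: ler_sum => j Pj; rewrite -mulr_suml.
apply: (le_trans (ler_wpM2r _ (hj j Pj))).
  by rewrite mulr_ge0 ?dot_ge0// ltW.
by rewrite mulrA -expr2.
Qed.

Lemma exists_blocks (I J : finType) (P : pred I) (P' : pred J) m n
    (d : I -> nat) (d' : J -> nat)
    (E : forall i, 'M[F]_(d i, m)) (E' : forall j, 'M[F]_(d' j, n))
    (Pr : forall i j, 'M[F]_(d i, d' j) -> Prop) :
  resolution P E -> resolution P' E' ->
  (forall i j, P i -> P' j -> exists K, Pr i j K) ->
  exists K : 'M[F]_(m, n), forall i j, P i -> P' j -> Pr i j (E i *m K *m (E' j)^T).
Proof.
move=> [h1 h2 _] [h1' h2' _] h.
have {}h i j : exists K, P i -> P' j -> Pr i j K.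
  have [/andP[Pi Pj]|n0] := boolP (P i && P' j).
    by have [K hK] := h i j Pi Pj; exists K.
  by exists 0 => Pi Pj; rewrite Pi Pj in n0.
pose K i j := projT1 (cid (h i j)).
have hK i j : P i -> P' j -> Pr i j (K i j) by exact: projT2 (cid (h i j)).
exists (\sum_(i | P i) \sum_(j | P' j) (E i)^T *m K i j *m E' j) => i j Pi Pj.
suff -> : E i *m (\sum_(i | P i) \sum_(j | P' j) (E i)^T *m K i j *m E' j)
    *m (E' j)^T = K i j by exact: hK.
rewrite mulmx_sumr mulmx_suml (bigD1 i)//= [X in _ + X]big1 ?addr0; last first.
  move=> k /andP[Pk ki]; rewrite mulmx_sumr mulmx_suml big1// => l _.
  by rewrite !mulmxA h2 1?eq_sym// !mul0mx.
rewrite mulmx_sumr mulmx_suml (bigD1 j)//= [X in _ + X]big1 ?addr0; last first.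
  by move=> l /andP[Pl lj]; rewrite -!mulmxA h2'// !mulmx0.
by rewrite !mulmxA h1// mul1mx -mulmxA h1'// mulmx1.
Qed.

Section BlockDiagonal.
Variables (I : finType) (P : pred I) (n : nat) (d : I -> nat).
Variable (E : forall i, 'M[F]_(d i, n)).
Hypothesis (hE : resolution P E).

Definition blockdiag (M : 'M[F]_n) :=
  forall i j, P i -> P j -> i != j -> E i *m M *m (E j)^T = 0.

Lemma blockdiag_row M i : blockdiag M -> P i ->
  E i *m M = E i *m M *m (E i)^T *m E i.
Proof.
move=> hM Pi; have [_ _ h] := hE; rewrite -[LHS]mulmx1 -h mulmx_sumr.
rewrite (bigD1 i)//= big1 ?addr0 ?mulmxA// => j /andP[Pj ji].
by rewrite mulmxA hM 1?eq_sym// mul0mx.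
Qed.

Lemma blockdiag_quad M x : blockdiag M ->
  dot x (M *m x) =
    \sum_(i | P i) dot (E i *m x) (E i *m M *m (E i)^T *m (E i *m x)).
Proof.
move=> hM; rewrite [M *m x](resolution_split hE) dot_sumr.
apply: eq_bigr => i Pi; rewrite -dotM; congr (dot _ _).
by rewrite mulmxA {1}(blockdiag_row hM Pi) !mulmxA.
Qed.

Lemma blockdiag_sym M : blockdiag M ->
  (forall i, P i -> (E i *m M *m (E i)^T)^T = E i *m M *m (E i)^T) -> M^T = M.
Proof.
move=> hM hs; apply: (resolution_inj2 hE hE) => i j Pi Pj.
have -> : E i *m M^T *m (E j)^T = (E j *m M *m (E i)^T)^T.
  by rewrite !trmx_mul trmxK mulmxA.
have [<-|ij] := eqVneq i j; first exact: hs.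
by rewrite (hM i j Pi Pj ij) (hM j i Pj Pi) ?trmx0 1?eq_sym.
Qed.

Lemma blockdiag_psd M : blockdiag M ->
  (forall i, P i -> psd (E i *m M *m (E i)^T)) -> psd M.
Proof.
move=> hM h; apply: psdP => [|x].
  by apply: blockdiag_sym => // i Pi; exact/psd_sym/h.
by rewrite blockdiag_quad// sumr_ge0// => i Pi; exact/psd_ge0/h.
Qed.

Lemma blockdiag_row_pow M i t : blockdiag M -> P i ->
  E i *m M ^+ t = (E i *m M *m (E i)^T) ^+ t *m E i.
Proof.
move=> hM Pi; elim: t => [|t IH]; first by rewrite !expr0 mulmx1 mul1mx.
set Mi := E i *m M *m (E i)^T in IH *.
have -> : M ^+ t.+1 = M ^+ t *m M by rewrite exprSr.
have -> : Mi ^+ t.+1 = Mi ^+ t *m Mi by rewrite exprSr.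
by rewrite mulmxA IH -!mulmxA (blockdiag_row hM Pi) -!mulmxA.
Qed.

Lemma blockdiag_stable M L a : 0 <= L -> 0 <= a -> blockdiag M ->
  (forall i, P i -> stable L a (E i *m M *m (E i)^T)) -> stable L a M.
Proof.
move=> L0 a0 hM h t; have c0 : 0 <= L * a ^+ t by rewrite mulr_ge0 ?exprn_ge0.
apply: mxnorm2_le => // x; apply: sqr_le_norm2 => //.
rewrite (resolution_dot hE) (resolution_dot hE x) mulr_sumr.
apply: ler_sum => i Pi; rewrite mulmxA blockdiag_row_pow// -mulmxA.
by apply: norm2_le_sqr => //; apply/norm2_mulmx_le/h.
Qed.

(** The roots of the diagonal blocks are assembled into a block diagonal psd root of M, and
    uniqueness of the root identifies it with [psd_sqrt M]. *)
Lemma blockdiag_psd_sqrt M : blockdiag M ->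
  (forall i, P i -> psd (E i *m M *m (E i)^T)) ->
  blockdiag (psd_sqrt M) /\
  forall i, P i -> E i *m psd_sqrt M *m (E i)^T = psd_sqrt (E i *m M *m (E i)^T).
Proof.
move=> hM h.
(* One predicate must serve all pairs of indices although the diagonal condition only types when j =
   i; quantifying over the equality and casting allows this, and at [erefl] the cast disappears. *)
pose Pr i j (K : 'M[F]_(d i, d j)) := (i != j -> K = 0) /\
  forall e : j = i, ecast k ('M[F]_(d i, d k)) e K = psd_sqrt (E i *m M *m (E i)^T).
have [|S hS] := exists_blocks (Pr := Pr) hE hE.
  move=> i j Pi Pj; have [<-{j Pj}|ij] := eqVneq i j.
    exists (psd_sqrt (E i *m M *m (E i)^T)); split; first by rewrite eqxx.
    by move=> e; rewrite eq_axiomK.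
  by exists 0; split => // e; rewrite e eqxx in ij.
have bS : blockdiag S by move=> i j Pi Pj ij; case: (hS i j Pi Pj) => + _; apply.
have eS i : P i -> E i *m S *m (E i)^T = psd_sqrt (E i *m M *m (E i)^T).
  by move=> Pi; have [_ /(_ erefl)] := hS i i Pi Pi.
suff -> : psd_sqrt M = S by [].
apply: psd_sqrt_eq.
  by apply: blockdiag_psd => // i Pi; rewrite eS//; case: (psd_sqrtP (h i Pi)).
apply: (resolution_inj2 hE hE) => i j Pi Pj.
have -> : E i *m (S *m S) *m (E j)^T =
    (E i *m S *m (E i)^T) *m (E i *m S *m (E j)^T).
  by rewrite mulmxA {1}(blockdiag_row bS Pi) !mulmxA.
have [<-|ij] := eqVneq i j; last by rewrite (bS i j)// mulmx0 hM.
by rewrite eS//; case: (psd_sqrtP (h i Pi)).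
Qed.

End BlockDiagonal.

Lemma decentralized_stabilizable (I : finType) (P : pred I) n m
    (d dm : I -> nat) (E : forall i, 'M[F]_(d i, n)) (G : forall i, 'M[F]_(dm i, m))
    (A : 'M[F]_n) (B : 'M[F]_(n, m)) (nb : rel I) (D : nat) L0 a :
  resolution P E -> resolution P G -> (0 < D)%N -> 0 < L0 -> 0 <= a ->
  (forall i j, P i -> P j -> i != j -> E i *m B *m (G j)^T = 0) ->
  (forall i, P i -> stabilizable L0 a (E i *m A *m (E i)^T) (E i *m B *m (G i)^T)) ->
  (forall i j, P i -> P j -> i != j -> exists K, mxnorm2 K <= L0 /\
     E i *m A *m (E j)^T = E i *m B *m (G i)^T *m K) ->
  (forall i, P i -> nb i i) ->
  (forall i j, P i -> P j -> ~~ nb i j -> E i *m A *m (E j)^T = 0) ->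
  (forall i, P i -> (#|[set j | P j & nb i j]| <= D)%N) ->
  (forall j, P j -> (#|[set i | P i & nb i j]| <= D)%N) ->
  stabilizable (L0 * D%:R) a A B.
Proof.
move=> hE hG D0 L0p a0 hB hst hoff nbr hnb hrow hcol.
pose Bd i := E i *m B *m (G i)^T.
(* The clauses serve, in order, the Schur test for the norm of K, the cancellation of the
   off-diagonal blocks of the closed loop, and the stability of its diagonal blocks. *)
pose Pr i j (K : 'M[F]_(dm i, d j)) :=
  [/\ mxnorm2 K <= L0 * (nb i j)%:R, i != j -> E i *m A *m (E j)^T = Bd i *m K &
  forall e : j = i, stable L0 a (E i *m A *m (E i)^T -
     Bd i *m ecast k ('M[F]_(dm i, d k)) e K)].
have [|K hK] := exists_blocks (Pr := Pr) hG hE.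
  move=> i j Pi Pj; have [<-{j Pj}|ij] := eqVneq i j.
    have [K [nK sK]] := hst i Pi; exists K; split.
    - by rewrite (nbr i Pi) mulr1.
    - by rewrite eqxx.
    - by move=> e; rewrite eq_axiomK.
  have [nbij|nnb] := boolP (nb i j).
    have [K [nK eK]] := hoff i j Pi Pj ij; exists K; split.
    - by rewrite nbij mulr1.
    - by move=> _.
    - by move=> e; rewrite e eqxx in ij.
  exists 0; split.
  - by rewrite mxnorm20 mulr_ge0// ltW.
  - by move=> _; rewrite mulmx0 hnb.
  - by move=> e; rewrite e eqxx in ij.
exists K; split.
  apply: (schur_test (c := fun i j => L0 * (nb i j)%:R) hG hE).
  - by rewrite mulr_gt0// ltr0n.
  - by move=> i j Pi Pj; case: (hK i j Pi Pj).
  - move=> i Pi; rewrite -mulr_sumr ler_pM2l// -natr_sum ler_nat.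
    rewrite -big_mkcondr /= sum1_card; apply: leq_trans (hrow i Pi).
    by rewrite leq_eqVlt; apply/orP; left; apply/eqP/eq_card => j; rewrite !inE.
  - move=> j Pj; rewrite -mulr_sumr ler_pM2l// -natr_sum ler_nat.
    rewrite -big_mkcondr /= sum1_card; apply: leq_trans (hcol j Pj).
    by rewrite leq_eqVlt; apply/orP; left; apply/eqP/eq_card => i; rewrite !inE.
have eB i : P i -> E i *m B = Bd i *m G i.
  move=> Pi; have [_ _ h] := hG; rewrite -[LHS]mulmx1 -h mulmx_sumr.
  rewrite (bigD1 i)//= big1 ?addr0 ?mulmxA// => j /andP[Pj ji].
  by rewrite mulmxA hB 1?eq_sym// mul0mx.
have eC i j : P i -> P j -> E i *m (A - B *m K) *m (E j)^T =
    E i *m A *m (E j)^T - Bd i *m (G i *m K *m (E j)^T).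
  by move=> Pi Pj; rewrite mulmxBr mulmxBl [E i *m (B *m K)]mulmxA eB// -!mulmxA.
have hs : stable L0 a (A - B *m K).
  apply: (blockdiag_stable hE) => //; first exact: ltW.
    move=> i j Pi Pj ij; rewrite eC//; have [_ /(_ ij)-> _] := hK i j Pi Pj.
    by rewrite subrr.
  by move=> i Pi; rewrite eC//; have [_ _ /(_ erefl)] := hK i i Pi Pi.
(* The closed loop is stable already with constant L0; the factor D >= 1 is spent only on the norm
   of the feedback. *)
move=> t; apply: (le_trans (hs t)); rewrite ler_wpM2r ?exprn_ge0//.
by rewrite ler_peMr ?ler1n// ltW.
Qed.

End Resolutions.

(** * Nodes and clusters as orthogonal decompositions *)

Section Clusters.
Variables (F : realType) (N : nat).
Implicit Types (p q : 'I_N -> nat) (S T : {set 'I_N}).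

Definition node_sel p i : 'M[F]_(p i, \sum_i p i) := selector F (@tagnat.Rank _ p i).

Definition cluster_idx p S (k : 'I_(cdim p S)) : 'I_(\sum_i p i) :=
  tagnat.Rank (enum_val (tagnat.sig1 k)) (tagnat.sig2 k).

Definition cluster_sel p S : 'M[F]_(cdim p S, \sum_i p i) :=
  selector F (@cluster_idx p S).

Lemma node_sel_block p q (M : 'M[F]_(\sum_i p i, \sum_i q i)) i j :
  node_sel p i *m M *m (node_sel q j)^T = submxblock M i j.
Proof. exact: selector_mxsub. Qed.

Lemma cluster_sel_block p q (M : forall i j, 'M[F]_(p i, q j)) S T :
  cluster_sel p S *m (\mxblock_(i, j) M i j) *m (cluster_sel q T)^T = cblock M S T.
Proof.
rewrite selector_mxsub; apply/matrixP => k l; rewrite mxE /cluster_idx.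
set i := enum_val _; set j := enum_val _.
have /matrixP/(_ (tagnat.sig2 k) (tagnat.sig2 l)) := mxblockK M i j.
by rewrite mxE => ->; rewrite /cblock mxE.
Qed.

Lemma Rank_inj p i j (b : 'I_(p i)) (c : 'I_(p j)) :
  tagnat.Rank i b = tagnat.Rank j c ->
  Tagged (fun i => 'I_(p i)) b = Tagged (fun i => 'I_(p i)) c.
Proof. by move=> /tagnat.rank_inj. Qed.

Lemma node_resolution p : resolution predT (node_sel p).
Proof.
apply: resolution_selector => [a|i j b c _ _]; last exact: Rank_inj.
by exists (tagnat.sig1 a), (tagnat.sig2 a); rewrite tagnat.sig2K.
Qed.

Lemma cluster_idx_surj p S i (b : 'I_(p i)) :
  i \in S -> exists k : 'I_(cdim p S), cluster_idx k = tagnat.Rank i b.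
Proof.
move=> iS; have [k0 e] : exists k0 : 'I_#|S|, enum_val k0 = i.
  by exists (enum_rank_in iS i); rewrite enum_rankK_in.
case: _ / e b => b {i iS}.
exists (@tagnat.Rank _ (fun k => p (enum_val k)) k0 b).
pose f (t : {k : 'I_#|S| & 'I_(p (enum_val k))}) : 'I_(\sum_i p i) :=
  tagnat.Rank (enum_val (tag t)) (tagged t).
transitivity (f (tagnat.sig (@tagnat.Rank _ (fun k => p (enum_val k)) k0 b))).
  by [].
by rewrite /tagnat.Rank tagnat.rankK.
Qed.

Lemma cluster_idx_inj p S (k l : 'I_(cdim p S)) :
  cluster_idx k = cluster_idx l -> k = l.
Proof.
move=> /Rank_inj h; apply: (can_inj (@tagnat.sigK _ _)).
move: h; rewrite (tagnat.sigE12 k) (tagnat.sigE12 l).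
move: (tagnat.sig1 k) (tagnat.sig2 k) (tagnat.sig1 l) (tagnat.sig2 l).
move=> k0 b l0 c e.
have ekl : k0 = l0 by apply: enum_val_inj; have /= := congr1 tag e.
case: _ / ekl c e => c /eqP.
by rewrite eq_Tagged /= => /eqP->.
Qed.

Lemma cluster_resolution p (Pi : {set {set 'I_N}}) :
  finset.partition Pi [set: 'I_N] ->
  resolution (fun S => S \in Pi) (cluster_sel p).
Proof.
move=> hPi; have /and3P[/eqP cov triv _] := hPi.
apply: resolution_selector => [a|S T b c SP TP e].
  set i := tagnat.sig1 a; have iP : i \in finset.cover Pi by rewrite cov inE.
  have iS : i \in finset.pblock Pi i by rewrite finset.mem_pblock.
  have [k hk] := cluster_idx_surj (tagnat.sig2 a) iS.
  exists (finset.pblock Pi i), k; split; first exact: finset.pblock_mem.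
  by rewrite hk tagnat.sig2K.
have ST : S = T.
  have /(congr1 tag) /= ei := Rank_inj e.
  rewrite -(finset.def_pblock triv SP (enum_valP (tagnat.sig1 b))).
  by rewrite ei (finset.def_pblock triv TP (enum_valP (tagnat.sig1 c))).
case: _ / ST c TP e => c _ e.
by rewrite (cluster_idx_inj e).
Qed.

End Clusters.

(** * From conditions on clusters to the whole network *)

Section DecentralizedConditions.
Variables (F : realType) (N : nat).
Variables (e : rel 'I_N) (nx nu : 'I_N -> nat).
Hypotheses (e_sym : symmetric e).
Variables (Pi : {set {set 'I_N}}) (D : nat) (L0 : F).
Hypotheses (hN : (0 < N)%N) (hPi : finset.partition Pi [set: 'I_N]).
Hypotheses (hD : condD e Pi D) (L0_gt1 : 1 < L0).

Definition cluster_adj (S T : {set 'I_N}) :=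
  [exists i in S, exists j in T, (i == j) || e i j].

Lemma cluster_adjC S T : cluster_adj S T = cluster_adj T S.
Proof.
by apply/idP/idP => /exists_inP[i iS /exists_inP[j jT h]];
  apply/exists_inP; exists j => //; apply/exists_inP; exists i => //;
  rewrite eq_sym e_sym.
Qed.

Lemma cluster_adj_refl S : S \in Pi -> cluster_adj S S.
Proof.
have /and3P[_ _ n0] := hPi => SP.
have /set0Pn[i iS] : S != finset.set0 by apply: contraNneq n0 => <-.
by apply/exists_inP; exists i => //; apply/exists_inP; exists i => //; rewrite eqxx.
Qed.

Lemma cluster_degree_row S : S \in Pi -> (#|[set T | T \in Pi & cluster_adj S T]| <= D)%N.
Proof. by move=> /hD. Qed.

Lemma cluster_degree_col S : S \in Pi -> (#|[set T | T \in Pi & cluster_adj T S]| <= D)%N.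
Proof.
move=> /hD; apply: leq_trans; rewrite leq_eqVlt; apply/orP; left; apply/eqP.
by apply/eq_card => T; rewrite !inE cluster_adjC.
Qed.

(** A network with a node has a cluster, which is its own neighbour. This yields L0 <= L0 * D, hence
    1 < L, the standing assumption of all estimates on the constants. *)
Lemma cluster_degree_gt0 : (0 < D)%N.
Proof.
have /and3P[/eqP cov _ _] := hPi.
have iP : Ordinal hN \in finset.cover Pi by rewrite cov inE.
have SP := finset.pblock_mem iP.
apply: leq_trans (cluster_degree_row SP); apply/card_gt0P.
by exists (finset.pblock Pi (Ordinal hN)); rewrite inE SP cluster_adj_refl.
Qed.

Lemma cblock_nonadj (p q : 'I_N -> nat) (M : forall i j, 'M[F]_(p i, q j)) S T :
  graph_sparse e M -> ~~ cluster_adj S T -> cblock M S T = 0.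
Proof.
move=> hM /exists_inPn hn; rewrite /cblock -mxblock0; apply/eq_mxblock => k l.
have /exists_inPn/(_ _ (enum_valP l)) := hn _ (enum_valP k).
by rewrite negb_or => /andP[]; exact: hM.
Qed.

Lemma cluster_norm (p q : 'I_N -> nat) (M : forall i j, 'M[F]_(p i, q j)) :
  graph_sparse e M ->
  (forall S T, S \in Pi -> T \in Pi -> mxnorm2 (cblock M S T) <= L0) ->
  mxnorm2 (\mxblock_(i, j) M i j) <= L0 * D%:R.
Proof.
move=> hM hL; have L0p : 0 < L0 by rewrite (lt_trans _ L0_gt1).
apply: (schur_test (c := fun S T => L0 * (cluster_adj S T)%:R)
  (cluster_resolution F p hPi) (cluster_resolution F q hPi)).
- by rewrite mulr_gt0// ltr0n cluster_degree_gt0.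
- move=> S T SP TP; rewrite cluster_sel_block.
  have [h|h] := boolP (cluster_adj S T); first by rewrite mulr1 hL.
  by rewrite cblock_nonadj// mxnorm20 mulr0.
- move=> S SP; rewrite -mulr_sumr ler_pM2l// -natr_sum ler_nat.
  rewrite -big_mkcondr /= sum1_card; apply: leq_trans (cluster_degree_row SP).
  by rewrite leq_eqVlt; apply/orP; left; apply/eqP/eq_card => j; rewrite !inE.
- move=> S SP; rewrite -mulr_sumr ler_pM2l// -natr_sum ler_nat.
  rewrite -big_mkcondr /= sum1_card; apply: leq_trans (cluster_degree_col SP).
  by rewrite leq_eqVlt; apply/orP; left; apply/eqP/eq_card => j; rewrite !inE.
Qed.

Lemma cluster_blockdiag (p : 'I_N -> nat) (M : forall i j, 'M[F]_(p i, p j)) :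
  (forall S T, S \in Pi -> T \in Pi -> S != T -> cblock M S T = 0) ->
  blockdiag (fun S => S \in Pi) (cluster_sel F p) (\mxblock_(i, j) M i j).
Proof. by move=> h S T SP TP ST; rewrite cluster_sel_block h. Qed.

Lemma cluster_psd (p : 'I_N -> nat) (M : forall i j, 'M[F]_(p i, p j)) (g : F) :
  (forall S T, S \in Pi -> T \in Pi -> S != T -> cblock M S T = 0) ->
  (forall S, S \in Pi -> psd (cblock M S S - g%:M)) ->
  psd (\mxblock_(i, j) M i j - g%:M).
Proof.
move=> h0 h; have res := cluster_resolution F p hPi; have [h1 h2 _] := res.
have eg S T : cluster_sel F p S *m (\mxblock_(i, j) M i j - g%:M) *m
    (cluster_sel F p T)^T = cblock M S T - g *: (cluster_sel F p S *m (cluster_sel F p T)^T).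
  by rewrite mulmxBr mulmxBl cluster_sel_block mul_mx_scalar -scalemxAl.
apply: (blockdiag_psd res) => [S T SP TP ST|S SP]; rewrite eg.
  by rewrite h0// h2// scaler0 subr0.
by rewrite h1// scalemx1; exact: h.
Qed.

Variable alpha : F.
Hypothesis alpha0 : 0 <= alpha.
Variables (A : forall i j, 'M[F]_(nx i, nx j)) (A_sparse : graph_sparse e A).

Lemma cluster_stabilizable (B : forall i j, 'M[F]_(nx i, nu j)) :
  (forall S T, S \in Pi -> T \in Pi -> S != T -> cblock B S T = 0) ->
  condU4 L0 alpha Pi A B ->
  stabilizable (L0 * D%:R) alpha (\mxblock_(i, j) A i j) (\mxblock_(i, j) B i j).
Proof.
move=> hB h4; have L0p : 0 < L0 by rewrite (lt_trans _ L0_gt1).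
apply: (decentralized_stabilizable (nb := cluster_adj)
  (cluster_resolution F nx hPi) (cluster_resolution F nu hPi)) => //.
- exact: cluster_degree_gt0.
- by move=> S T SP TP ST; rewrite cluster_sel_block hB.
- by move=> S SP; rewrite !cluster_sel_block; case: (h4 S SP).
- move=> S T SP TP ST; rewrite !cluster_sel_block.
  by have [_] := h4 S SP; apply => //; rewrite eq_sym.
- exact: cluster_adj_refl.
- by move=> S T SP TP h; rewrite cluster_sel_block cblock_nonadj.
- exact: cluster_degree_col.
Qed.

(** Since the root of the block diagonal Q is block diagonal with the roots of the diagonal blocks,
    transposing (U5) gives exactly the hypotheses of decentralized stabilization for A^T and the
    transposed root. *)
Lemma cluster_detectable (Q : forall i j, 'M[F]_(nx i, nx j)) :
  (forall S T, S \in Pi -> T \in Pi -> S != T -> cblock Q S T = 0) ->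
  condU5 L0 alpha Pi A Q ->
  psd (\mxblock_(i, j) Q i j) /\
  detectable (L0 * D%:R) alpha (\mxblock_(i, j) A i j)
    (psd_sqrt (\mxblock_(i, j) Q i j)).
Proof.
move=> hQ h5; have L0p : 0 < L0 by rewrite (lt_trans _ L0_gt1).
have res := cluster_resolution F nx hPi.
have hbd := cluster_blockdiag hQ.
have hp S : S \in Pi -> psd (cluster_sel F nx S *m (\mxblock_(i, j) Q i j) *m
    (cluster_sel F nx S)^T).
  by move=> SP; rewrite cluster_sel_block; case: (h5 S SP).
split; first exact: (blockdiag_psd res).
have [hW eW] := blockdiag_psd_sqrt res hbd hp.
have eWS S : S \in Pi -> cluster_sel F nx S *m (psd_sqrt (\mxblock_(i, j) Q i j))^T
    *m (cluster_sel F nx S)^T = (psd_sqrt (cblock Q S S))^T.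
  by move=> SP; rewrite -(trmxK (cluster_sel F nx S)) -!trmx_mul mulmxA trmxK eW//
   cluster_sel_block.
have eA S T : cluster_sel F nx S *m (\mxblock_(i, j) A i j)^T *m (cluster_sel F nx T)^T
    = (cblock A T S)^T.
  by rewrite -cluster_sel_block !trmx_mul trmxK mulmxA.
apply: (decentralized_stabilizable (nb := cluster_adj) res res) => //.
- exact: cluster_degree_gt0.
- move=> S T SP TP ST; apply: trmx_inj; rewrite !trmx_mul !trmxK mulmxA trmx0.
  by rewrite hW// eq_sym.
- by move=> S SP; rewrite eWS// eA; case: (h5 S SP).
- move=> S T SP TP ST; rewrite eWS// eA; have [_ _ h] := h5 S SP.
  have [|K [nK ->]] := h T TP; first by rewrite eq_sym.
  by exists K^T; rewrite mxnorm2_tr trmx_mul.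
- exact: cluster_adj_refl.
- by move=> S T SP TP h; rewrite eA cblock_nonadj ?trmx0// cluster_adjC.
- exact: cluster_degree_col.
Qed.

End DecentralizedConditions.

(** * The Riccati equation *)

Section Auxiliary.
Variable F : realType.

Lemma le_geometric_limit (a b c q : F) : 0 <= q -> q < 1 ->
  (forall k, a <= b + c * q ^+ k) -> a <= b.
Proof.
move=> q0 q1 h; have hc : ((fun k => b + c * q ^+ k) @ \oo --> b)%classic.
  rewrite -[X in (_ --> X)%classic]addr0 -(mulr0 c).
  apply: cvgD; first exact: cvg_cst.
  apply: cvgM; first exact: cvg_cst.
  by apply: cvg_expr; rewrite ger0_norm.
by have /cvgr_to_ge := hc; apply; exact: nearW.
Qed.

Lemma geometric_sum_le (q : F) k : 0 <= q -> q < 1 ->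
  \sum_(t < k) q ^+ t <= (1 - q)^-1.
Proof.
move=> q0 q1; have q1' : 0 < 1 - q by rewrite subr_gt0.
rewrite -[leRHS]mul1r ler_pdivlMr//.
by have := subrX1 q k; have := exprn_ge0 k q0; lra.
Qed.

(** Turns entrywise convergence into convergence in operator norm, as required in the limit of value
    iteration. *)
Lemma mxnorm2_entries m n (M : 'M[F]_(m, n)) :
  mxnorm2 M <= \sum_i \sum_j `|M i j|.
Proof.
have s0 : 0 <= \sum_i \sum_j `|M i j|.
  by apply: sumr_ge0 => i _; apply: sumr_ge0.
apply: mxnorm2_le => // x.
rewrite {1}[M]matrix_sum_delta mulmx_suml.
apply: (le_trans (ler_norm2_sum _ _ _)); rewrite mulr_suml.
apply: ler_sum => i _; rewrite mulmx_suml.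
apply: (le_trans (ler_norm2_sum _ _ _)); rewrite mulr_suml.
apply: ler_sum => j _; rewrite -scalemxAl norm2Z ler_wpM2l//.
rewrite -[leRHS]mul1r; apply: sqr_le_norm2 => //; rewrite expr1n mul1r.
rewrite dotE (bigD1 i)//= big1 ?addr0 => [|k ki]; last first.
  rewrite !mxE big1 ?mul0r// => l _.
  by rewrite mxE (negbTE ki) mul0r.
have -> : (delta_mx i j *m x) i 0 = x j 0.
  rewrite mxE (bigD1 j)//= mxE !eqxx mul1r big1 ?addr0// => l lj.
  by rewrite mxE (negbTE lj) andbF mul0r.
rewrite dotE (bigD1 j)//= lerDl sumr_ge0// => l _.
by rewrite -expr2 sqr_ge0.
Qed.

Lemma stable_norm2 n (Phi : 'M[F]_n) L a t x :
  stable L a Phi -> norm2 (Phi ^+ t *m x) <= L * a ^+ t * norm2 x.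
Proof. by move=> h; apply/norm2_mulmx_le/h. Qed.

Lemma stable_tr n (Phi : 'M[F]_n) L a : stable L a Phi -> stable L a Phi^T.
Proof.
move=> h t; suff -> : Phi^T ^+ t = (Phi ^+ t)^T by rewrite mxnorm2_tr.
elim: t => [|t IH]; first by rewrite !expr0 [1](_ : _ = 1%:M)// trmx1.
by rewrite exprS IH exprSr trmx_mul.
Qed.

End Auxiliary.

Section Riccati.
Variables (F : realType) (n m : nat).
Variables (A : 'M[F]_n) (B : 'M[F]_(n, m)) (Q : 'M[F]_n) (R : 'M[F]_m).
Variables (L alpha gamma : F).
Hypotheses (L1 : 1 < L) (alpha0 : 0 < alpha) (alpha1 : alpha < 1) (gamma0 : 0 < gamma).
Hypotheses (nA : mxnorm2 A <= L) (nB : mxnorm2 B <= L).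
Hypotheses (nQ : mxnorm2 Q <= L) (nR : mxnorm2 R <= L).
Hypotheses (psdQ : psd Q) (psdR : psd (R - gamma%:M)).

Let L0 : 0 < L := lt_trans ltr01 L1.

Lemma psd_input_cost : psd R.
Proof.
rewrite -[R](subrK gamma%:M); apply: psdD => //.
apply: psdP => [|x]; first by rewrite tr_scalar_mx.
by rewrite mul_scalar_mx dotZr mulr_ge0 ?dot_ge0// ltW.
Qed.

Definition ric_weight P := R + B^T *m P *m B.
Definition ric_gain P := invmx (ric_weight P) *m B^T *m P *m A.
Definition ric_map P := A^T *m P *m A
  - A^T *m P *m B *m invmx (ric_weight P) *m B^T *m P *m A + Q.

Lemma ric_weight_psd P : psd P -> psd (ric_weight P).
Proof. by move=> hP; apply: psdD; [exact: psd_input_cost|exact: psd_congr]. Qed.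

Lemma ric_weight_ge P u : psd P -> gamma * dot u u <= dot u (ric_weight P *m u).
Proof.
move=> hP; rewrite mulmxDl dotDr; have h1 := psd_subge u psdR.
have h2 := psd_ge0 u (psd_congr B hP); lra.
Qed.

Lemma ric_weight_unit P : psd P -> ric_weight P \in unitmx.
Proof.
move=> hP; apply: unitmx_inj => u hu; apply: dot_eq0.
have := ric_weight_ge u hP; rewrite hu dot0r => h.
apply/eqP; rewrite eq_le dot_ge0 andbT.
by rewrite -(pmulr_rle0 _ gamma0).
Qed.

Lemma ric_gain_eq P : psd P -> ric_weight P *m ric_gain P = B^T *m P *m A.
Proof. by move=> hP; rewrite /ric_gain !mulmxA mulmxV ?mul1mx ?ric_weight_unit. Qed.

Lemma ric_map_eq P : psd P ->
  ric_map P = A^T *m P *m A - (ric_gain P)^T *m ric_weight P *m ric_gain P + Q.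
Proof.
move=> hP; congr (_ - _ + _).
have -> : (ric_gain P)^T *m ric_weight P = (B^T *m P *m A)^T.
  by rewrite -ric_gain_eq// [RHS]trmx_mul (psd_sym (ric_weight_psd hP)).
by rewrite /ric_gain !trmx_mul trmxK (psd_sym hP) !mulmxA.
Qed.

(** The one-step Bellman identity: stage cost plus cost-to-go equals the Riccati value plus a
    penalty for deviating from the gain. It gives the minimality and monotonicity of [ric_map] and,
    summed along a trajectory, the loss of a suboptimal feedback. *)
Lemma complete_square P x u : psd P ->
  dot x (Q *m x) + dot u (R *m u) + dot (A *m x + B *m u) (P *m (A *m x + B *m u))
  = dot x (ric_map P *m x)
    + dot (u + ric_gain P *m x) (ric_weight P *m (u + ric_gain P *m x)).
Proof.
move=> hP; set K := ric_gain P; set S := ric_weight P.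
have hSK : S *m K = B^T *m P *m A := ric_gain_eq hP.
have eS : dot u (S *m u) = dot u (R *m u) + dot (B *m u) (P *m (B *m u)).
  by rewrite mulmxDl dotDr -!mulmxA -dotM.
have sS : S^T = S := psd_sym (ric_weight_psd hP).
have e1 : dot u (S *m (K *m x)) = dot (B *m u) (P *m (A *m x)).
  have -> : S *m (K *m x) = B^T *m P *m A *m x by rewrite -hSK -mulmxA.
  by rewrite -!mulmxA -dotM.
rewrite ric_map_eq// -/K -/S; clearbody S K.
rewrite !mulmxDl mulNmx !mulmxDr !dotDr !dotDl !dotNr.
rewrite (dot_symmx (K *m x) u sS) e1 eS.
have -> : dot x (K^T *m S *m K *m x) = dot (K *m x) (S *m (K *m x)).
  by rewrite -!mulmxA -dotM.
have -> : dot x (A^T *m P *m A *m x) = dot (A *m x) (P *m (A *m x)).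
  by rewrite -!mulmxA -dotM.
rewrite (dot_symmx (A *m x) (B *m u) (psd_sym hP)); ring.
Qed.

Lemma ric_map_le P x u : psd P ->
  dot x (ric_map P *m x) <=
  dot x (Q *m x) + dot u (R *m u) + dot (A *m x + B *m u) (P *m (A *m x + B *m u)).
Proof.
by move=> hP; rewrite complete_square// lerDl psd_ge0//; exact: ric_weight_psd.
Qed.

Lemma ric_map_gain P x : psd P ->
  dot x (ric_map P *m x) =
  dot x (Q *m x) + dot (ric_gain P *m x) (R *m (ric_gain P *m x))
  + dot ((A - B *m ric_gain P) *m x) (P *m ((A - B *m ric_gain P) *m x)).
Proof.
move=> hP; have := complete_square x (- (ric_gain P *m x)) hP.
rewrite addNr dot0l addr0 => <-; rewrite !mulmxN dotNl dotNr opprK.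
by rewrite mulmxBl !mulmxA.
Qed.

Lemma ric_map_psd P : psd P -> psd (ric_map P).
Proof.
move=> hP; apply: psdP => [|x].
  rewrite ric_map_eq//; have h1 := psd_sym (psd_congr A hP).
  have h2 := psd_sym (psd_congr (ric_gain P) (ric_weight_psd hP)).
  move: (_ *m ric_gain P) h2 => Y h2; move: (_ *m A) h1 => X h1.
  by rewrite !linearD /= linearN /= h1 h2 (psd_sym psdQ).
by rewrite ric_map_gain// !addr_ge0 ?psd_ge0//; exact: psd_input_cost.
Qed.

(** The gain of P' is a suboptimal input for P and attains equality for P'. *)
Lemma ric_map_mono P P' : psd P -> psd P' ->
  (forall x, dot x (P *m x) <= dot x (P' *m x)) ->
  forall x, dot x (ric_map P *m x) <= dot x (ric_map P' *m x).
Proof.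
move=> hP hP' h x; apply: (le_trans (ric_map_le x (- (ric_gain P' *m x)) hP)).
have -> : A *m x + B *m - (ric_gain P' *m x) = (A - B *m ric_gain P') *m x.
  by rewrite mulmxN mulmxBl mulmxA.
by rewrite [leRHS]ric_map_gain// mulmxN dotNl dotNr opprK lerD2l.
Qed.

(** Testing the equation of the gain against y = K x gives gamma |y|^2 <= <B y, P A x> <= c L^2 |y|
    |x|. *)
Lemma ric_gain_norm P c : psd P -> mxnorm2 P <= c ->
  mxnorm2 (ric_gain P) <= c * L ^+ 2 / gamma.
Proof.
move=> hP hc; have c0 : 0 <= c := le_trans (mxnorm2_ge0 _) hc.
apply: mxnorm2_le => [|x].
  by rewrite !mulr_ge0 ?exprn_ge0 ?invr_ge0// ltW.
set y := ric_gain P *m x.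
have [->|y0] := eqVneq (norm2 y) 0.
  by rewrite !mulr_ge0 ?exprn_ge0 ?invr_ge0 ?norm2_ge0// ltW.
have yp : 0 < norm2 y by rewrite lt_neqAle eq_sym y0 norm2_ge0.
rewrite mulrAC ler_pdivlMr// -(ler_pM2r yp).
have h1 := ric_weight_ge y hP.
rewrite /y mulmxA ric_gain_eq// -/y -!mulmxA -dotM in h1.
have nPA : mxnorm2 (P *m A) <= c * L by exact: mxnorm2M_le.
have /ler_normlW h2 := dot_mxnorm2 (B *m y) x nPA; rewrite -mulmxA in h2.
have h3 := norm2_mulmx_le y nB; rewrite -sqr_norm2 in h1.
have h4 : c * L * norm2 (B *m y) * norm2 x <= c * L * (L * norm2 y) * norm2 x.
  by rewrite ler_wpM2r ?norm2_ge0// ler_wpM2l// mulr_ge0// ltW.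
lra.
Qed.

Section Bounded.
Hypothesis (stabAB : stabilizable L alpha A B).

Lemma alpha2_lt1 : alpha ^+ 2 < 1.
Proof. by rewrite exprn_ilt1// ltW. Qed.

Lemma LP_gt0 : 0 < LP L alpha.
Proof.
rewrite /LP !mulr_gt0 ?invr_gt0 ?exprn_gt0//.
  by rewrite addr_gt0// exprn_gt0.
by rewrite subr_gt0 alpha2_lt1.
Qed.

(* The cost-to-go of value iteration is at most the cost of the stabilizing feedback. *)
Lemma value_iteration_bound (Ps : nat -> 'M[F]_n) k x :
  (forall k, psd (Ps k)) -> (forall k, Ps k.+1 = ric_map (Ps k)) ->
  dot x (Ps k *m x) <=
    (LP L alpha + mxnorm2 (Ps 0%N) * L ^+ 2 * (alpha ^+ 2) ^+ k) * dot x x.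
Proof.
move=> hp hs; have [K [nK sK]] := stabAB; set Phi := A - B *m K in sK.
have st y : dot y (Q *m y) + dot (K *m y) (R *m (K *m y)) <= L * (1 + L ^+ 2) * dot y y.
  have /ler_normlW h1 := dot_mxnorm2 y y nQ.
  have /ler_normlW h2 := dot_mxnorm2 (K *m y) (K *m y) nR.
  have h3 := norm2_le_sqr (ltW L0) (norm2_mulmx_le y nK).
  rewrite -mulrA -expr2 sqr_norm2 in h1; rewrite -mulrA -expr2 sqr_norm2 in h2.
  have h4 := ler_wpM2l (ltW L0) h3; lra.
have h1 : dot x (Ps k *m x) <= \sum_(t < k) L * (1 + L ^+ 2) *
     dot (Phi ^+ t *m x) (Phi ^+ t *m x)
     + dot (Phi ^+ k *m x) (Ps 0%N *m (Phi ^+ k *m x)).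
  elim: k x => [|k IH] x; first by rewrite big_ord0 expr0 !mul1mx add0r.
  rewrite hs; apply: (le_trans (ric_map_le x (- (K *m x)) (hp k))).
  have -> : A *m x + B *m - (K *m x) = Phi *m x by rewrite mulmxN mulmxBl mulmxA.
  rewrite mulmxN dotNl dotNr opprK big_ord_recl expr0 !mul1mx -[leRHS]addrA.
  apply: lerD; first exact: st.
  have e t : Phi ^+ t.+1 *m x = Phi ^+ t *m (Phi *m x) by rewrite mulmxA exprSr.
  rewrite e; apply: (le_trans (IH _)); rewrite lerD2r.
  by apply: ler_sum => t _; rewrite lift0 e.
apply: (le_trans h1); rewrite mulrDl.
have hPhi t : dot (Phi ^+ t *m x) (Phi ^+ t *m x) <= L ^+ 2 * (alpha ^+ 2) ^+ t * dot x x.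
  rewrite exprAC -exprMn; apply: norm2_le_sqr; last exact: stable_norm2.
  by rewrite mulr_ge0 ?exprn_ge0// ltW.
apply: lerD.
  (* Origin of [LP]: the stage weight L (1 + L^2) times the geometric series of the squared state
     bound L^2 alpha^(2t). *)
  apply: (@le_trans _ _ (\sum_(t < k) L ^+ 3 * (1 + L ^+ 2) * dot x x * (alpha ^+ 2) ^+ t)).
    apply: ler_sum => t _.
    have c0 : 0 <= L * (1 + L ^+ 2) by rewrite mulr_ge0 ?addr_ge0 ?exprn_ge0// ltW.
    apply: (le_trans (ler_wpM2l c0 (hPhi t))).
    by rewrite le_eqVlt; apply/orP; left; apply/eqP; ring.
  rewrite -mulr_sumr /LP [leRHS]mulrAC ler_wpM2l//.
    by rewrite !mulr_ge0 ?dot_ge0 ?addr_ge0 ?exprn_ge0// ltW.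
  by apply: geometric_sum_le; rewrite ?exprn_ge0 ?alpha2_lt1// ltW.
have /ler_normlW h2 := dot_mxnorm2 (Phi ^+ k *m x) (Phi ^+ k *m x) (lexx (mxnorm2 (Ps 0%N))).
rewrite -mulrA -expr2 sqr_norm2 in h2; apply: (le_trans h2).
apply: (le_trans (ler_wpM2l (mxnorm2_ge0 _) (hPhi k))).
by rewrite !mulrA.
Qed.

Lemma psd_norm_le (P : 'M[F]_n) c : 0 < c -> psd P ->
  (forall x, dot x (P *m x) <= c * dot x x) -> mxnorm2 P <= c.
Proof.
move=> c0 hP h; apply: sym_mxnorm2_le => // [|x]; first exact: psd_sym.
by rewrite ger0_norm ?psd_ge0.
Qed.

(** A fixed point is a constant value iteration; the contribution of its initial value decays
    geometrically, and only [LP] survives as k grows. *)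
Lemma riccati_norm P : psd P -> ric_map P = P -> mxnorm2 P <= LP L alpha.
Proof.
move=> hP e; apply: psd_norm_le => // [|x]; first exact: LP_gt0.
apply: (@le_geometric_limit _ _ _ (mxnorm2 P * L ^+ 2 * dot x x) (alpha ^+ 2)).
- by rewrite exprn_ge0// ltW.
- exact: alpha2_lt1.
move=> k; have := @value_iteration_bound (fun=> P) k x (fun=> hP) (fun=> esym e).
by move/le_trans; apply; rewrite mulrDl lerD2l mulrAC.
Qed.

(** Value iteration from 0 increases and is bounded, so it has a limit P. Monotonicity of [ric_map]
    gives P <= [ric_map P]; the converse compares P with its iterates through their gains. *)
Lemma riccati_exists : exists P, psd P /\ ric_map P = P.
Proof.
pose Ps k := iter k ric_map 0.
have hs k : Ps k.+1 = ric_map (Ps k) by [].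
have hp k : psd (Ps k).
  by elim: k => [|k IH]; [exact: psd0|rewrite hs; exact: ric_map_psd].
have hb k x : dot x (Ps k *m x) <= LP L alpha * dot x x.
  have := value_iteration_bound k x hp hs.
  by rewrite mxnorm20 !mul0r addr0.
have hm k x : dot x (Ps k *m x) <= dot x (Ps k.+1 *m x).
  elim: k x => [|k IH] x; first by rewrite mul0mx dot0r psd_ge0.
  by rewrite hs [in leRHS]hs; apply: ric_map_mono.
have [P hP] := monotone_mcvg (fun k => psd_sym (hp k)) hm hb.
have psP : psd P.
  apply: psdP => [|x]; first exact: (mcvg_sym (fun k => psd_sym (hp k)) hP).
  by apply: (mcvg_quad_ge hP) => k; exact: psd_ge0.
have hle k x : dot x (Ps k *m x) <= dot x (P *m x).
  have hmm l : dot x (Ps k *m x) <= dot x (Ps (l + k)%N *m x).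
    by elim: l => // l /le_trans; apply; exact: hm.
  have h' : mcvg (fun l => Ps (l + k)%N) P.
    move=> i j; have := hP i j.
    by rewrite -(cvg_shiftn k (fun l => Ps l i j)).
  exact: (mcvg_quad_ge h').
have nP k : mxnorm2 (Ps k) <= LP L alpha by apply: psd_norm_le => //; exact: LP_gt0.
exists P; split => //; apply: quad_inj => [||x]; rewrite ?psd_sym//.
  exact: ric_map_psd.
apply/eqP; rewrite eq_le; apply/andP; split; last first.
  apply: (mcvg_quad_le (mcvgS hP)) => k; rewrite hs.
  by apply: ric_map_mono => // y; exact: hle.
pose c := (L + L * (LP L alpha * L ^+ 2 / gamma)) ^+ 2 * dot x x.
pose eps k := \sum_i \sum_j `|(P - Ps k) i j|.
have heps : ((fun k => dot x (P *m x) + eps k * c) @ \oo --> dot x (P *m x))%classic.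
  rewrite -[X in (_ --> X)%classic]addr0 -(mul0r c).
  apply: cvgD; first exact: cvg_cst.
  apply: cvgM; last exact: cvg_cst.
  have -> : (0 : F) = \sum_(i < n) \sum_(j < n) 0 by rewrite big1// => i _; rewrite big1.
  apply: cvgn_sum => i; apply: cvgn_sum => j.
  rewrite -[X in (_ --> X)%classic](normr0 F); apply: cvg_norm.
  rewrite -(subrr (P i j)); under [X in (X @ _)%classic]eq_fun do rewrite !mxE.
  by apply: cvgB; [exact: cvg_cst|exact: hP].
have /cvgr_to_ge := heps; apply; apply: nearW => k.
(* The gain of the k-th iterate, suboptimal for P, bounds [ric_map P] by the next iterate plus an
   error governed by P - P_k. The gains are bounded uniformly in k, so the error tends to 0 and
   continuity of the inverse is never invoked. *)
set Phi := A - B *m ric_gain (Ps k).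
have h1 : dot x (ric_map P *m x) <= dot x (Ps k.+1 *m x)
    + dot (Phi *m x) ((P - Ps k) *m (Phi *m x)).
  rewrite hs (ric_map_gain x (hp k)) -/Phi.
  apply: (le_trans (ric_map_le x (- (ric_gain (Ps k) *m x)) psP)).
  have -> : A *m x + B *m - (ric_gain (Ps k) *m x) = Phi *m x.
    by rewrite mulmxN mulmxBl mulmxA.
  by rewrite mulmxN dotNl dotNr opprK [(P - Ps k) *m _]mulmxBl dotBr; lra.
apply: (le_trans h1); apply: lerD; first exact: hle.
have /ler_normlW h2 := dot_mxnorm2 (Phi *m x) (Phi *m x) (mxnorm2_entries (P - Ps k)).
apply: (le_trans h2); rewrite -mulrA -expr2 sqr_norm2 ler_wpM2l//.
  by apply: sumr_ge0 => i _; apply: sumr_ge0.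
have g0 : 0 <= LP L alpha * L ^+ 2 / gamma.
  apply: mulr_ge0; last by rewrite invr_ge0 ltW.
  by apply: mulr_ge0; [exact: ltW LP_gt0|rewrite exprn_ge0// ltW].
apply: norm2_le_sqr; first by rewrite addr_ge0 ?(mulr_ge0 _ g0)// ltW.
apply: norm2_mulmx_le; apply: (le_trans (mxnorm2D _ _)); rewrite mxnorm2N.
by apply: lerD => //; apply: mxnorm2M_le => //; exact: ric_gain_norm.
Qed.

Lemma PstarP : let P := Pstar A B Q R in
  [/\ psd P, ric_map P = P, mxnorm2 P <= LP L alpha & Kstar A B Q R = ric_gain P].
Proof.
have h : psd (Pstar A B Q R) /\ riccati A B Q R (Pstar A B Q R).
  rewrite /Pstar; case: xgetP => [? -> //|].
  by have [P [hP e]] := riccati_exists => /(_ P) []; split => //; exact/esym.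
case: h => hP e; have {}e : ric_map (Pstar A B Q R) = Pstar A B Q R by exact/esym.
by split=> //; exact: riccati_norm.
Qed.

End Bounded.
End Riccati.

(** * Decay of the inverse of a banded operator *)

(* If [H] has bandwidth 1 for the filtration [Z], then (1 - H^2 / c)^k v differs
   from [v] by a polynomial in [H] of degree 2k - 1 applied to [H v]; this
   contracts [v] by the factor ((Lam^2 - gam^2) / (Lam^2 + gam^2)) ^ k. *)
Section InverseDecay.
Variables (F : realType) (V : lmodType F) (f : V -> V -> F) (H : V -> V).
Variables (Lam gam : F).
Hypotheses (fD : forall u v w, f (u + v) w = f u w + f v w).
Hypotheses (fZ : forall a u v, f (a *: u) v = a * f u v).
Hypotheses (fC : forall u v, f u v = f v u).
Hypotheses (HD : forall u v, H (u + v) = H u + H v).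
Hypotheses (HZ : forall a u, H (a *: u) = a *: H u).
Hypotheses (Hs : forall u v, f (H u) v = f u (H v)).
Hypotheses (gam0 : 0 < gam) (gamLam : gam < Lam).
Hypotheses (hU : forall v, `|f (H v) v| <= Lam * f v v).
Hypotheses (hL : forall v, gam ^+ 2 * f v v <= f (H v) (H v)).

Let Lam0 : 0 < Lam := lt_trans gam0 gamLam.
Let c := (Lam ^+ 2 + gam ^+ 2) / 2.
Let r2 := (Lam ^+ 2 - gam ^+ 2) / (Lam ^+ 2 + gam ^+ 2).
Let X v := v - c^-1 *: H (H v).

Let c0 : 0 < c.
Proof. by rewrite divr_gt0// addr_gt0// exprn_gt0. Qed.

Let r20 : 0 < r2.
Proof.
apply: divr_gt0; last by rewrite addr_gt0// exprn_gt0.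
by rewrite subr_gt0 ltr_pXn2r// ?nnegrE ltW.
Qed.

Let XD u v : X (u + v) = X u + X v.
Proof. by rewrite /X !HD scalerDr opprD addrACA. Qed.

Let XZ a u : X (a *: u) = a *: X u.
Proof. by rewrite /X !HZ scalerBr !scalerA mulrC. Qed.

Let fN u w : f (- u) w = - f u w.
Proof. by rewrite -scaleN1r fZ mulN1r. Qed.

Let XE u v : f (X u) v = f u v - c^-1 * f (H u) (H v).
Proof. by rewrite /X fD fN fZ Hs. Qed.

(** In the sense of forms H^2 lies between gam^2 and Lam^2, and [c] is the midpoint of this
    interval; 1 - H^2 / c therefore lies between - r2 and r2. Polarization is used twice: to pass
    from the form bound [hU] to |H v|, and from the form of X to |X v|. *)
Let X_contract v : f (X v) (X v) <= r2 ^+ 2 * f v v.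
Proof.
have Lam2 : 0 < Lam ^+ 2 by rewrite exprn_gt0.
have gam2 : 0 < gam ^+ 2 by rewrite exprn_gt0.
apply: polarization_bound => // [u w|u]; first by rewrite [RHS]fC !XE (fC w) (fC (H w)).
have hU2 := polarization_bound fD fZ fC HD HZ Hs Lam0 hU u.
have d0 : Lam ^+ 2 + gam ^+ 2 != 0 by rewrite gt_eqF// addr_gt0.
have e1 : c * (f u u - c^-1 * f (H u) (H u)) = c * f u u - f (H u) (H u).
  by rewrite mulrBr mulVKf// gt_eqF.
have e2 : c * (r2 * f u u) = (Lam ^+ 2 - gam ^+ 2) / 2 * f u u.
  by rewrite /c /r2; field.
have h := hL u; rewrite XE ler_norml; apply/andP; split;
  rewrite -(ler_pM2l c0) e1 ?mulrN e2 /c; lra.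
Qed.

Variables (Z : nat -> V -> Prop) (T : nat).
Hypotheses (Z0 : forall k, Z k 0) (ZS : forall k v, Z k v -> Z k.+1 v).
Hypotheses (ZD : forall k u v, Z k u -> Z k v -> Z k (u + v)).
Hypotheses (ZZ : forall k a u, Z k u -> Z k (a *: u)).
Hypotheses (ZH : forall k u, (k < T)%N -> Z k u -> Z k.+1 (H u)).

Let ZX k u : (k.+1 < T)%N -> Z k u -> Z k.+2 (X u).
Proof.
move=> kT hu; rewrite /X -scaleNr; apply: ZD; first by do 2!apply: ZS.
by apply/ZZ/ZH => //; apply: ZH => //; exact: ltnW.
Qed.

Let Z_iter k u : (k.*2 <= T)%N -> Z 0 u -> Z k.*2 (iter k X u).
Proof.
elim: k => [//|k IH] kT hu; rewrite doubleS iterS; apply: ZX; first by lia.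
by apply: IH => //; lia.
Qed.

(** At k = 0 the index [k.*2.-1] is cut off at 0 and membership in Z 0 says too little, hence the
    separate clause v' = 0. *)
Lemma inverse_decay v k : (k.*2 <= T)%N -> Z 0 (H v) ->
  exists v', [/\ Z k.*2.-1 v', k = 0%N -> v' = 0 &
    f (v - v') (v - v') <= (r2 ^+ 2) ^+ k * (gam ^- 2 * f (H v) (H v))].
Proof.
move=> kT hv.
have hit j : X (iter j X v) = iter j X v - c^-1 *: iter j X (H (H v)).
  elim: j => [//|j IH]; rewrite !iterS {1}IH -scaleNr XD XZ.
  by rewrite scaleNr.
have hX : exists v', [/\ Z k.*2.-1 v', k = 0%N -> v' = 0 & v - v' = iter k X v].
  elim: k kT => [|k IH] kT; first by exists 0; split; rewrite ?subr0.
  have [|v' [zv' _ ev']] := IH; first by lia.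
  (* Telescoping: one more factor X subtracts c^-1 H X^k (H v), which lies in level 2 k + 1 because
     H v lies in level 0. *)
  exists (v' + c^-1 *: H (iter k X (H v))); split => //.
    apply: ZD.
      have le i j u : (i <= j)%N -> Z i u -> Z j u.
        by move=> ij hz; rewrite -(subnK ij); elim: (j - i)%N => // l; exact: ZS.
      by apply: le zv'; lia.
    by apply: ZZ; rewrite doubleS /=; apply: ZH; [lia|apply: Z_iter => //; lia].
  rewrite opprD addrA ev' iterS hit; congr (_ - _ *: _).
  elim: k {IH kT v' zv' ev'} => [//|k IH]; rewrite !iterS -IH /X.
  by rewrite -scaleNr HD HZ scaleNr.
have [v' [zv' v0 ev']] := hX; exists v'; split => //; rewrite ev'.
have hk : f (iter k X v) (iter k X v) <= (r2 ^+ 2) ^+ k * f v v.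
  elim: k {kT hX v' zv' v0 ev'} => [|k IH]; first by rewrite expr0 mul1r.
  rewrite iterS (le_trans (X_contract _))// [_ ^+ k.+1]exprS -mulrA ler_wpM2l//.
  by rewrite exprn_ge0// ltW.
apply: (le_trans hk); rewrite ler_wpM2l ?exprn_ge0//; first exact: ltW.
by rewrite ler_pdivlMl ?exprn_gt0.
Qed.

End InverseDecay.

(** * Finite-horizon signals and the energy gain of a stable system *)

Section Sequences.
Variables (F : realType) (T : nat).

(** Signals are functions on all of [nat], hence form a module pointwise. Entries after T are
    invisible, so this form is degenerate, which is why the abstract decay argument assumes no
    definiteness. *)
Definition sdot k (x y : nat -> 'cV[F]_k) : F := \sum_(t < T.+1) dot (x t) (y t).

Lemma sdotC k (x y : nat -> 'cV[F]_k) : sdot x y = sdot y x.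
Proof. by apply: eq_bigr => t _; exact: dotC. Qed.

Lemma sdotDl k (x y z : nat -> 'cV[F]_k) : sdot (x + y) z = sdot x z + sdot y z.
Proof. by rewrite /sdot -big_split; apply: eq_bigr => t _; exact: dotDl. Qed.

Lemma sdotDr k (x y z : nat -> 'cV[F]_k) : sdot z (x + y) = sdot z x + sdot z y.
Proof. by rewrite sdotC sdotDl !(sdotC z). Qed.

Lemma sdotZl k a (x z : nat -> 'cV[F]_k) : sdot (a *: x) z = a * sdot x z.
Proof. by rewrite /sdot mulr_sumr; apply: eq_bigr => t _; exact: dotZl. Qed.

Lemma sdotZr k a (x z : nat -> 'cV[F]_k) : sdot z (a *: x) = a * sdot z x.
Proof. by rewrite sdotC sdotZl (sdotC z). Qed.

Lemma sdotNl k (x z : nat -> 'cV[F]_k) : sdot (- x) z = - sdot x z.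
Proof. by rewrite -scaleN1r sdotZl mulN1r. Qed.

Lemma sdotNr k (x z : nat -> 'cV[F]_k) : sdot z (- x) = - sdot z x.
Proof. by rewrite sdotC sdotNl (sdotC z). Qed.

Lemma sdot_ge0 k (x : nat -> 'cV[F]_k) : 0 <= sdot x x.
Proof. by apply: sumr_ge0 => t _; exact: dot_ge0. Qed.

Lemma sdot_young k s (x y : nat -> 'cV[F]_k) : 0 < s ->
  2 * sdot x y <= s * sdot x x + s^-1 * sdot y y.
Proof.
move=> s0; have sn : s != 0 by rewrite gt_eqF.
have := sdot_ge0 (s *: x - y); rewrite !sdotDl !sdotDr !sdotNl !sdotNr !sdotZl !sdotZr.
rewrite (sdotC y x) -(pmulr_rge0 _ (_ : 0 < s^-1)) ?invr_gt0//.
have -> : s^-1 * (s * (s * sdot x x) - s * sdot x y + (- (s * sdot x y) - - sdot y y))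
   = s * sdot x x + s^-1 * sdot y y - 2 * sdot x y by field.
by rewrite subr_ge0.
Qed.

Lemma sdot_sqB k (x y : nat -> 'cV[F]_k) :
  sdot (x - y) (x - y) <= 2 * (sdot x x + sdot y y).
Proof.
have := sdot_ge0 (x + y); rewrite !sdotDl !sdotDr !sdotNl !sdotNr (sdotC y x); lra.
Qed.

Lemma sdot_sqD k (x y : nat -> 'cV[F]_k) :
  sdot (x + y) (x + y) <= 2 * (sdot x x + sdot y y).
Proof.
have := sdot_ge0 (x - y); rewrite !sdotDl !sdotDr !sdotNl !sdotNr (sdotC y x); lra.
Qed.

Lemma sdot_le k l (x : nat -> 'cV[F]_k) (y : nat -> 'cV[F]_l) c : 0 <= c ->
  (forall t, (t <= T)%N -> norm2 (x t) <= c * norm2 (y t)) ->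
  sdot x x <= c ^+ 2 * sdot y y.
Proof.
move=> c0 h; rewrite /sdot mulr_sumr; apply: ler_sum => t _.
by apply: norm2_le_sqr => //; apply: h; rewrite -ltnS.
Qed.

(** The scalar filter y_(t+1) = a y_t + |w_(t+1)| dominates the state: |Phi^j x_t| <= L a^j y_t.
    Carrying all powers Phi^j through the induction keeps the constant L from compounding. *)
Lemma stable_response n (Phi : 'M[F]_n) L a (x w : nat -> 'cV[F]_n) :
  0 <= L -> 0 <= a -> a < 1 -> stable L a Phi ->
  x 0%N = w 0%N -> (forall t, (t < T)%N -> x t.+1 = Phi *m x t + w t.+1) ->
  sdot x x <= (L / (1 - a)) ^+ 2 * sdot w w.
Proof.
move=> L0 a0 a1 hs x0 xS; have a1' : 0 < 1 - a by rewrite subr_gt0.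
have an : 1 - a != 0 by rewrite gt_eqF.
pose y := fix y t := if t is s.+1 then a * y s + norm2 (w t) else norm2 (w 0%N).
have y0 t : 0 <= y t.
  by elim: t => [|t IH] /=; rewrite ?addr_ge0 ?mulr_ge0 ?norm2_ge0.
have hy t j : (t <= T)%N -> norm2 (Phi ^+ j *m x t) <= L * a ^+ j * y t.
  elim: t j => [|t IH] j tT; first by rewrite x0; exact: stable_norm2.
  rewrite xS// mulmxDr (le_trans (ler_norm2D _ _))//= mulrDr lerD ?stable_norm2//.
  have -> : Phi ^+ j *m (Phi *m x t) = Phi ^+ j.+1 *m x t by rewrite mulmxA exprSr.
  by apply: (le_trans (IH _ (ltnW tT))); rewrite exprSr !mulrA.
(* The term in y_t^2 is a storage function: with it the gain 1 / (1 - a) of the scalar filter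
   follows by induction, the defect of each step being a perfect square. *)
have hsum t : \sum_(s < t.+1) y s ^+ 2 + a / (1 - a) * y t ^+ 2 <=
   (1 - a) ^- 2 * \sum_(s < t.+1) norm2 (w s) ^+ 2.
  elim: t => [|t IH].
    rewrite !big_ord_recr !big_ord0 /= !add0r.
    have -> : norm2 (w 0%N) ^+ 2 + a / (1 - a) * norm2 (w 0%N) ^+ 2 =
      (1 - a)^-1 * norm2 (w 0%N) ^+ 2 by field.
    have v1 : 1 <= (1 - a)^-1 by rewrite -[leLHS]invr1 lef_pV2 ?posrE// gerBl.
    by rewrite ler_wpM2r ?sqr_ge0// -exprVn expr2 ler_peMr// (le_trans ler01).
  rewrite big_ord_recr [in leRHS]big_ord_recr /= mulrDr -addrA.
  rewrite -(lerD2r (- (a / (1 - a) * y t ^+ 2))) in IH.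
  apply: (le_trans (lerD _ (lexx _)) _).
    by move: IH; rewrite addrK; apply.
  rewrite -addrA lerD2l.
  set Y := y t; set W := norm2 _.
  have -> : - (a / (1 - a) * Y ^+ 2) + ((a * Y + W) ^+ 2 + a / (1 - a) * (a * Y + W) ^+ 2)
     = (1 - a) ^- 2 * W ^+ 2 - a * (1 - a) ^- 2 * (W - (1 - a) * Y) ^+ 2.
    by field.
  by rewrite gerBl mulr_ge0 ?sqr_ge0// mulr_ge0// invr_ge0 sqr_ge0.
apply: (@le_trans _ _ (L ^+ 2 * \sum_(s < T.+1) y s ^+ 2)).
  rewrite /sdot mulr_sumr; apply: ler_sum => t _.
  have := hy t 0%N _; rewrite expr0 mul1mx mulr1 -sqr_norm2 -exprMn => h.
  by rewrite lerXn2r ?nnegrE ?mulr_ge0 ?norm2_ge0// h// -ltnS.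
rewrite exprMn -[leRHS]mulrA ler_wpM2l ?sqr_ge0//.
have := hsum T; rewrite exprVn => h.
have -> : sdot w w = \sum_(s < T.+1) norm2 (w s) ^+ 2.
  by apply: eq_bigr => s _; rewrite sqr_norm2.
by apply: le_trans h; rewrite lerDl mulr_ge0 ?sqr_ge0// divr_ge0// ltW.
Qed.

End Sequences.

(** * The optimality system *)

Section Constants.
Variables (F : realType) (L alpha gamma : F).
Hypotheses (L1 : 1 < L) (alpha0 : 0 < alpha) (alpha1 : alpha < 1).
Hypotheses (gamma0 : 0 < gamma) (gamma1 : gamma < 1).

Let L0 : 0 < L := lt_trans ltr01 L1.
Local Notation lH := (LH L alpha).
Local Notation gF := (gammaF L alpha).
Local Notation gG := (gammaG L alpha gamma).
Local Notation gH := (gammaH L alpha gamma).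
Local Notation rh := (rho L alpha gamma).

Lemma LH_ge_L : 2 * L + 1 <= lH.
Proof. by rewrite le_max lexx. Qed.

Lemma LH_ge_LP : LP L alpha + 1 <= lH.
Proof. by rewrite le_max lexx orbT. Qed.

Lemma LH_ge3 : 3 <= lH.
Proof. by apply: le_trans LH_ge_L; have := L1; lra. Qed.

Lemma gammaF_inv : gF^-1 = (L * (1 + L) / (1 - alpha)) ^+ 2.
Proof. by rewrite invf_div -exprMn -expr_div_n. Qed.

Lemma gammaF_inv_ge : 4 <= gF^-1.
Proof.
rewrite gammaF_inv -[leLHS](_ : 2 ^+ 2 = 4 :> F); last by ring.
have h : 2 <= L * (1 + L) / (1 - alpha).
  by rewrite ler_pdivlMr ?subr_gt0//; have := L1; have := alpha0; nra.
by rewrite lerXn2r ?nnegrE// (le_trans _ h).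
Qed.

Lemma gammaG_gt0 : 0 < gG.
Proof.
by rewrite divr_gt0 ?mulr_gt0 ?exprn_gt0 ?subr_gt0// addr_gt0.
Qed.

Lemma gammaG_inv : gG^-1 = 2 * L ^+ 2 / (1 - alpha) ^+ 2 * L ^+ 2 * (1 + L) ^+ 2 / gamma.
Proof.
rewrite invf_div; field; rewrite subr_eq0 !gt_eqF//.
Qed.

Lemma gammaG_inv_ge : 1 <= gG^-1.
Proof.
rewrite -[leLHS]invr1 lef_pV2 ?posrE ?gammaG_gt0//.
rewrite ler_pdivrMr ?mul1r ?mulr_gt0 ?exprn_gt0 ?addr_gt0//.
have h1 : (1 - alpha) ^+ 2 * gamma <= 1.
  by rewrite mulr_ile1 ?exprn_ge0 ?exprn_ile1// ?subr_ge0 ?gerBl ltW.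
apply: (le_trans h1); have L4 : 1 <= L ^+ 4 by rewrite exprn_ege1// ltW.
have L2 : 1 <= (1 + L) ^+ 2 by rewrite exprn_ege1// lerDl ltW.
have : 1 <= L ^+ 4 * (1 + L) ^+ 2 by rewrite mulr_ege1.
by lra.
Qed.

(** Retains a single product from the definition of [gammaH], with [mubar] replaced by its leading
    term 2 LH^2 / (gammaG gammaF). *)
Lemma gammaH_inv_ge : 2 * lH ^+ 4 * gG^-1 * gF^-1 ^+ 2 <= gH^-1.
Proof.
have h3 := LH_ge3; have f4 := gammaF_inv_ge; have g1 := gammaG_inv_ge.
rewrite /gammaH /= invrK; set mu := mubar L alpha gamma.
have gG0 := gammaG_gt0.
have lH0 : 0 <= lH by lra.
have f0 : 0 <= gF^-1 by lra.
have g0 : 0 <= gG^-1 by lra.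
have mu_ge : 2 * lH ^+ 2 * gG^-1 * gF^-1 <= mu.
  rewrite /mu /mubar /= ler_wpM2r//; lra.
have t0 : 0 <= 2 * lH ^+ 2 * gG^-1 * gF^-1.
  by rewrite !mulr_ge0 ?exprn_ge0.
have mu0 : 0 <= mu := le_trans t0 mu_ge.
have h1 : lH * (mu * lH) / gF <= lH * (1 + mu * lH) / gF.
  by rewrite ler_wpM2r// ler_wpM2l// lerDr.
have h2 : 0 <= lH * (1 + mu * lH) / gF.
  by rewrite !mulr_ge0// addr_ge0// mulr_ge0.
have c1 : 1 <= 1 + 4 * lH / gG + 4 * lH ^+ 2 / gG ^+ 2.
  rewrite -addrA lerDl addr_ge0 ?mulr_ge0 ?exprn_ge0// invr_ge0 exprn_ge0//.
  exact: ltW.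
have h4 : lH * (1 + mu * lH) / gF <=
    (1 + 4 * lH / gG + 4 * lH ^+ 2 / gG ^+ 2) * (lH * (1 + mu * lH) / gF).
  by rewrite ler_peMl.
have h5 : 2 * lH ^+ 4 * gG^-1 * gF^-1 ^+ 2 <= lH * (mu * lH) / gF.
  have c0 : 0 <= lH ^+ 2 * gF^-1 by rewrite mulr_ge0 ?exprn_ge0.
  have := ler_wpM2l c0 mu_ge; lra.
have h6 : 0 <= 2 / gG by rewrite mulr_ge0.
lra.
Qed.

Lemma gammaH_inv_ge1 : 1 < gH^-1.
Proof.
have h3 := LH_ge3; have f4 := gammaF_inv_ge; have g1 := gammaG_inv_ge.
apply: lt_le_trans gammaH_inv_ge.
have l1 : 1 <= lH ^+ 4 by rewrite exprn_ege1//; lra.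
have f1 : 1 <= gF^-1 ^+ 2 by rewrite exprn_ege1//; lra.
have : 1 <= lH ^+ 4 * gG^-1 * gF^-1 ^+ 2 by rewrite mulr_ege1// mulr_ege1.
lra.
Qed.

Lemma gammaH_gt0 : 0 < gH.
Proof. by rewrite -invr_gt0; have := gammaH_inv_ge1; lra. Qed.

Lemma gammaH_lt1 : gH < 1.
Proof. by have := gammaH_inv_ge1; rewrite invf_gt1 ?gammaH_gt0. Qed.

Lemma gammaH_lt_LH : gH < lH.
Proof. by have := LH_ge3; have := gammaH_lt1; lra. Qed.

Lemma sqr_rho : rh ^+ 2 = (lH ^+ 2 - gH ^+ 2) / (lH ^+ 2 + gH ^+ 2).
Proof.
have h := gammaH_lt_LH; have h0 := gammaH_gt0.
rewrite sqr_sqrtr//; apply: divr_ge0; last by rewrite addr_ge0// sqr_ge0.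
by rewrite subr_ge0 lerXn2r// ?nnegrE ltW// (lt_trans h0).
Qed.

Lemma rho_gt0 : 0 < rh.
Proof.
have h := gammaH_lt_LH; have h0 := gammaH_gt0.
have l0 : 0 < lH := lt_trans h0 h.
rewrite sqrtr_gt0; apply: divr_gt0; last by rewrite addr_gt0// exprn_gt0.
by rewrite subr_gt0 ltr_pXn2r// nnegrE ltW.
Qed.

Lemma rho_lt1 : rh < 1.
Proof.
have h := gammaH_lt_LH; have h0 := gammaH_gt0.
have l0 : 0 < lH := lt_trans h0 h.
rewrite -(@ltr_pXn2r _ 2)// ?nnegrE ?(ltW rho_gt0)// expr1n sqr_rho.
rewrite ltr_pdivrMr ?addr_gt0 ?exprn_gt0// mul1r.
have : 0 < gH ^+ 2 by rewrite exprn_gt0.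
lra.
Qed.

(** The factor 1 / rho will pay for rounding a distance down to an even number. *)
Lemma Upsilon_ge : gH^-1 * rh^-1 <= Upsilon L alpha gamma.
Proof.
have h := gammaH_lt_LH; have h0 := gammaH_gt0; have r0 := rho_gt0.
have l0 : 0 < lH := lt_trans h0 h.
rewrite /Upsilon invfM mulrA ler_wpM2r ?invr_ge0 ?(ltW r0)//.
rewrite ler_pdivlMr ?exprn_gt0// expr2 mulKf ?gt_eqF//.
exact: ltW.
Qed.

Lemma Upsilon_ge1 : 1 <= Upsilon L alpha gamma.
Proof.
apply: le_trans Upsilon_ge; rewrite mulr_ege1//.
  exact/ltW/gammaH_inv_ge1.
by rewrite -[leLHS]invr1 lef_pV2 ?posrE ?rho_gt0// ltW// rho_lt1.
Qed.

End Constants.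

(** The scalar part of the lower bound on the optimality system. [Zh] and [W] are the squared norms
    of a particular solution of the dynamics and of the homogeneous remainder, [Z] and [s] those of
    the primal variables and of the multipliers, [a] and [b] those of the residuals; [fi] and [g]
    are the inverses of [gammaF] and [gammaG], and [h] is [LH]. *)
Lemma kkt_lower_constants (F : realFieldType) (W Z s a b Zh g fi h gH : F) :
  4 <= fi -> 0 < gH ->
  Z <= 2 * W + 2 * Zh -> s <= 2 * fi * (a + h ^+ 2 * Z) -> Zh <= fi * b ->
  0 <= a -> 0 <= b -> 0 <= Zh -> 2 * h ^+ 4 * g * fi ^+ 2 <= gH^-1 ->
  1 <= g -> 3 <= h -> W <= 2 * g ^+ 2 * (a + h ^+ 2 * Zh) ->
  Z + s <= gH ^- 2 * (a + b).
Proof.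
move=> f4 gH0 hZ hs hZh a0 b0 Zh0 hC g1 h3 hW.
have f0 : 0 <= fi by lra.
have g0 : 0 <= g by lra.
have h0 : 0 <= h by lra.
have y9 : 9 <= h ^+ 2 by nra.
have G1 : 1 <= g ^+ 2 by rewrite exprn_ege1.
set y := h ^+ 2 in hs hW y9 *; set G := g ^+ 2 in hW G1 *.
have y0 : 0 <= y by lra.
have G0 : 0 <= G by lra.
pose c := a + b; have c0 : 0 <= c by rewrite addr_ge0.
have yf1 : 1 <= y * fi by rewrite mulr_ege1//; lra.
have h1 : Zh <= fi * c by apply: (le_trans hZh); rewrite ler_wpM2l// lerDr.
have h2 : a + y * Zh <= 2 * (y * fi * c).
  have := ler_wpM2r c0 yf1; have := ler_wpM2l y0 h1; rewrite /c; lra.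
have yG1 : 1 <= G * y by rewrite mulr_ege1//; lra.
have fc0 : 0 <= fi * c by rewrite mulr_ge0.
have h4 : Z <= 10 * (G * y * fi * c).
  have := ler_wpM2r fc0 yG1; have := ler_wpM2l G0 h2; lra.
have yZ : y * Z <= 10 * (G * y ^+ 2 * fi * c) by have := ler_wpM2l y0 h4; lra.
have t1 : 1 <= G * y ^+ 2 * fi.
  have y21 : 1 <= y ^+ 2 by rewrite exprn_ege1//; lra.
  by rewrite mulr_ege1 ?(mulr_ege1 G1 y21)//; lra.
have h5 : s <= 22 * (G * y ^+ 2 * fi ^+ 2 * c).
  have u1 : a + y * Z <= 11 * (G * y ^+ 2 * fi * c).
    have ac : a <= c by rewrite lerDl.
    have := ler_wpM2r c0 t1; lra.
  by have := ler_wpM2l f0 u1; lra.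
have yf : 1 <= y * fi by rewrite mulr_ege1//; lra.
have h6 : Z <= 10 * (G * y ^+ 2 * fi ^+ 2 * c).
  have u0 : 0 <= G * y * fi * c by rewrite !mulr_ge0.
  by have := ler_wpM2r u0 yf; lra.
have h7 : 4 * G * y ^+ 4 * fi ^+ 4 <= gH ^- 2.
  have p0 : 0 <= 2 * h ^+ 4 * g * fi ^+ 2 by rewrite !mulr_ge0// exprn_ge0.
  have := lerXn2r 2 p0 (le_trans p0 hC) hC.
  rewrite exprVn; apply: le_trans; rewrite /G /y le_eqVlt; apply/orP; left.
  by apply/eqP; ring.
(* Z + s is at most 32 G y^2 fi^2 c, while 8 <= y^2 fi^2 makes 4 G y^4 fi^4 at least 32 G y^2
   fi^2. *)
apply: le_trans (ler_wpM2r c0 h7).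
have h9 : 36 <= y * fi by nra.
have h8 : 8 <= y ^+ 2 * fi ^+ 2 by rewrite -exprMn; nra.
have v0 : 0 <= G * y ^+ 2 * fi ^+ 2 * c by rewrite !mulr_ge0// exprn_ge0.
have := ler_wpM2r v0 h8; lra.
Qed.

(** * Symmetry and two-sided bounds of the optimality system *)

Section KKT.
Variables (F : realType) (n m : nat).
Variables (A : 'M[F]_n) (B : 'M[F]_(n, m)) (Q : 'M[F]_n) (R : 'M[F]_m).
Variables (P : 'M[F]_n) (T : nat).

Implicit Types (x l : nat -> 'cV[F]_n) (u : nat -> 'cV[F]_m).

Local Notation V := ((nat -> 'cV[F]_n) * (nat -> 'cV[F]_m) * (nat -> 'cV[F]_n))%type.

(** The value 0 at time 0 makes the initial state the row 0 of the dynamics [x - kkt_prev x u].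
    Dually [kkt_next] is 0 at time T, so that summation by parts leaves no boundary term. *)
Definition kkt_prev x u (t : nat) : 'cV[F]_n :=
  if t is s.+1 then A *m x s + B *m u s else 0.

Definition kkt_next k (M : 'M[F]_(k, n)) l (t : nat) : 'cV[F]_k :=
  if (t < T)%N then M *m l t.+1 else 0.

Definition kkt_state x (t : nat) : 'cV[F]_n := (if (t < T)%N then Q else P) *m x t.

Definition kkt_input u (t : nat) : 'cV[F]_m := R *m u t.

(* The optimality system of the problem with horizon [T] and terminal cost [P];
   a triple consists of states, inputs and multipliers.  The input at time [T]
   is a dummy. *)
Definition kkt (v : V) : V :=
  (kkt_state v.1.1 + v.2 - kkt_next A^T v.2, kkt_input v.1.2 - kkt_next B^T v.2,
   v.1.1 - kkt_prev v.1.1 v.1.2).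

Definition kkt_dot (v w : V) : F :=
  sdot T v.1.1 w.1.1 + sdot T v.1.2 w.1.2 + sdot T v.2 w.2.

Lemma kkt_prevD x x' u u' :
  kkt_prev (x + x') (u + u') = kkt_prev x u + kkt_prev x' u'.
Proof.
apply/funext => -[|t]; rewrite !fctE /= ?addr0//.
by rewrite !mulmxDr addrACA.
Qed.

Lemma kkt_prevZ a x u : kkt_prev (a *: x) (a *: u) = a *: kkt_prev x u.
Proof.
apply/funext => -[|t]; rewrite !fctE /= ?scaler0//.
by rewrite scalerDr !scalemxAr.
Qed.

Lemma kkt_nextD k (M : 'M[F]_(k, n)) l l' :
  kkt_next M (l + l') = kkt_next M l + kkt_next M l'.
Proof.
apply/funext => t; rewrite !fctE /kkt_next; case: ifP => _; rewrite ?addr0//.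
by rewrite /= mulmxDr.
Qed.

Lemma kkt_nextZ k (M : 'M[F]_(k, n)) a l : kkt_next M (a *: l) = a *: kkt_next M l.
Proof.
apply/funext => t; rewrite !fctE /kkt_next; case: ifP => _; rewrite ?scaler0//.
by rewrite /= scalemxAr.
Qed.

Lemma kkt_stateD x x' : kkt_state (x + x') = kkt_state x + kkt_state x'.
Proof. by apply/funext => t; rewrite !fctE /kkt_state /= mulmxDr. Qed.

Lemma kkt_stateZ a x : kkt_state (a *: x) = a *: kkt_state x.
Proof. by apply/funext => t; rewrite !fctE /kkt_state /= scalemxAr. Qed.

Lemma kkt_inputD u u' : kkt_input (u + u') = kkt_input u + kkt_input u'.
Proof. by apply/funext => t; rewrite !fctE /kkt_input /= mulmxDr. Qed.

Lemma kkt_inputZ a u : kkt_input (a *: u) = a *: kkt_input u.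
Proof. by apply/funext => t; rewrite !fctE /kkt_input /= scalemxAr. Qed.

Lemma kktD v w : kkt (v + w) = kkt v + kkt w.
Proof.
congr (_, _, _) => /=.
- by rewrite kkt_stateD kkt_nextD opprD [RHS]addrACA (addrACA (kkt_state _)).
- by rewrite kkt_inputD kkt_nextD opprD addrACA.
- by rewrite kkt_prevD opprD addrACA.
Qed.

Lemma kktZ a v : kkt (a *: v) = a *: kkt v.
Proof.
congr (_, _, _) => /=.
- by rewrite kkt_stateZ kkt_nextZ scalerBr scalerDr.
- by rewrite kkt_inputZ kkt_nextZ scalerBr.
- by rewrite kkt_prevZ scalerBr.
Qed.

Lemma kkt_dotD v w z : kkt_dot (v + w) z = kkt_dot v z + kkt_dot w z.
Proof. rewrite /kkt_dot /= !sdotDl; ring. Qed.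

Lemma kkt_dotZ a v w : kkt_dot (a *: v) w = a * kkt_dot v w.
Proof. rewrite /kkt_dot /= !sdotZl; ring. Qed.

Lemma kkt_dotC v w : kkt_dot v w = kkt_dot w v.
Proof. by congr (_ + _ + _); exact: sdotC. Qed.

Lemma kkt_adj x u l : sdot T (kkt_prev x u) l =
  sdot T x (kkt_next A^T l) + sdot T u (kkt_next B^T l).
Proof.
rewrite /sdot big_ord_recl /= dot0l add0r.
rewrite [X in _ = X + _]big_ord_recr [X in _ = _ + X]big_ord_recr /=.
have e k (M : 'M[F]_(k, n)) : kkt_next M l T = 0 by rewrite /kkt_next ltnn.
rewrite !e !dot0r !addr0 -big_split; apply: eq_bigr => t _ /=.
by rewrite /kkt_next ltn_ord dotDl !dotM.
Qed.

Section Bounds.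
Variables (L alpha gamma : F).
Hypotheses (L1 : 1 < L) (alpha0 : 0 < alpha) (alpha1 : alpha < 1).
Hypotheses (gamma0 : 0 < gamma) (gamma1 : gamma < 1).
Hypotheses (nA : mxnorm2 A <= L) (nB : mxnorm2 B <= L).
Hypotheses (nQ : mxnorm2 Q <= L) (nR : mxnorm2 R <= L).
Hypotheses (psdQ : psd Q) (psdR : psd (R - gamma%:M)).
Hypotheses (psdP : psd P) (nP : mxnorm2 P <= LP L alpha).
Hypotheses (stabAB : stabilizable L alpha A B).
Hypotheses (detAQ : detectable L alpha A (psd_sqrt Q)).

Let L0 : 0 < L := lt_trans ltr01 L1.
Let psdR0 := psd_input_cost gamma0 psdR.
Local Notation lH := (LH L alpha).

Let state_weight_sym t : (if (t < T)%N then Q else P)^T = if (t < T)%N then Q else P.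
Proof. by case: ifP => _; exact: psd_sym. Qed.

Let state_weight_psd t : psd (if (t < T)%N then Q else P).
Proof. by case: ifP. Qed.

Let state_weight_norm t : mxnorm2 (if (t < T)%N then Q else P) <= lH.
Proof.
have h1 := LH_ge_L L alpha; have h2 := LH_ge_LP L alpha; have hL := L1.
by case: ifP => _; [have := nQ|have := nP]; lra.
Qed.

Let input_norm : mxnorm2 R <= lH.
Proof. by have h1 := LH_ge_L L alpha; have := nR; have := L1; lra. Qed.

Lemma kkt_state_sym x y : sdot T (kkt_state x) y = sdot T x (kkt_state y).
Proof. by apply: eq_bigr => t _; rewrite dotM state_weight_sym. Qed.

Lemma kkt_input_sym u u' : sdot T (kkt_input u) u' = sdot T u (kkt_input u').
Proof. by apply: eq_bigr => t _; rewrite dotM (psd_sym psdR0). Qed.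

Lemma kkt_sym v w : kkt_dot (kkt v) w = kkt_dot v (kkt w).
Proof.
rewrite /kkt_dot /= !sdotDl !sdotDr !sdotNl !sdotNr.
rewrite kkt_state_sym kkt_input_sym kkt_adj (sdotC _ v.2 (kkt_prev _ _)) kkt_adj.
rewrite (sdotC _ (kkt_next A^T v.2)) (sdotC _ (kkt_next B^T v.2)).
ring.
Qed.

(** Origin of [LH]: after Young's inequality x_t with t < T collects L from Q, 1 from the coupling
    with its multiplier and L from the dynamics, while x_T collects LP + 1; multipliers collect at
    most 1 + 2 L and inputs at most 2 L. *)
Lemma kkt_upper v : `|kkt_dot (kkt v) v| <= lH * kkt_dot v v.
Proof.
case: v => -[x u] l; rewrite /kkt_dot /= !sdotDl !sdotNl.
rewrite (sdotC _ (kkt_next A^T l)) (sdotC _ (kkt_next B^T l)) (sdotC _ l x).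
have := kkt_adj x u l; set p1 := sdot T x _; set p2 := sdot T u _ => ep.
have cross k (a b : 'cV[F]_k) : `|dot a b| <= (dot a a + dot b b) / 2.
  have h1 := dot_ge0 (a - b); have h2 := dot_ge0 (a + b).
  rewrite !dotDl !dotDr !dotNl !dotNr (dotC b a) in h1 h2.
  by rewrite ler_norml; apply/andP; split; lra.
have crossM k j (M : 'M[F]_(k, j)) a b : mxnorm2 M <= L ->
    `|dot (M *m a) b| <= L * (dot a a + dot b b) / 2.
  move=> hM; rewrite dotC; apply: (le_trans (dot_mxnorm2 b a hM)).
  rewrite -!sqr_norm2; have := ler_wpM2l (ltW L0) (sqr_ge0 (norm2 b - norm2 a)).
  by lra.
have hx : `|sdot T (kkt_state x) x| <=
    L * \sum_(t < T) dot (x t) (x t) + LP L alpha * dot (x T) (x T).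
  rewrite /sdot big_ord_recr /=; apply: (le_trans (ler_normD _ _)); apply: lerD.
    apply: (le_trans (ler_norm_sum _ _ _)); rewrite mulr_sumr.
    apply: ler_sum => t _; rewrite /kkt_state ltn_ord.
    by apply: le_trans (crossM _ _ _ _ _ nQ) _; lra.
  rewrite /kkt_state ltnn dotC; apply: (le_trans (dot_mxnorm2 _ _ nP)).
  by rewrite -mulrA -expr2 sqr_norm2.
have hu : `|sdot T (kkt_input u) u| <= L * sdot T u u.
  apply: (le_trans (ler_norm_sum _ _ _)); rewrite mulr_sumr.
  by apply: ler_sum => t _; apply: le_trans (crossM _ _ _ _ _ nR) _; lra.
have hxl : `|sdot T x l| <= (sdot T x x + sdot T l l) / 2.
  apply: (le_trans (ler_norm_sum _ _ _)); rewrite -big_split /= mulr_suml.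
  by apply: ler_sum => t _; exact: cross.
have hp : `|sdot T (kkt_prev x u) l| <= L * (\sum_(t < T) dot (x t) (x t)
    + \sum_(t < T) dot (u t) (u t)) / 2 + L * \sum_(t < T) dot (l t.+1) (l t.+1).
  rewrite /sdot big_ord_recl /= dot0l add0r.
  apply: (le_trans (ler_norm_sum _ _ _)).
  rewrite mulrAC -!mulrA -big_split /= !mulr_sumr -big_split /=.
  apply: ler_sum => t _; rewrite dotDl.
  apply: (le_trans (ler_normD _ _)).
  have h1 := crossM _ _ _ (x t) (l t.+1) nA.
  have h2 := crossM _ _ _ (u t) (l t.+1) nB.
  rewrite add0n /bump /= ?add1n; lra.
have ex : sdot T x x = \sum_(t < T) dot (x t) (x t) + dot (x T) (x T).
  by rewrite /sdot big_ord_recr.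
have eu : sdot T u u = \sum_(t < T) dot (u t) (u t) + dot (u T) (u T).
  by rewrite /sdot big_ord_recr.
have el : sdot T l l = dot (l 0%N) (l 0%N) + \sum_(t < T) dot (l t.+1) (l t.+1).
  by rewrite /sdot big_ord_recl.
have h1 := LH_ge_L L alpha; have h2 := LH_ge_LP L alpha; have hL := L1.
rewrite ep in hp; rewrite {}ex {}eu {}el in hx hu hxl *.
have xs0 : 0 <= \sum_(t < T) dot (x t) (x t) by apply: sumr_ge0 => t _; exact: dot_ge0.
have us0 : 0 <= \sum_(t < T) dot (u t) (u t) by apply: sumr_ge0 => t _; exact: dot_ge0.
have ls0 : 0 <= \sum_(t < T) dot (l t.+1) (l t.+1).
  by apply: sumr_ge0 => t _; exact: dot_ge0.
have xT0 := dot_ge0 (x T); have uT0 := dot_ge0 (u T); have l00 := dot_ge0 (l 0%N).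
move: hx hu hxl hp xs0 us0 ls0 xT0 uT0 l00; rewrite -/p1 -/p2.
move: (LH L alpha) h1 h2 => lh h1 h2.
move: (LP L alpha) h2 => lp h2.
set xs := \sum_(t < T) dot (x t) _; set us := \sum_(t < T) dot (u t) _.
set ls := \sum_(t < T) dot (l t.+1) _.
set xT := dot (x T) _; set uT := dot (u T) _; set l00 := dot (l 0%N) _.
move=> hx hu hxl hp xs0 us0 ls0 xT0 uT0 l000.
have k1 := ler_wpM2r xs0 h1; have k2 := ler_wpM2r us0 h1; have k3 := ler_wpM2r ls0 h1.
have k4 := ler_wpM2r xT0 h2; have k5 := ler_wpM2r uT0 h1; have k6 := ler_wpM2r l000 h1.
have j1 := mulr_ge0 (ltW L0) us0; have j2 := mulr_ge0 (ltW L0) uT0.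
have j3 := mulr_ge0 (ltW L0) l000; have j4 := mulr_ge0 (ltW L0) xs0.
move: hx hu hxl hp; rewrite !ler_norml => /andP[a1 a2] /andP[b1 b2] /andP[c1 c2] /andP[d1 d2].
by apply/andP; split; lra.
Qed.

(** Run the stabilizing feedback with r as disturbance. The state has gain L / (1 - alpha) and the
    input at most L times more; the sum of squares is absorbed in (1 + L)^2. *)
Lemma kkt_right_inverse (r : nat -> 'cV[F]_n) : exists x u,
  x - kkt_prev x u = r /\
  sdot T x x + sdot T u u <= (gammaF L alpha)^-1 * sdot T r r.
Proof.
have [K [nK sK]] := stabAB; set Phi := A - B *m K in sK.
pose x := fix x t := if t is s.+1 then Phi *m x s + r s.+1 else r 0%N.
exists x, (fun t => - (K *m x t)); split.
  apply/funext => -[|t]; rewrite !fctE /= ?subr0//.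
  rewrite mulmxN {1}/Phi mulmxBl [B *m (K *m _)]mulmxA.
  by rewrite addrAC subrr add0r.
have h1 : sdot T x x <= (L / (1 - alpha)) ^+ 2 * sdot T r r.
  by apply: (stable_response (ltW L0) (ltW alpha0) alpha1 sK).
have h2 : sdot T (fun t => - (K *m x t)) (fun t => - (K *m x t)) <= L ^+ 2 * sdot T x x.
  apply: sdot_le => [|t _]; first exact: ltW.
  by rewrite norm2N norm2_mulmx_le.
have -> : (gammaF L alpha)^-1 = (1 + L) ^+ 2 * (L / (1 - alpha)) ^+ 2.
  by rewrite gammaF_inv -exprMn; congr (_ ^+ 2); ring.
rewrite -[leRHS]mulrA.
have h3 : (1 + L ^+ 2) * sdot T x x <= (1 + L) ^+ 2 * ((L / (1 - alpha)) ^+ 2 * sdot T r r).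
  apply: ler_pM => //; first by rewrite addr_ge0 ?sqr_ge0.
    exact: sdot_ge0.
  by have := L0; nra.
lra.
Qed.

(** Output injection rewrites the dynamics as a stable system driven by C x and u, with C^2 = Q, so
    the state energy is controlled by the cost. Only times before T drive the system; the terminal
    term is dropped by its sign. *)
Lemma reduced_hessian x u : x - kkt_prev x u = 0 ->
  gammaG L alpha gamma * (sdot T x x + sdot T u u)
  <= sdot T x (kkt_state x) + sdot T u (kkt_input u).
Proof.
move=> hx; have ex : x = kkt_prev x u by exact: subr0_eq.
have [K [nK sK]] := detAQ; set C := psd_sqrt Q in sK.
have [psdC eC] := psd_sqrtP psdQ; rewrite -/C in psdC eC.
have sC := psd_sym psdC; rewrite sC in sK.
have {sK} := stable_tr sK; rewrite linearB /= trmx_mul trmxK sC => sK.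
set Phi := A - _ in sK.
pose w t := if t is s.+1 then K^T *m (C *m x s) + B *m u s else 0.
have h1 : sdot T x x <= (L / (1 - alpha)) ^+ 2 * sdot T w w.
  apply: (stable_response (ltW L0) (ltW alpha0) alpha1 sK); first by rewrite ex.
  move=> t _; rewrite [in LHS]ex /= /Phi mulmxBl addrA mulmxA.
  by rewrite subrK.
have hQ t : dot (C *m x t) (C *m x t) = dot (x t) (Q *m x t).
  by rewrite dotM sC mulmxA eC.
have h2 : sdot T w w <= 2 * L ^+ 2 *
    (sdot T x (kkt_state x) + sdot T u u).
  apply: (@le_trans _ _ (2 * L ^+ 2 * (\sum_(t < T) dot (x t) (Q *m x t)
      + \sum_(t < T) dot (u t) (u t)))).
    rewrite /sdot big_ord_recl /= dot0l add0r -big_split mulr_sumr /=.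
    apply: ler_sum => t _; rewrite -hQ /bump /= ?add0n ?add1n /=.
    set a := K^T *m _; set b := B *m _.
    have ha : dot a a <= L ^+ 2 * dot (C *m x t) (C *m x t).
      by apply: norm2_le_sqr; [exact: ltW|apply: norm2_mulmx_le; rewrite mxnorm2_tr].
    have hb : dot b b <= L ^+ 2 * dot (u t) (u t).
      by apply: norm2_le_sqr; [exact: ltW|exact: norm2_mulmx_le].
    have := dot_ge0 (a - b); rewrite !dotDl !dotDr !dotNl !dotNr (dotC b a); lra.
  rewrite ler_wpM2l//; first by rewrite mulr_ge0 ?sqr_ge0.
  rewrite /sdot !big_ord_recr /= -!addrA lerD//.
    by apply: ler_sum => t _; rewrite /kkt_state ltn_ord.
  rewrite /kkt_state ltnn addrCA lerDl addr_ge0 ?dot_ge0//.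
  exact: psd_ge0.
have hu : gamma * sdot T u u <= sdot T u (kkt_input u).
  by rewrite /sdot mulr_sumr; apply: ler_sum => t _; exact: psd_subge.
have hs0 : 0 <= sdot T x (kkt_state x).
  by apply: sumr_ge0 => t _; apply: psd_ge0.
have hu0 := sdot_ge0 T u.
have g0 := gammaG_gt0 L1 alpha1 gamma0.
rewrite mulrC -ler_pdivlMr// gammaG_inv//.
set a := sdot T x (kkt_state x) in h2 hs0 *; set b := sdot T u (kkt_input u) in hu *.
set U := sdot T u u in h2 hu hu0 *.
have aU : a + U <= (a + b) / gamma.
  rewrite ler_pdivlMr//; have : a * gamma <= a by rewrite ler_piMr// ltW.
  lra.
have i0 : 0 < 1 - alpha by have := alpha1; lra.
set q := 2 * L ^+ 2 / (1 - alpha) ^+ 2 * L ^+ 2 * (1 + L) ^+ 2.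
have q0 : 0 <= q.
  have -> : q = 2 * (L ^+ 2 * (1 + L) / (1 - alpha)) ^+ 2.
    by rewrite /q; field; rewrite gt_eqF.
  by rewrite mulr_ge0// sqr_ge0.
have h3 : sdot T x x <= 2 * L ^+ 2 / (1 - alpha) ^+ 2 * L ^+ 2 * (a + U).
  apply: (le_trans h1); apply: (le_trans (ler_wpM2l (sqr_ge0 _) h2)).
  by rewrite le_eqVlt; apply/orP; left; apply/eqP; field; rewrite gt_eqF.
apply: (@le_trans _ _ (q * (a + U))); last first.
  by apply: (le_trans (ler_wpM2l q0 aU)); rewrite le_eqVlt; apply/orP; left; apply/eqP; ring.
have p0 : 1 <= 2 * L ^+ 2 / (1 - alpha) ^+ 2 * L ^+ 2.
  rewrite mulrAC ler_pdivlMr ?exprn_gt0// mul1r.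
  have : (1 - alpha) ^+ 2 <= 1.
    by have := alpha0; have := i0; nra.
  have l2 : 1 <= L ^+ 2 by rewrite exprn_ege1// ltW.
  by have := mulr_ege1 l2 l2; lra.
(* [q] is [p] times (1 + L)^2: one copy of [p] bounds the state energy, and the surplus (1 + L)^2 -
   1 >= 1 bounds the input energy. *)
have m1 : 1 <= (1 + L) ^+ 2 - 1 by have := L1; nra.
have aU0 : 0 <= a + U by rewrite addr_ge0.
rewrite /q; set p := 2 * L ^+ 2 / (1 - alpha) ^+ 2 * L ^+ 2 in h3 p0 *.
have := ler_wpM2r aU0 (mulr_ege1 p0 m1); lra.
Qed.

(** A null space argument: a right inverse corrects the residual of the dynamics, the remainder (w,
    wu) is homogeneous and is bounded by [reduced_hessian], and the multiplier is recovered by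
    pairing it with a second right inverse. *)
Lemma kkt_lower v :
  gammaH L alpha gamma ^+ 2 * kkt_dot v v <= kkt_dot (kkt v) (kkt v).
Proof.
have gH0 := gammaH_gt0 L1 alpha0 alpha1 gamma0 gamma1.
have hC := gammaH_inv_ge L1 alpha0 alpha1 gamma0 gamma1.
have f4 := gammaF_inv_ge L1 alpha0 alpha1.
have g1 := gammaG_inv_ge L1 alpha0 alpha1 gamma0 gamma1.
have gG0 := gammaG_gt0 L1 alpha1 gamma0.
have l3 := LH_ge3 alpha L1.
case: v => -[x u] l; rewrite -ler_pdivlMl ?exprn_gt0//.
rewrite /kkt_dot /=; set hx := _ - kkt_next A^T l; set hu := _ - kkt_next B^T l.
set hl := x - kkt_prev x u.
have [x' [u' [ex' nx']]] := kkt_right_inverse hl.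
have [y [yu [ey ny]]] := kkt_right_inverse l.
set fi := (gammaF L alpha)^-1 in f4 hC nx' ny; clearbody fi.
pose w := x - x'; pose wu := u - u'.
have ew : w - kkt_prev w wu = 0.
  rewrite /w /wu -(scaleN1r x') -(scaleN1r u') kkt_prevD kkt_prevZ !scaleN1r.
  by rewrite opprD addrACA -opprD ex' subrr.
have hess := reduced_hessian ew.
have eGx : kkt_state x = hx - l + kkt_next A^T l.
  by rewrite /hx addrAC subrK addrK.
have eRu : kkt_input u = hu + kkt_next B^T l by rewrite /hu subrK.
(* Homogeneous trajectories annihilate the multiplier terms, so the Hessian on (w, wu) is expressed
   through the residuals and the particular solution alone. *)
have wl0 : sdot T w l - sdot T w (kkt_next A^T l) - sdot T wu (kkt_next B^T l) = 0.
  have := kkt_adj w wu l; rewrite -(subr0_eq ew) => ->; ring.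
have hessE : sdot T w (kkt_state w) + sdot T wu (kkt_input wu) =
    sdot T w hx + sdot T wu hu - sdot T w (kkt_state x') - sdot T wu (kkt_input u').
  rewrite {2}/w {2}/wu -(scaleN1r x') -(scaleN1r u') kkt_stateD kkt_inputD.
  rewrite kkt_stateZ kkt_inputZ !scaleN1r eGx eRu !sdotDr !sdotNr.
  have := wl0; lra.
have nG x0 : sdot T (kkt_state x0) (kkt_state x0) <= lH ^+ 2 * sdot T x0 x0.
  apply: sdot_le => [|t _]; first lra.
  exact/norm2_mulmx_le/state_weight_norm.
have nR' u0 : sdot T (kkt_input u0) (kkt_input u0) <= lH ^+ 2 * sdot T u0 u0.
  apply: sdot_le => [|t _]; first lra.
  exact/norm2_mulmx_le/input_norm.
pose g := (gammaG L alpha gamma)^-1.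
(* With weight gammaG / 2 the four Young inequalities consume exactly one of the two copies of
   gammaG W in the doubled estimate. *)
have g0 : 0 < gammaG L alpha gamma / 2 by rewrite divr_gt0.
have gi : (gammaG L alpha gamma / 2)^-1 = 2 * g by rewrite invf_div mulrC /g mulrC.
have y1 := sdot_young T w hx g0; have y2 := sdot_young T wu hu g0.
have y3 := sdot_young T w (- kkt_state x') g0.
have y4 := sdot_young T wu (- kkt_input u') g0.
rewrite !gi !sdotNl !sdotNr ?opprK in y1 y2 y3 y4.
have n3 := nG x'; have n4 := nR' u'.
set W := sdot T w w + sdot T wu wu.
set a := sdot T hx hx + sdot T hu hu; set b := sdot T hl hl in nx' *.
set Zh := sdot T x' x' + sdot T u' u' in nx'.
have gp : 0 < g by rewrite invr_gt0.
have W1 : gammaG L alpha gamma * W <= 2 * g * (a + lH ^+ 2 * Zh).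
  have := ler_wpM2l (ltW gp) n3; have := ler_wpM2l (ltW gp) n4.
  rewrite hessE in hess.
  move: hess; rewrite /W /a /Zh; lra.
have W2 : W <= 2 * g ^+ 2 * (a + lH ^+ 2 * Zh).
  have := ler_wpM2l (ltW gp) W1; rewrite mulrA mulVf ?mul1r ?gt_eqF//.
  by move=> /le_trans; apply; rewrite le_eqVlt; apply/orP; left; apply/eqP; ring.
have z1 := sdot_sqD T w x'; have z2 := sdot_sqD T wu u'.
rewrite /w /wu !subrK -/w -/wu in z1 z2.
set Z := sdot T x x + sdot T u u.
have Z1 : Z <= 2 * W + 2 * Zh by rewrite /Z /W /Zh; lra.
set sl := sdot T l l in ny *.
have fi0 : 0 < fi by lra.
pose dx : nat -> 'cV[F]_n := hx - kkt_state x.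
pose du : nat -> 'cV[F]_m := hu - kkt_input u.
(* |l|^2 is the pairing of l with the dynamics of (y, yu); by adjointness it becomes a pairing of
   (y, yu) with the stationarity rows, from which l is eliminated. *)
have slE : sl = sdot T y dx + sdot T yu du.
  rewrite /sl -{2}ey sdotDr sdotNr (sdotC _ l) (sdotC _ l) kkt_adj.
  by rewrite /dx /du eGx eRu !sdotDr !sdotNr !sdotDr !sdotNr; ring.
have fiv : 0 < fi^-1 by rewrite invr_gt0.
have s1 := sdot_young T y dx fiv.
have s2 := sdot_young T yu du fiv.
rewrite invrK in s1 s2.
have b1 : sdot T dx dx <= 2 * (sdot T hx hx + sdot T (kkt_state x) (kkt_state x)).
  exact: sdot_sqB.
have b2 : sdot T du du <= 2 * (sdot T hu hu + sdot T (kkt_input u) (kkt_input u)).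
  exact: sdot_sqB.
have S1 : sl <= 2 * fi * (a + lH ^+ 2 * Z).
  have m1 := nG x; have m2 := nR' u.
  have c1 : fi^-1 * (sdot T y y + sdot T yu yu) <= sl.
    by rewrite ler_pdivrMl.
  have c2 := ler_wpM2l (ltW fi0) b1; have c3 := ler_wpM2l (ltW fi0) b2.
  have c4 := ler_wpM2l (ltW fi0) m1; have c5 := ler_wpM2l (ltW fi0) m2.
  rewrite /a /Z; lra.
have a0 : 0 <= a by rewrite addr_ge0 ?sdot_ge0.
have b0 : 0 <= b by rewrite sdot_ge0.
have Zh0 : 0 <= Zh by rewrite addr_ge0 ?sdot_ge0.
rewrite -/Z -/sl -/a -/b.
move: W1 W2 Z1 S1 nx' a0 b0 Zh0 hC g1 l3; rewrite -/g.
move: (LH L alpha) => h; move: (gammaH L alpha gamma) gH0 => gH gH0.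
clear -f4 fi0 gH0; move: W Z sl a b Zh g => W Z sl a b Zh g.
move=> W1 W2 Z1 S1 Zh1 a0 b0 Zh0 hC g1 h3.
exact: kkt_lower_constants Z1 S1 Zh1 a0 b0 Zh0 hC g1 h3 W2.
Qed.

End Bounds.
End KKT.

Lemma sdot_component (F : realType) T k (x : nat -> 'cV[F]_k) t :
  (t <= T)%N -> dot (x t) (x t) <= sdot T x x.
Proof.
move=> tT; rewrite /sdot (bigD1 (Ordinal (tT : (t < T.+1)%N)))//= lerDl.
by apply: sumr_ge0 => i _; exact: dot_ge0.
Qed.

(** Abstract notion of spreading by one step per application. The trivial filtration isolates decay
    in time; supports in balls of the graph give decay in space. *)
Definition filtration (F : realType) k (S : nat -> 'cV[F]_k -> Prop) :=
  [/\ forall j, S j 0, forall j x y, S j x -> S j y -> S j (x + y),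
      forall j a x, S j x -> S j (a *: x) & forall j x, S j x -> S j.+1 x].

Definition bandwidth1 (F : realType) k l (S : nat -> 'cV[F]_k -> Prop)
    (S' : nat -> 'cV[F]_l -> Prop) (M : 'M[F]_(l, k)) :=
  forall j x, S j x -> S' j.+1 (M *m x).

(** * Decay of the closed loop and of the optimal gain *)

Section KKTDecay.
Variables (F : realType) (n m : nat).
Variables (A : 'M[F]_n) (B : 'M[F]_(n, m)) (Q : 'M[F]_n) (R : 'M[F]_m).
Variables (P : 'M[F]_n).
Variables (L alpha gamma : F).
Hypotheses (L1 : 1 < L) (alpha0 : 0 < alpha) (alpha1 : alpha < 1).
Hypotheses (gamma0 : 0 < gamma) (gamma1 : gamma < 1).
Hypotheses (nA : mxnorm2 A <= L) (nB : mxnorm2 B <= L).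
Hypotheses (nQ : mxnorm2 Q <= L) (nR : mxnorm2 R <= L).
Hypotheses (psdQ : psd Q) (psdR : psd (R - gamma%:M)).
Hypotheses (psdP : psd P) (nP : mxnorm2 P <= LP L alpha).
Hypotheses (stabAB : stabilizable L alpha A B).
Hypotheses (detAQ : detectable L alpha A (psd_sqrt Q)).
Hypotheses (ricP : ric_map A B Q R P = P).

Local Notation V := ((nat -> 'cV[F]_n) * (nat -> 'cV[F]_m) * (nat -> 'cV[F]_n))%type.
Local Notation K := (ric_gain A B R P).
Local Notation Phi := (A - B *m ric_gain A B R P).
Local Notation rh := (rho L alpha gamma).
Local Notation gH := (gammaH L alpha gamma).

Lemma riccati_costate : Q + A^T *m P *m Phi = P.
Proof.
have e := ric_gain_eq A B gamma0 psdR psdP.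
rewrite -{3}ricP /ric_map mulmxBr addrC; congr (_ - _ + _).
by rewrite /ric_gain !mulmxA.
Qed.

Lemma riccati_input : R *m K = B^T *m P *m Phi.
Proof.
have e := ric_gain_eq A B gamma0 psdR psdP.
apply: (addIr (B^T *m P *m B *m K)); rewrite -mulmxDl -/(ric_weight B R P) e.
by rewrite mulmxBr [_ *m (B *m K)]mulmxA subrK.
Qed.

Section Horizon.
Variable (T : nat).
Local Notation kktT := (kkt A B Q R P T).

(** The dummy input at time T is set to 0 so that its row [R *m u T] leaves no residual. *)
Definition kkt_solution (x0 : 'cV[F]_n) : V :=
  (fun t => Phi ^+ t *m x0, fun t => if (t < T)%N then - (K *m (Phi ^+ t *m x0)) else 0,
   fun t => - (P *m (Phi ^+ t *m x0))).

Lemma kkt_solutionE x0 t : (t <= T)%N ->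
  [/\ (kktT (kkt_solution x0)).1.1 t = 0, (kktT (kkt_solution x0)).1.2 t = 0 &
      (kktT (kkt_solution x0)).2 t = if t == 0%N then x0 else 0].
Proof.
move=> tT; have eS s : Phi ^+ s.+1 *m x0 = Phi *m (Phi ^+ s *m x0).
  by rewrite mulmxA exprS.
rewrite /kkt /= !fctE /= /kkt_state /kkt_input /kkt_next; split.
- case: ltnP => hT; last by rewrite subr0 subrr.
  rewrite eS !mulmxN opprK; set y := _ *m x0.
  have -> : P *m y = Q *m y + A^T *m (P *m (Phi *m y)).
    by rewrite -{1}riccati_costate mulmxDl !mulmxA.
  by rewrite addrAC subrr.
- case: ltnP => hT; last by rewrite mulmx0 subr0.
  rewrite eS !mulmxN opprK; set y := _ *m x0.
  have -> : R *m (K *m y) = B^T *m (P *m (Phi *m y)).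
    by rewrite [R *m (_ *m y)]mulmxA riccati_input -!mulmxA.
  by rewrite addNr.
- case: t tT => [|t] tT; first by rewrite /= subr0 mul1mx.
  by rewrite /= tT eS mulmxN mulmxBl !mulmxA subrr.
Qed.

Lemma kkt_solution_dot x0 :
  kkt_dot T (kktT (kkt_solution x0)) (kktT (kkt_solution x0)) = dot x0 x0.
Proof.
have z k (x : nat -> 'cV[F]_k) : (forall t, (t <= T)%N -> x t = 0) -> sdot T x x = 0.
  by move=> h; rewrite /sdot big1// => t _; rewrite h ?dot0l// -ltnS.
rewrite /kkt_dot z => [|t tT]; last by case: (kkt_solutionE x0 tT).
rewrite z => [|t tT]; last by case: (kkt_solutionE x0 tT).
rewrite !add0r /sdot big_ord_recl big1 ?addr0 => [|t _].
  by case: (kkt_solutionE x0 (leq0n T)) => _ _ ->.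
have tT : (lift ord0 t <= T)%N by rewrite -ltnS.
by case: (kkt_solutionE x0 tT) => _ _ ->; rewrite dot0l.
Qed.

Variables (Sx : nat -> 'cV[F]_n -> Prop) (Su : nat -> 'cV[F]_m -> Prop).
Hypotheses (fSx : filtration Sx) (fSu : filtration Su).
Hypotheses (SA : bandwidth1 Sx Sx A) (SAt : bandwidth1 Sx Sx A^T).
Hypotheses (SB : bandwidth1 Su Sx B) (SBt : bandwidth1 Sx Su B^T).
Hypotheses (SQ : bandwidth1 Sx Sx Q) (SR : bandwidth1 Su Su R).

(** Space and time share one index: a source at time 0 has, after j applications of [kkt], spread j
    levels in space and j steps in time. *)
Definition kkt_support j (v : V) := forall t, (t <= T)%N ->
  [/\ Sx j (v.1.1 t), Su j (v.1.2 t), Sx j (v.2 t) &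
      (j < t)%N -> [/\ v.1.1 t = 0, v.1.2 t = 0 & v.2 t = 0]].

(** For j < T the state at time T still vanishes, so the terminal weight P, which respects no
    filtration in space, is only applied to 0. *)
Lemma kkt_support_kkt j v : (j < T)%N -> kkt_support j v -> kkt_support j.+1 (kktT v).
Proof.
have [Sx0 SxD SxZ SxS] := fSx; have [Su0 SuD SuZ SuS] := fSu.
have SxN i x : Sx i x -> Sx i (- x) by rewrite -scaleN1r; exact: SxZ.
have SuN i x : Su i x -> Su i (- x) by rewrite -scaleN1r; exact: SuZ.
move=> jT hv t tT; have [hx hu hl h0] := hv t tT.
rewrite /kkt /= !fctE /= /kkt_state /kkt_input /kkt_next; split.
- apply: (SxD); first apply: (SxD); last apply: (SxN).
  + have [tT'|Tt] := ltnP t T; first exact: SQ.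
    by case: h0 => [|-> _ _]; [exact: leq_trans jT Tt|rewrite mulmx0].
  + exact: SxS.
  + have [tT'|//] := ltnP t T; apply: SAt; by case: (hv t.+1 tT').
- apply: (SuD); first exact: SR.
  apply: (SuN); have [tT'|//] := ltnP t T; apply: SBt; by case: (hv t.+1 tT').
- apply: (SxD); first exact: SxS.
  apply: (SxN); case: t tT {hx hu hl h0} => [//|t] tT /=.
  by have [hx hu _ _] := hv t (ltnW tT); apply: (SxD); [exact: SA|exact: SB].
- move=> jt; case: h0 => [|-> -> ->]; first exact: ltnW.
  rewrite !mulmx0; split.
  + have [tT'|Tt] := ltnP t T; last by rewrite addr0 subrr.
    case: (hv t.+1 tT') => _ _ _ [|_ _ ->]; first by rewrite ltnS ltnW// ltnW.
    by rewrite mulmx0 addr0 subrr.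
  + have [tT'|Tt] := ltnP t T; last by rewrite subrr.
    case: (hv t.+1 tT') => _ _ _ [|_ _ ->]; first by rewrite ltnS ltnW// ltnW.
    by rewrite mulmx0 subrr.
  + case: t tT jt {hx hu hl} => [//|t] tT jt /=.
    case: (hv t (ltnW tT)) => _ _ _ [|-> -> _]; first by rewrite -ltnS.
    by rewrite !mulmx0 addr0 subrr.
Qed.

Lemma kkt_solution_decay x0 k : Sx 0 x0 -> (k.*2 <= T)%N ->
  exists v', [/\ kkt_support k.*2.-1 v', k = 0%N -> v' = 0 &
    kkt_dot T (kkt_solution x0 - v') (kkt_solution x0 - v')
      <= (gH^-1 * rh ^+ k.*2) ^+ 2 * dot x0 x0].
Proof.
move=> hx0 kT; have [Sx0 SxD SxZ SxS] := fSx; have [Su0 SuD SuZ SuS] := fSu.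
have gH0 := gammaH_gt0 L1 alpha0 alpha1 gamma0 gamma1.
have gHL := gammaH_lt_LH L1 alpha0 alpha1 gamma0 gamma1.
have [|j v h|j v w hv hw|j a v hv|j v||v' [h1 h2 h3]] := inverse_decay (kkt_dotD T)
    (kkt_dotZ T) (kkt_dotC T) (@kktD _ _ _ A B Q R P T)
    (@kktZ _ _ _ A B Q R P T)
    (@kkt_sym _ _ _ A B Q R P T _ gamma0 psdQ psdR psdP) gH0 gHL
    (@kkt_upper _ _ _ A B Q R P T _ _ L1 nA nB nQ nR nP)
    (@kkt_lower _ _ _ A B Q R P T _ _ _ L1 alpha0 alpha1 gamma0 gamma1
       nB nQ nR psdQ psdR psdP nP stabAB detAQ)
    (Z := kkt_support) (T := T) _ _ _ _ _ (v := kkt_solution x0) kT.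
- by move=> j t tT; split.
- move=> t tT; have [hx hu hl h0] := h t tT; split; [exact: SxS|exact: SuS|exact: SxS|].
  by move=> jt; apply: h0; exact: ltnW.
- move=> t tT; have [hx hu hl h0] := hv t tT; have [hx' hu' hl' h0'] := hw t tT.
  split; [exact: SxD|exact: SuD|exact: SxD|].
  move=> jt; have [e1 e2 e3] := h0 jt; have [e1' e2' e3'] := h0' jt.
  by rewrite /= !fctE e1 e2 e3 e1' e2' e3' !addr0.
- move=> t tT; have [hx hu hl h0] := hv t tT.
  split; [exact: SxZ|exact: SuZ|exact: SxZ|].
  move=> jt; have [e1 e2 e3] := h0 jt.
  by rewrite /= !fctE e1 e2 e3 !scaler0.
- exact: kkt_support_kkt.
- move=> t tT; have [-> -> ->] := kkt_solutionE x0 tT; split => //.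
    by case: ifP.
  by case: t tT.
exists v'; split => //; apply: (le_trans h3); rewrite kkt_solution_dot.
have e (r g : F) : ((r ^+ 2) ^+ 2) ^+ k * g ^- 2 = (g^-1 * r ^+ k.*2) ^+ 2.
  rewrite [RHS]exprMn exprVn mulrC -!exprM; congr (_ * _ ^+ _).
  by rewrite -muln2; ring.
by rewrite -(sqr_rho L1 alpha0 alpha1 gamma0 gamma1) mulrA e.
Qed.

End Horizon.

(** Only even exponents are produced; an odd t = 2 k + 1 loses one factor rho, recovered from the 1
    / rho in [Upsilon]. *)
Lemma decay_rate k t : (t <= k.*2.+1)%N ->
  gH^-1 * rh ^+ k.*2 <= Upsilon L alpha gamma * rh ^+ t.
Proof.
move=> tk; have r0 := rho_gt0 L1 alpha0 alpha1 gamma0 gamma1.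
have r1 := rho_lt1 L1 alpha0 alpha1 gamma0 gamma1.
have gH0 := gammaH_gt0 L1 alpha0 alpha1 gamma0 gamma1.
have hU := Upsilon_ge L1 alpha0 alpha1 gamma0 gamma1.
apply: le_trans (ler_wpM2r (exprn_ge0 t (ltW r0)) hU).
have gi0 : 0 <= gH^-1 by rewrite invr_ge0 ltW.
rewrite -mulrA ler_wpM2l//.
rewrite ler_pdivlMl// -exprS; apply: ler_wiXn2l => //; exact: ltW.
Qed.

(** Horizon t and k = t / 2: the correction v' lives at times up to 2 k - 1 < t, hence the state
    Phi^t x0 at the final time is entirely part of the small remainder. *)
Lemma closed_loop_decay t : mxnorm2 (Phi ^+ t) <= Upsilon L alpha gamma * rh ^+ t.
Proof.
have r0 := rho_gt0 L1 alpha0 alpha1 gamma0 gamma1.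
have U1 := Upsilon_ge1 L1 alpha0 alpha1 gamma0 gamma1.
have gH0 := gammaH_gt0 L1 alpha0 alpha1 gamma0 gamma1.
have tk : (t./2.*2 <= t)%N by rewrite -[leqRHS]odd_double_half leq_addl.
apply: mxnorm2_le => [|x0].
  by rewrite mulr_ge0 ?exprn_ge0 ?(ltW r0)// (le_trans ler01).
have tr k l (M : 'M[F]_(l, k)) : bandwidth1 (fun _ _ => True) (fun _ _ => True) M by [].
have ft k : filtration (fun (_ : nat) (_ : 'cV[F]_k) => True) by [].
have [v' [hv' h0 hd]] := kkt_solution_decay (ft n) (ft m) (tr _ _ A) (tr _ _ A^T)
  (tr _ _ B) (tr _ _ B^T) (tr _ _ Q) (tr _ _ R) (x0 := x0) (k := t./2) I tk.
have z : v'.1.1 t = 0.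
  have [e|k0] := eqVneq t./2 0%N; first by rewrite h0.
  have [_ _ _ h] := hv' t (leqnn t); case: h => [|-> //].
  by rewrite prednK ?double_gt0 ?lt0n.
apply: (@le_trans _ _ (gH^-1 * rh ^+ t./2.*2 * norm2 x0)).
  apply: sqr_le_norm2; first by apply: mulr_ge0; [rewrite invr_ge0 ltW|rewrite exprn_ge0// ltW].
  apply: le_trans hd; rewrite -[Phi ^+ t *m x0]subr0 -z.
  apply: (le_trans (sdot_component ((kkt_solution t x0 - v').1.1) (leqnn t))).
  by rewrite /kkt_dot -addrA lerDl addr_ge0 ?sdot_ge0.
rewrite ler_wpM2r ?norm2_ge0//; apply: decay_rate.
by rewrite -[leqLHS]odd_double_half -add1n leq_add2r leq_b1.
Qed.

Lemma gain_decay (Sx : nat -> 'cV[F]_n -> Prop) (Su : nat -> 'cV[F]_m -> Prop) x0 k :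
  filtration Sx -> filtration Su ->
  bandwidth1 Sx Sx A -> bandwidth1 Sx Sx A^T ->
  bandwidth1 Su Sx B -> bandwidth1 Sx Su B^T ->
  bandwidth1 Sx Sx Q -> bandwidth1 Su Su R -> Sx 0%N x0 ->
  exists y, [/\ Su k.*2.-1 y, k = 0%N -> y = 0 &
    norm2 (K *m x0 - y) <= gH^-1 * rh ^+ k.*2 * norm2 x0].
Proof.
move=> fSx fSu SA SAt SB SBt SQ SR hx0.
have r0 := rho_gt0 L1 alpha0 alpha1 gamma0 gamma1.
have gH0 := gammaH_gt0 L1 alpha0 alpha1 gamma0 gamma1.
(* The horizon exceeds 2 k by one so that even for k = 0 the input at time 0 is the feedback - K x0
   and not the dummy. *)
have [v' [hv' h0 hd]] := kkt_solution_decay fSx fSu SA SAt SB SBt SQ SR hx0 (leqnSn k.*2).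
exists (- v'.1.2 0%N); split.
- have [_ hu _ _] := hv' 0%N isT; have [_ _ SuZ _] := fSu.
  by rewrite -scaleN1r; apply: SuZ.
- by move=> /h0->; rewrite oppr0.
rewrite -norm2N; apply: sqr_le_norm2.
  by apply: mulr_ge0; [rewrite invr_ge0 ltW|rewrite exprn_ge0// ltW].
apply: le_trans hd; have -> : - (K *m x0 - - v'.1.2 0%N) =
    (kkt_solution k.*2.+1 x0 - v').1.2 0%N.
  by rewrite /= !fctE /= mul1mx opprD opprK.
apply: (le_trans (sdot_component _ (leq0n k.*2.+1))).
by rewrite /kkt_dot -addrA addrCA lerDl addr_ge0 ?sdot_ge0.
Qed.

End KKTDecay.

(** * Perturbation of the optimal feedback *)

Section Perturbation.
Variables (F : realType) (n : nat) (Phi : 'M[F]_n) (U r : F).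
Hypotheses (U0 : 0 < U) (r0 : 0 < r) (r1 : r < 1) (hPhi : stable U r Phi).

Let r2lt : r ^+ 2 < 1.
Proof. by rewrite exprn_ilt1// ltW. Qed.

Let W2 := U ^+ 2 / (1 - r ^+ 2).

Let W2_gt0 : 0 < W2.
Proof. by rewrite divr_gt0 ?exprn_gt0// subr_gt0. Qed.

(** W is the sum of (Phi^t)^T Phi^t, obtained as a monotone limit; the quadratic bound is a
    geometric series. *)
Lemma lyapunov_matrix : exists W : 'M[F]_n,
  [/\ psd W, W = 1%:M + Phi^T *m W *m Phi &
      forall x, dot x (W *m x) <= U ^+ 2 / (1 - r ^+ 2) * dot x x].
Proof.
pose Ws := fix Ws k : 'M[F]_n := if k is j.+1 then 1%:M + Phi^T *m Ws j *m Phi else 0.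
have psd1 : psd (1%:M : 'M[F]_n).
  by apply: psdP => [|x]; rewrite ?trmx1// mul1mx dot_ge0.
have hp k : psd (Ws k).
  by elim: k => [|k IH] /=; [exact: psd0|apply: psdD => //; exact: psd_congr].
have hq k x : dot x (Ws k *m x) = \sum_(t < k) dot (Phi ^+ t *m x) (Phi ^+ t *m x).
  elim: k x => [|k IH] x; first by rewrite mul0mx dot0r big_ord0.
  rewrite /= mulmxDl mul1mx dotDr big_ord_recl expr0 !mul1mx; congr (_ + _).
  rewrite -!mulmxA -dotM IH; apply: eq_bigr => t _.
  by rewrite lift0 exprSr mulmxA.
have hb k x : dot x (Ws k *m x) <= W2 * dot x x.
  rewrite hq; apply: (@le_trans _ _ (\sum_(t < k) U ^+ 2 * dot x x * (r ^+ 2) ^+ t)).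
    apply: ler_sum => t _; rewrite mulrAC exprAC -exprMn.
    apply: norm2_le_sqr; last exact: stable_norm2.
    by rewrite mulr_ge0 ?exprn_ge0// ltW.
  rewrite -mulr_sumr /W2 [leRHS]mulrAC ler_wpM2l//.
    by rewrite mulr_ge0 ?sqr_ge0 ?dot_ge0.
  by apply: geometric_sum_le => //; rewrite sqr_ge0.
have [|W hW] := monotone_mcvg (fun k => psd_sym (hp k)) _ hb.
  move=> k x; rewrite !hq big_ord_recr /= lerDl; exact: dot_ge0.
exists W; split.
- apply: psdP => [|x]; first exact: (mcvg_sym (fun k => psd_sym (hp k)) hW).
  by apply: (mcvg_quad_ge hW) => k; exact: psd_ge0.
- apply: (mcvg_uniq (mcvgS hW)) => /=.
  apply: mcvgD; first exact: mcvg_cst.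
  by apply: mcvgM; [apply: mcvgM => //|]; exact: mcvg_cst.
- by move=> x; apply: (mcvg_quad_le hW).
Qed.

(** Phi lowers <x, W x> by |x|^2, and the perturbation gives back at most half of it. As W <= U^2 /
    (1 - r^2), the remaining decrease |x|^2 / 2 is a fixed fraction of <x, W x>, whence [beta];
    comparison with 1 <= W gives [Omega]. *)
Lemma perturbed_stable (E : 'M[F]_n) phi eta :
  mxnorm2 Phi <= phi -> mxnorm2 E <= eta -> 1 <= U ->
  U ^+ 2 / (1 - r ^+ 2) * (eta * (2 * phi + eta)) <= 2^-1 ->
  stable (Num.sqrt (U ^+ 2 / (1 - r ^+ 2)))
    (Num.sqrt (1 - (1 - r ^+ 2) / (2 * U ^+ 2))) (Phi + E).
Proof.
move=> nPhi nE U1 hsmall; have [W [hW eW bW]] := lyapunov_matrix.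
rewrite -/W2 in hsmall bW *.
have nW : mxnorm2 W <= W2 by apply: psd_norm_le.
have phi0 : 0 <= phi := le_trans (mxnorm2_ge0 _) nPhi.
have eta0 : 0 <= eta := le_trans (mxnorm2_ge0 _) nE.
set b2 := 1 - _.
have eb2 : b2 = 1 - (2 * W2)^-1.
  rewrite /b2 /W2; congr (_ - _); field.
  by rewrite !gt_eqF// subr_gt0.
have W1 : 1 <= W2.
  have u1 : 1 <= U ^+ 2 by rewrite exprn_ege1.
  rewrite ler_pdivlMr ?subr_gt0// mul1r (le_trans _ u1)// gerBl; exact: sqr_ge0.
have b20 : 0 <= b2.
  have p2 : 0 < 2 * W2 by rewrite mulr_gt0.
  rewrite eb2 subr_ge0 invf_le1//; apply: (le_trans W1).
  by rewrite ler_peMl ?ler1n// ltW.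
clearbody W2 b2.
have step x : dot ((Phi + E) *m x) (W *m ((Phi + E) *m x)) <= b2 * dot x (W *m x).
  have sW := psd_sym hW.
  have e1 : dot (Phi *m x) (W *m (Phi *m x)) = dot x (W *m x) - dot x x.
    rewrite [in RHS]eW mulmxDl mul1mx dotDr -!mulmxA -[in RHS]dotM.
    by rewrite addrAC subrr add0r.
  have h1 : dot (Phi *m x) (W *m (E *m x)) <= W2 * (phi * eta) * dot x x.
    have /ler_normlW := dot_mxnorm2 (Phi *m x) (E *m x) nW.
    move=> /le_trans; apply; rewrite -sqr_norm2 -!mulrA ler_wpM2l ?(ltW W2_gt0)//.
    have k1 := norm2_mulmx_le x nPhi; have k2 := norm2_mulmx_le x nE.
    have := ler_pM (norm2_ge0 _) (norm2_ge0 _) k1 k2; lra.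
  have h2 : dot (E *m x) (W *m (E *m x)) <= W2 * eta ^+ 2 * dot x x.
    apply: (le_trans (bW _)); rewrite -mulrA ler_wpM2l ?(ltW W2_gt0)//.
    by apply: norm2_le_sqr => //; exact: norm2_mulmx_le.
  rewrite !mulmxDl mulmxDr !dotDl !dotDr (dot_symmx (E *m x) (Phi *m x) sW) e1.
  have h3 := ler_wpM2r (dot_ge0 x) hsmall.
  have h4 : (2 * W2)^-1 * dot x (W *m x) <= 2^-1 * dot x x.
    rewrite invfM -mulrA ler_wpM2l// ler_pdivrMl//.
  rewrite eb2; lra.
have iter_step t x : dot ((Phi + E) ^+ t *m x) (W *m ((Phi + E) ^+ t *m x))
    <= b2 ^+ t * dot x (W *m x).
  elim: t => [|t IH]; first by rewrite !expr0 !mul1mx mul1r.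
  have -> : (Phi + E) ^+ t.+1 *m x = (Phi + E) *m ((Phi + E) ^+ t *m x).
    by rewrite mulmxA exprS.
  apply: (le_trans (step _)); rewrite exprS -mulrA ler_wpM2l//.
have lW x : dot x x <= dot x (W *m x).
  rewrite [in leRHS]eW mulmxDl mul1mx dotDr lerDl.
  by rewrite psd_ge0//; exact: psd_congr.
move=> t; apply: mxnorm2_le => [|x]; first by rewrite mulr_ge0 ?exprn_ge0 ?sqrtr_ge0.
apply: sqr_le_norm2; first by rewrite mulr_ge0 ?exprn_ge0 ?sqrtr_ge0.
apply: (le_trans (lW _)); apply: (le_trans (iter_step t x)).
rewrite exprMn exprAC !sqr_sqrtr ?(ltW W2_gt0)//.
rewrite mulrAC mulrC; apply: ler_wpM2r; first exact: exprn_ge0.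
exact: bW.
Qed.

End Perturbation.

(** * Infinite-horizon costs of linear feedbacks *)

Section Series.
Variables (F : realType) (f : nat -> F).
Hypothesis (f0 : forall t, 0 <= f t).

Lemma nneseries_partial T :
  ((\sum_(t < T) f t)%:E <= \sum_(0 <= t <oo) (f t)%:E)%E.
Proof.
rewrite -(big_mkord xpredT) -sumEFin.
by apply: nneseries_lim_ge => t _ _; rewrite lee_fin.
Qed.

Lemma nneseries_bounded c : (forall T, \sum_(t < T) f t <= c) ->
  (\sum_(0 <= t <oo) (f t)%:E)%E \is a fin_num /\ (\sum_(0 <= t <oo) (f t)%:E <= c%:E)%E.
Proof.
move=> h; have h1 : (\sum_(0 <= t <oo) (f t)%:E <= c%:E)%E.
  apply: lime_le; first by apply: is_cvg_nneseries => t _ _; rewrite lee_fin.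
  by apply: nearW => T; rewrite sumEFin lee_fin big_mkord.
split => //; rewrite ge0_fin_numE; first exact: le_lt_trans h1 (ltry _).
by apply: nneseries_ge0 => t _ _; rewrite lee_fin.
Qed.

End Series.

Section ClosedLoopCost.
Variables (F : realType) (n m : nat).
Variables (A : 'M[F]_n) (B : 'M[F]_(n, m)) (Q : 'M[F]_n) (R : 'M[F]_m).
Variables (P : 'M[F]_n) (gamma : F).
Hypotheses (gamma0 : 0 < gamma) (psdQ : psd Q) (psdR : psd (R - gamma%:M)).
Hypotheses (psdP : psd P) (ricP : ric_map A B Q R P = P).

Let psdR0 := psd_input_cost gamma0 psdR.

Definition gain_cost (G : 'M[F]_(m, n)) (x : 'cV[F]_n) :=
  2^-1 * dot x (Q *m x) + 2^-1 * dot (G *m x) (R *m (G *m x)).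

Lemma gain_cost_ge0 G x : 0 <= gain_cost G x.
Proof. by rewrite /gain_cost addr_ge0// mulr_ge0// psd_ge0. Qed.

Lemma trajectory_gain (G : 'M[F]_(m, n)) x0 t :
  trajectory A B (fun x => - (G *m x)) x0 t = (A - B *m G) ^+ t *m x0.
Proof.
elim: t => [|t IH]; first by rewrite expr0 mul1mx.
rewrite /trajectory iterS -/(trajectory _ _ _ _ _) IH.
have -> : (A - B *m G) ^+ t.+1 *m x0 = (A - B *m G) *m ((A - B *m G) ^+ t *m x0).
  by rewrite mulmxA exprS.
by rewrite mulmxN [in RHS]mulmxBl !mulmxA.
Qed.

Lemma cost_gain (G : 'M[F]_(m, n)) x0 :
  cost A B Q R (fun x => - (G *m x)) x0 =
  (\sum_(0 <= t <oo) (gain_cost G ((A - B *m G) ^+ t *m x0))%:E)%E.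
Proof.
apply: eq_eseriesr => t _; congr (_%:E); rewrite /= trajectory_gain.
by rewrite /stage_cost !dot_quad mulmxN dotNl dotNr opprK.
Qed.

(** The Bellman identity telescopes. The term at time T stays explicit: it has the right sign in
    upper bounds and decays geometrically in the lower bound for the optimal gain, whose penalty sum
    is 0. *)
Lemma gain_cost_sum (G : 'M[F]_(m, n)) x0 T :
  let x t := (A - B *m G) ^+ t *m x0 in
  let D := ric_gain A B R P - G in
  \sum_(t < T) gain_cost G (x t) =
    2^-1 * (dot x0 (P *m x0) - dot (x T) (P *m x T))
    + 2^-1 * \sum_(t < T) dot (D *m x t) (ric_weight B R P *m (D *m x t)).
Proof.
move=> x D; elim: T => [|T IH].
  by rewrite !big_ord0 /x expr0 mul1mx subrr mulr0 addr0.
rewrite !big_ord_recr /= IH.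
have eS : x T.+1 = A *m x T + B *m - (G *m x T).
  have -> : x T.+1 = (A - B *m G) *m x T by rewrite /x mulmxA exprS.
  by rewrite mulmxBl mulmxN [B *m (G *m _)]mulmxA.
have := complete_square A B Q gamma0 psdR (x T) (- (G *m x T)) psdP.
rewrite ricP -eS (_ : - (G *m x T) + _ = D *m x T); last first.
  by rewrite addrC /D [RHS]mulmxBl.
rewrite mulmxN dotNl dotNr opprK /gain_cost => h.
lra.
Qed.

End ClosedLoopCost.

(** * Graph distance and truncation *)

Section GraphDistance.
Variables (N : nat) (e : rel 'I_N).

Lemma walkP i j d : reflect (exists w : seq 'I_N, [/\ size w = d, path e i w & last i w = j])
  (walk e i j d).
Proof.
apply: (iffP existsP) => [[w /andP[h1 /eqP h2]]|[w [/eqP sw h1 h2]]].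
  by exists w; rewrite size_tuple.
by exists (Tuple sw); rewrite /= h1 h2 eqxx.
Qed.

Lemma walk0 i : walk e i i 0.
Proof. by apply/walkP; exists [::]. Qed.

Lemma walkS i j k d : e i j -> walk e j k d -> walk e i k d.+1.
Proof.
move=> eij /walkP[w [<- h1 h2]]; apply/walkP; exists (j :: w).
by rewrite /= eij h1 h2.
Qed.

Lemma walk_sym i j d : symmetric e -> walk e i j d -> walk e j i d.
Proof.
move=> es /walkP[w [sw h1 h2]]; apply/walkP; exists (rev (belast i w)).
rewrite size_rev size_belast sw; split=> //.
  rewrite -h2 rev_path; apply: sub_path h1 => x y exy.
  by rewrite es.
case: w {sw h1} h2 => [|x w] /= h2; first by [].
by rewrite rev_cons last_rcons.
Qed.

Lemma gdistP i j d : gdist e i j = Some d <->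
  walk e i j d /\ forall d', walk e i j d' -> (d <= d')%N.
Proof.
rewrite /gdist; case: pselect => [h|h]; split=> //.
- by move=> [<-]; case: ex_minnP => m hm hmin; split.
- move=> [hd hmin]; congr Some; case: ex_minnP => m hm hm'.
  by apply/eqP; rewrite eqn_leq hm'// hmin.
- by move=> [hd _]; case: h; exists d.
Qed.

Lemma gdist_leP i j k : gdist_le e i j k <-> exists2 d, (d <= k)%N & walk e i j d.
Proof.
rewrite /gdist_le; case E: (gdist e i j) => [d|]; split => //.
- by move=> dk; exists d => //; case/gdistP: E.
- by move=> [d' dk hd']; case/gdistP: E => _ /(_ _ hd') /leq_trans; apply.
- move: E; rewrite /gdist; case: pselect => // h _ [d _ hd].
  by case: h; exists d.
Qed.

Lemma gdist_le_refl i k : gdist_le e i i k.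
Proof. by apply/gdist_leP; exists 0%N; rewrite ?walk0. Qed.

Lemma gdist_leS i j k : gdist_le e i j k -> gdist_le e i j k.+1.
Proof. by move=> /gdist_leP[d dk h]; apply/gdist_leP; exists d => //; exact: ltnW. Qed.

Lemma gdist_le_step i l j k : e i l -> gdist_le e l j k -> gdist_le e i j k.+1.
Proof.
by move=> eil /gdist_leP[d dk h]; apply/gdist_leP; exists d.+1 => //; exact: walkS h.
Qed.

Lemma gdist_sym i j : symmetric e -> gdist e i j = gdist e j i.
Proof.
move=> es; have h a b d : gdist e a b = Some d -> gdist e b a = Some d.
  move=> /gdistP[h1 h2]; apply/gdistP; split; first exact: walk_sym.
  by move=> d' hd'; apply/h2/walk_sym.
case E: (gdist e i j) => [d|]; first by rewrite (h _ _ _ E).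
by case E': (gdist e j i) => [d|] //; rewrite (h _ _ _ E') in E.
Qed.

Lemma gdist_refl i : gdist e i i = Some 0%N.
Proof. by apply/gdistP; split; first exact: walk0. Qed.

Variable F : realType.

Definition near_support (p : 'I_N -> nat) (j : 'I_N) (k : nat)
    (x : 'cV[F]_(\sum_i p i)) :=
  forall i, ~~ gdist_le e i j k -> node_sel F p i *m x = 0.

Lemma near_support_filtration p j : filtration (near_support (p := p) j).
Proof.
split=> [k i _|k x y hx hy i hi|k a x hx i hi|k x hx i hi].
- by rewrite mulmx0.
- by rewrite mulmxDr hx// hy// addr0.
- by rewrite -scalemxAr hx// scaler0.
- by apply: hx; apply: contra hi; exact: gdist_leS.
Qed.

Lemma sparse_bandwidth1 p q (M : forall i j, 'M[F]_(p i, q j)) j :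
  graph_sparse e M ->
  bandwidth1 (near_support (p := q) j) (near_support (p := p) j)
    (\mxblock_(i, j) M i j).
Proof.
move=> hM k x hx i hi; have res := node_resolution F q.
rewrite [x](resolution_split res) !mulmx_sumr big1// => l _.
rewrite !mulmxA node_sel_block mxblockK.
have [le|nle] := boolP (gdist_le e l j k); last by rewrite -mulmxA hx// mulmx0.
rewrite hM ?mul0mx//.
  by apply: contraNneq hi => ->; exact: gdist_leS.
by apply: contraNN hi => eil; exact: gdist_le_step le.
Qed.

Lemma graph_sparse_tr p q (M : forall i j, 'M[F]_(p i, q j)) : symmetric e ->
  graph_sparse e M -> graph_sparse e (fun i j => (M j i)^T).
Proof. by move=> es hM i j ij eij; rewrite hM ?trmx0// 1?eq_sym// es. Qed.

Lemma sparse_tr_bandwidth1 p q (M : forall i j, 'M[F]_(p i, q j)) j : symmetric e ->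
  graph_sparse e M ->
  bandwidth1 (near_support (p := p) j) (near_support (p := q) j)
    (\mxblock_(i, j) M i j)^T.
Proof.
by move=> es hM; rewrite tr_mxblock; apply: sparse_bandwidth1; exact: graph_sparse_tr.
Qed.

Lemma norm2_node_sel (p : 'I_N -> nat) i (x : 'cV[F]_(\sum_i p i)) :
  norm2 (node_sel F p i *m x) <= norm2 x.
Proof.
rewrite -[leRHS]mul1r; apply: sqr_le_norm2 => //; rewrite expr1n mul1r.
rewrite (resolution_dot (node_resolution F p) x) [leRHS](bigD1 i)//= lerDl.
by apply: sumr_ge0 => j _; exact: dot_ge0.
Qed.

Lemma norm2_node_emb (p : 'I_N -> nat) i (y : 'cV[F]_(p i)) :
  norm2 ((node_sel F p i)^T *m y) = norm2 y.
Proof.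
have [h _ _] := node_resolution F p.
by rewrite !norm2_dot dotM trmxK mulmxA h// mul1mx.
Qed.

Lemma near_support_emb (p : 'I_N -> nat) j (y : 'cV[F]_(p j)) :
  near_support j 0 ((node_sel F p j)^T *m y).
Proof.
move=> i hi; have [_ h _] := node_resolution F p.
rewrite mulmxA h ?mul0mx//; apply: contraNneq hi => ->; exact: gdist_le_refl.
Qed.

End GraphDistance.

(** * Truncation error of a matrix with decaying blocks *)

Section Truncation.
Variables (F : realType) (N : nat) (hN : (0 < N)%N) (e : rel 'I_N) (e_sym : symmetric e).
Variables (p : nat -> F) (r dl U : F).
Hypotheses (hp : subexponential p).
Hypotheses (hcount : forall (i : 'I_N) (d : nat),
  #|[set j : 'I_N | gdist e i j == Some d]|%:R <= p d).
Hypotheses (r0 : 0 < r) (rdl : r < dl) (dl1 : dl < 1) (U0 : 0 < U).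

Let dl0 : 0 < dl := lt_trans r0 rdl.
Let s := sup (range (fun n : nat => p n * (r / dl) ^+ n)).

(** As r / dl < 1, subexponential growth makes the sequence converge, hence bounded, so the supremum
    inside [Psi] really is an upper bound. *)
Lemma growth_has_sup : has_sup (range (fun n : nat => p n * (r / dl) ^+ n)).
Proof.
split; first by exists (p 0%N * (r / dl) ^+ 0), 0%N.
have q0 : 0 < r / dl by rewrite divr_gt0.
have q1 : r / dl < 1 by rewrite ltr_pdivrMr// mul1r.
have [_ /(_ _ q0 q1)] := hp.
move=> /cvgP/cvg_seq_bounded[M [_ hM]].
exists (M + 1) => _ [n _ <-].
have := hM (M + 1); rewrite ltrDl ltr01 => /(_ isT n I).
by move/ler_normlW.
Qed.

Lemma growth_le d : p d * r ^+ d <= s * dl ^+ d.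
Proof.
have : p d * (r / dl) ^+ d <= s.
  by apply: ub_le_sup; [exact: growth_has_sup.2|exists d].
rewrite expr_div_n mulrA ler_pdivrMr ?exprn_gt0//.
Qed.

Lemma growth_ge1 : 1 <= s.
Proof.
have h : p 0%N <= s by have := growth_le 0; rewrite !expr0 !mulr1.
apply: le_trans h; apply: le_trans (hcount (Ordinal hN) 0).
rewrite ler1n card_gt0; apply/set0Pn; exists (Ordinal hN).
by rewrite inE gdist_refl.
Qed.

Lemma geometric_tail M k : \sum_(d < M | (k < d)%N) dl ^+ d <= dl ^+ k.+1 / (1 - dl).
Proof.
rewrite -(big_geq_mkord k.+1 M predT (fun d => dl ^+ d)) -{1}(add0n k.+1) big_addn.
under eq_bigr do rewrite exprD mulrC.
rewrite -mulr_sumr ler_wpM2l ?exprn_ge0 ?(ltW dl0)// big_mkord.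
by apply: geometric_sum_le => //; exact: ltW.
Qed.

(** Group the nodes by distance: at most p d of them lie at distance d, and p d * r^d <= s * dl^d.
    The tail of the geometric series starting at k + 1 produces the factor dl / (1 - dl) of [Psi];
    unreachable nodes contribute 0. *)
Lemma truncation_row i k :
  \sum_j (if gdist_le e i j k then 0 else U * expgdist r e i j)
  <= s * (U * dl / (1 - dl)) * dl ^+ k.
Proof.
(* A cutoff beyond all finite distances, so that nodes and distances are exchanged in a finite
   double sum. *)
pose M := (\max_j odflt 0%N (gdist e i j)).+1.
have hM j d : gdist e i j = Some d -> (d < M)%N.
  move=> E; rewrite ltnS (leq_trans _ (leq_bigmax j))//.
  by rewrite E.
apply: (@le_trans _ _ (\sum_j \sum_(d < M | (k < d)%N)
    (if gdist e i j == Some (d : nat) then U * r ^+ d else 0))).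
  apply: ler_sum => j _; rewrite /gdist_le /expgdist.
  have pos (o : option nat) d : 0 <= (if o == Some d then U * r ^+ d else 0).
    by case: ifP => // _; rewrite mulr_ge0 ?exprn_ge0// ltW.
  case E: (gdist e i j) => [d|]; last first.
    by rewrite mulr0; apply: sumr_ge0 => d _.
  case: leqP => dk; first by apply: sumr_ge0 => d' _; exact: pos.
  rewrite (bigD1 (Ordinal (hM _ _ E)))//= eqxx lerDl.
  by apply: sumr_ge0 => d' _; exact: pos.
rewrite exchange_big /=.
apply: (@le_trans _ _ (\sum_(d < M | (k < d)%N) U * (s * dl ^+ d))).
  apply: ler_sum => d _; rewrite -big_mkcond /= sumr_const.
  rewrite -mulr_natr -mulrA ler_wpM2l ?(ltW U0)// mulrC.
  apply: le_trans (growth_le d); rewrite ler_wpM2r ?exprn_ge0 ?(ltW r0)//.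
  apply: le_trans (hcount i d); rewrite ler_nat.
  by apply: subset_leq_card; apply/fintype.subsetP => j; rewrite !inE.
rewrite -!mulr_sumr.
have s0 : 0 <= s := le_trans ler01 growth_ge1.
have := ler_wpM2l (ltW U0) (ler_wpM2l s0 (geometric_tail M k)).
move=> /le_trans; apply; rewrite le_eqVlt; apply/orP; left; apply/eqP.
rewrite exprS; ring.
Qed.

Lemma truncate_norm (nu nx : 'I_N -> nat) (K : 'M[F]_(\sum_i nu i, \sum_i nx i)) k :
  (forall i j, mxnorm2 (submxblock K i j) <= U * expgdist r e i j) ->
  mxnorm2 (K - truncate e K k) <= s * (U * dl / (1 - dl)) * dl ^+ k.
Proof.
move=> hK; have s0 : 0 < s := lt_le_trans ltr01 growth_ge1.
apply: (schur_test (c := fun i j => if gdist_le e i j k then 0 else U * expgdist r e i j)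
  (node_resolution F nu) (node_resolution F nx)).
- by rewrite !mulr_gt0 ?exprn_gt0 ?invr_gt0 ?subr_gt0.
- move=> i j _ _; rewrite node_sel_block submxblockB /truncate mxblockK.
  by case: ifP => _; rewrite ?subrr ?mxnorm20// subr0.
- by move=> i _; exact: truncation_row.
- move=> j _; under eq_bigr => i _.
    rewrite /gdist_le /expgdist (gdist_sym i j e_sym) -/(gdist_le e j i k).
    rewrite -/(expgdist r e j i); over.
  exact: truncation_row.
Qed.

End Truncation.

(** * Gain, stability and cost estimates for the network *)

Section NetworkLQR.
Variables (F : realType) (N : nat) (hN : (0 < N)%N).
Variables (e : rel 'I_N) (e_sym : symmetric e) (nx nu : 'I_N -> nat).
Variables (A_ : forall i j : 'I_N, 'M[F]_(nx i, nx j)).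
Variables (B_ : forall i j : 'I_N, 'M[F]_(nx i, nu j)).
Variables (Q_ : forall i j : 'I_N, 'M[F]_(nx i, nx j)).
Variables (R_ : forall i j : 'I_N, 'M[F]_(nu i, nu j)).
Hypotheses (A_sparse : graph_sparse e A_) (B_sparse : graph_sparse e B_).
Hypotheses (Q_sparse : graph_sparse e Q_) (R_sparse : graph_sparse e R_).

Let A := \mxblock_(i, j) A_ i j.
Let B := \mxblock_(i, j) B_ i j.
Let Q := \mxblock_(i, j) Q_ i j.
Let R := \mxblock_(i, j) R_ i j.

Variables (L alpha gamma : F).
Hypotheses (L1 : 1 < L) (alpha0 : 0 < alpha) (alpha1 : alpha < 1).
Hypotheses (gamma0 : 0 < gamma) (gamma1 : gamma < 1).
Hypotheses (nA : mxnorm2 A <= L) (nB : mxnorm2 B <= L).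
Hypotheses (nQ : mxnorm2 Q <= L) (nR : mxnorm2 R <= L).
Hypotheses (psdQ : psd Q) (psdR : psd (R - gamma%:M)).
Hypotheses (stabAB : stabilizable L alpha A B).
Hypotheses (detAQ : detectable L alpha A (psd_sqrt Q)).

Local Notation P := (Pstar A B Q R).
Local Notation K := (Kstar A B Q R).
Local Notation Phi := (A - B *m K).
Local Notation rh := (rho L alpha gamma).
Local Notation Up := (Upsilon L alpha gamma).
Local Notation dl := (delta L alpha gamma).

Let PP := PstarP L1 alpha0 alpha1 gamma0 nA nB nQ nR psdQ psdR stabAB.
Let psdP : psd P. Proof. by case: PP. Qed.
Let ricP : ric_map A B Q R P = P. Proof. by case: PP. Qed.
Let nP : mxnorm2 P <= LP L alpha. Proof. by case: PP. Qed.
Let KE : K = ric_gain A B R P. Proof. by case: PP. Qed.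
Let r0 := rho_gt0 L1 alpha0 alpha1 gamma0 gamma1.
Let r1 := rho_lt1 L1 alpha0 alpha1 gamma0 gamma1.
Let U1 := Upsilon_ge1 L1 alpha0 alpha1 gamma0 gamma1.
Let U0 : 0 < Up. Proof. exact: lt_le_trans ltr01 U1. Qed.
Let L0 : 0 < L := lt_trans ltr01 L1.

Let closed_loop : stable Up rh Phi.
Proof.
rewrite KE => t; exact: (closed_loop_decay L1 alpha0 alpha1 gamma0 gamma1 nA nB nQ nR
  psdQ psdR psdP nP stabAB detAQ ricP).
Qed.

Lemma gain_block_decay i j : mxnorm2 (submxblock K i j) <= Up * expgdist rh e i j.
Proof.
have gH0 := gammaH_gt0 L1 alpha0 alpha1 gamma0 gamma1.
have ex0 : 0 <= expgdist rh e i j.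
  by rewrite /expgdist; case: gdist => // d; rewrite exprn_ge0// ltW.
have U00 := ltW U0.
apply: mxnorm2_le => [|y]; first by rewrite mulr_ge0.
set x0 := (node_sel F nx j)^T *m y.
have eK : submxblock K i j *m y = node_sel F nu i *m (K *m x0).
  by rewrite -node_sel_block -!mulmxA.
(* If i is farther than 2 k - 1 from j, the correction z vanishes at i, so the block of K is bounded
   by the remainder alone. *)
have key k : (forall d, gdist e i j = Some d -> (k.*2.-1 < d)%N \/ k = 0%N) ->
    norm2 (submxblock K i j *m y) <=
    (gammaH L alpha gamma)^-1 * rh ^+ k.*2 * norm2 y.
  move=> hk; have [z [hz z0 hd]] := gain_decay L1 alpha0 alpha1 gamma0 gamma1 nA nB nQ nR
    psdQ psdR psdP nP stabAB detAQ ricP k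
    (near_support_filtration e F nx j) (near_support_filtration e F nu j)
    (@sparse_bandwidth1 _ _ _ _ _ _ j A_sparse)
    (@sparse_tr_bandwidth1 _ _ _ _ _ _ j e_sym A_sparse)
    (@sparse_bandwidth1 _ _ _ _ _ _ j B_sparse)
    (@sparse_tr_bandwidth1 _ _ _ _ _ _ j e_sym B_sparse)
    (@sparse_bandwidth1 _ _ _ _ _ _ j Q_sparse) (@sparse_bandwidth1 _ _ _ _ _ _ j R_sparse)
    (@near_support_emb _ e _ _ _ y).
  rewrite norm2_node_emb in hd; apply: le_trans hd.
  rewrite eK KE; suff z' : node_sel F nu i *m z = 0.
    by rewrite -[X in norm2 X <= _]subr0 -z' -mulmxBr norm2_node_sel.
  have [k0|kn] := eqVneq k 0%N; first by rewrite z0// mulmx0.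
  apply: hz; apply/negP => /gdist_leP[d dk hw].
  case E: (gdist e i j) => [d'|].
    have [lt|k0] := hk _ E; last by rewrite k0 in kn.
    move/gdistP: E => [_ /(_ _ hw) le].
    by have := leq_trans lt (leq_trans le dk); rewrite ltnn.
  move: E; rewrite /gdist; case: pselect => // h _; case: h; by exists d.
rewrite /expgdist; case E: (gdist e i j) => [d|].
  apply: (le_trans (key d./2 _)).
    move=> d'; rewrite E => -[<-]; have [e0|n0] := eqVneq d./2 0%N; first by right.
    left; rewrite prednK ?double_gt0 ?lt0n//.
    by rewrite -[leqRHS]odd_double_half leq_addl.
  rewrite ler_wpM2r ?norm2_ge0//.
  apply: (decay_rate L1 alpha0 alpha1 gamma0 gamma1).
  by rewrite -[leqLHS]odd_double_half -add1n leq_add2r leq_b1.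
rewrite mulr0 mul0r.
(* Without a path from j to i every k is admissible, and letting k grow shows that the block is
   0. *)
apply: (@le_geometric_limit _ _ _ ((gammaH L alpha gamma)^-1 * norm2 y) (rh ^+ 2)).
- by rewrite exprn_ge0// ltW.
- by rewrite exprn_ilt1// ltW.
move=> k; rewrite add0r mulrAC -exprM mul2n.
by apply: key => d; rewrite E.
Qed.

Lemma delta_bounds : 0 < dl < 1 /\ rh < dl.
Proof.
have h0 := r0; have h1 := r1; rewrite /delta; split; last by lra.
by apply/andP; split; lra.
Qed.

Lemma beta_bounds : 0 < beta L alpha gamma < 1.
Proof.
have h0 := r0; have h1 := r1; have hU := U1.
have r2 : rh ^+ 2 < 1 by rewrite exprn_ilt1// ltW.
have r20 : 0 < rh ^+ 2 by rewrite exprn_gt0.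
have u2 : 1 <= Up ^+ 2 by rewrite exprn_ege1.
have q0 : 0 < (1 - rh ^+ 2) / (2 * Up ^+ 2).
  by rewrite divr_gt0 ?subr_gt0// mulr_gt0// exprn_gt0.
have q1 : (1 - rh ^+ 2) / (2 * Up ^+ 2) < 1.
  have d0 : 0 < 2 * Up ^+ 2 by rewrite mulr_gt0// exprn_gt0.
  rewrite ltr_pdivrMr//; lra.
rewrite /beta sqrtr_gt0 subr_gt0 q1 /=.
rewrite -[ltRHS]sqrtr1 ltr_sqrt//; lra.
Qed.

Variable (p : nat -> F).
Hypotheses (hp : subexponential p).
Hypotheses (hcount : forall (i : 'I_N) (d : nat),
  #|[set j : 'I_N | gdist e i j == Some d]|%:R <= p d).

Local Notation ps := (Psi L alpha gamma p).
Local Notation Kk := (truncate e K).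

Let d0 : 0 < dl. Proof. by case: delta_bounds => /andP[]. Qed.
Let d1 : dl < 1. Proof. by case: delta_bounds => /andP[]. Qed.
Let rd : rh < dl. Proof. by case: delta_bounds. Qed.

Lemma gain_truncation kappa : mxnorm2 (K - Kk kappa) <= ps * dl ^+ kappa.
Proof.
have := truncate_norm hN e_sym hp hcount r0 rd d1 U0 kappa gain_block_decay.
by [].
Qed.

Lemma Psi_gt0 : 0 < ps.
Proof.
rewrite /Psi /= mulr_gt0//; last by rewrite divr_gt0 ?subr_gt0// mulr_gt0.
by apply: (lt_le_trans ltr01); exact: (growth_ge1 hN hp hcount r0 rd).
Qed.

Lemma gain_norm : mxnorm2 Phi <= L * (1 + LP L alpha * L ^+ 2 / gamma).
Proof.
apply: (le_trans (mxnorm2D _ _)); rewrite mxnorm2N mulrDr mulr1 lerD//.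
apply: mxnorm2M_le => //; rewrite KE.
exact: (ric_gain_norm L1 gamma0 nA nB psdR psdP nP).
Qed.

Lemma kappabar_small kappa : kappabar L alpha gamma p <= kappa%:R ->
  dl ^+ kappa <= (1 - rh ^+ 2) / (2 * Up ^+ 2 * ps * L
           * (L * ps + 2 * L * (1 + LP L alpha * L ^+ 2 / gamma))).
Proof.
rewrite /kappabar /=; set C := _ / _ => h.
have P0 := Psi_gt0; have LP0 := LP_gt0 L1 alpha0 alpha1.
have t0 : 0 < LP L alpha * L ^+ 2 / gamma.
  by rewrite divr_gt0 // mulr_gt0// exprn_gt0.
have C0 : 0 < C.
  apply: divr_gt0; first by rewrite subr_gt0 exprn_ilt1// ltW.
  apply: mulr_gt0; last first.
    apply: addr_gt0; first exact: mulr_gt0.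
    by apply: mulr_gt0; [exact: mulr_gt0|exact: addr_gt0].
  by do 2 (apply: mulr_gt0 => //); rewrite mulr_gt0// exprn_gt0.
have ln0 : ln dl < 0 by rewrite ln_lt0// d0.
rewrite -ler_ln ?posrE ?exprn_gt0// lnXn//.
rewrite ler_ndivrMl// in h.
by rewrite -mulr_natr.
Qed.

(** Origin of [kappabar]: the perturbation has size eta = L Psi delta^kappa and the smallness
    condition is quadratic in it. Bounding one factor eta by L Psi makes the condition linear in
    delta^kappa. *)
Lemma truncated_stable kappa : kappabar L alpha gamma p <= kappa%:R ->
  stable (Omega L alpha gamma) (beta L alpha gamma) (A - B *m Kk kappa).
Proof.
move=> hk; have small := kappabar_small hk.
have -> : A - B *m Kk kappa = Phi + B *m (K - Kk kappa).
  by rewrite mulmxBr addrA subrK.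
have P0 := Psi_gt0; have LP0 := LP_gt0 L1 alpha0 alpha1.
have nE : mxnorm2 (B *m (K - Kk kappa)) <= L * (ps * dl ^+ kappa).
  by apply: mxnorm2M_le => //; exact: gain_truncation.
apply: (perturbed_stable U0 r0 r1 closed_loop gain_norm nE U1).
set G := 1 + LP L alpha * L ^+ 2 / gamma in small *.
have t0 : 0 < G by rewrite /G addr_gt0// divr_gt0 // mulr_gt0// exprn_gt0.
set D := dl ^+ kappa in small *.
have D0 : 0 < D by rewrite exprn_gt0.
have D1 : D <= 1 by rewrite exprn_ile1// ltW.
have r2 : 0 < 1 - rh ^+ 2 by rewrite subr_gt0 exprn_ilt1// ltW.
have X0 : 0 < 2 * Up ^+ 2 * ps * L * (L * ps + 2 * L * G).
  apply: mulr_gt0; last first.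
    apply: addr_gt0; first exact: mulr_gt0.
    by apply: mulr_gt0; [exact: mulr_gt0|].
  by do 2 (apply: mulr_gt0 => //); rewrite mulr_gt0// exprn_gt0.
rewrite ler_pdivlMr// in small.
rewrite mulrAC ler_pdivrMr//.
have h1 : L * (ps * D) <= L * ps by rewrite mulrA ler_piMr// ltW// mulr_gt0.
have c0 : 0 <= Up ^+ 2 * (L * (ps * D)).
  by apply: mulr_ge0; [exact: sqr_ge0|apply/ltW/mulr_gt0 => //; exact: mulr_gt0].
have := ler_wpM2l c0 h1; lra.
Qed.

(** The optimal cost is only needed from below, against the same value <x0, P x0> / 2 that bounds
    the truncated cost; finiteness gives the later subtraction its meaning in the extended reals. *)
Lemma optimal_cost_bounds x0 :
  cost A B Q R (fun x => - (K *m x)) x0 \is a fin_num /\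
  ((2^-1 * dot x0 (P *m x0))%:E <= cost A B Q R (fun x => (- (K *m x))%R) x0)%E.
Proof.
rewrite cost_gain; set x := fun t => Phi ^+ t *m x0.
have hsum T : \sum_(t < T) gain_cost Q R K (x t) =
    2^-1 * (dot x0 (P *m x0) - dot (x T) (P *m x T)).
  rewrite (gain_cost_sum gamma0 psdR psdP ricP) -KE subrr.
  rewrite [X in _ + _ * X = _]big1 ?mulr0 ?addr0// => t _.
  by rewrite mul0mx dot0l.
have f0 t := gain_cost_ge0 gamma0 psdQ psdR K (x t).
have [|hfin _] := nneseries_bounded f0 (c := 2^-1 * dot x0 (P *m x0)).
  by move=> T; rewrite hsum ler_wpM2l ?invr_ge0// gerBl psd_ge0.
split => //; rewrite -(fineK hfin) lee_fin.
apply: (@le_geometric_limit _ _ _ (2^-1 * (LP L alpha * Up ^+ 2 * dot x0 x0)) (rh ^+ 2)).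
- by rewrite exprn_ge0// ltW.
- by rewrite exprn_ilt1// ltW.
move=> T; have := nneseries_partial f0 T.
rewrite -(fineK hfin) lee_fin hsum => h.
have /ler_normlW hx := dot_mxnorm2 (x T) (x T) nP.
rewrite -mulrA -expr2 sqr_norm2 in hx.
have hs : dot (x T) (x T) <= (Up * rh ^+ T) ^+ 2 * dot x0 x0.
  apply: norm2_le_sqr; last exact: stable_norm2.
  by apply: mulr_ge0; [exact: ltW|rewrite exprn_ge0// ltW].
have := ler_wpM2l (ltW (LP_gt0 L1 alpha0 alpha1)) hs.
rewrite exprMn exprAC; lra.
Qed.

Lemma truncated_cost_bounds kappa x0 : kappabar L alpha gamma p <= kappa%:R ->
  cost A B Q R (fun x => - (Kk kappa *m x)) x0 \is a fin_num /\
  (cost A B Q R (fun x => (- (Kk kappa *m x))%R) x0 <=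
    (2^-1 * dot x0 (P *m x0)
     + Gamma L alpha gamma p * dl ^+ kappa * norm2 x0 ^+ 2)%:E)%E.
Proof.
move=> hk; have hst := truncated_stable hk.
rewrite cost_gain; set x := fun t => (A - B *m Kk kappa) ^+ t *m x0.
have f0 t := gain_cost_ge0 gamma0 psdQ psdR (Kk kappa) (x t).
apply: (nneseries_bounded f0) => T.
rewrite (gain_cost_sum gamma0 psdR psdP ricP) -KE -/(x _).
have /andP[b0 b1] := beta_bounds.
have P0 := Psi_gt0; have LP0 := LP_gt0 L1 alpha0 alpha1.
set bt := beta L alpha gamma in hst b0 b1 *.
set D := dl ^+ kappa.
have D0 : 0 < D by rewrite exprn_gt0.
have D1 : D <= 1 by rewrite exprn_ile1// ltW.
have nS : mxnorm2 (ric_weight B R P) <= L * (1 + L * LP L alpha).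
  apply: (le_trans (mxnorm2D _ _)); rewrite mulrDr mulr1 lerD//.
  rewrite (_ : L * (L * LP L alpha) = L * LP L alpha * L); last by ring.
  by apply: mxnorm2M_le => //; apply: mxnorm2M_le => //; rewrite mxnorm2_tr.
have Om0 : 0 <= Omega L alpha gamma by exact: sqrtr_ge0.
have hx t : dot (x t) (x t) <= Omega L alpha gamma ^+ 2 * (bt ^+ 2) ^+ t * dot x0 x0.
  rewrite exprAC -exprMn; apply: norm2_le_sqr; last exact: stable_norm2.
  by rewrite mulr_ge0 ?exprn_ge0// ltW.
have S0 : 0 <= L * (1 + L * LP L alpha).
  apply: mulr_ge0; first exact: ltW.
  by apply: addr_ge0 => //; apply: mulr_ge0; exact: ltW.
have c0 : 0 <= L * (1 + L * LP L alpha) * (ps * D) ^+ 2.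
  by apply: mulr_ge0 => //; exact: sqr_ge0.
have hterm t : dot ((K - Kk kappa) *m x t) (ric_weight B R P *m ((K - Kk kappa) *m x t))
    <= L * (1 + L * LP L alpha) * (ps * D) ^+ 2 *
       (Omega L alpha gamma ^+ 2 * dot x0 x0) * (bt ^+ 2) ^+ t.
  have /ler_normlW h1 := dot_mxnorm2 ((K - Kk kappa) *m x t) ((K - Kk kappa) *m x t) nS.
  rewrite -mulrA -expr2 sqr_norm2 in h1; apply: (le_trans h1).
  have h2 : dot ((K - Kk kappa) *m x t) ((K - Kk kappa) *m x t)
      <= (ps * D) ^+ 2 * dot (x t) (x t).
    apply: norm2_le_sqr; first by apply: mulr_ge0; exact: ltW.
    by apply: norm2_mulmx_le; exact: gain_truncation.
  apply: (le_trans (ler_wpM2l S0 h2)); rewrite [leLHS]mulrA.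
  apply: (le_trans (ler_wpM2l c0 (hx t))).
  by rewrite le_eqVlt; apply/orP; left; apply/eqP; ring.
have hsum : \sum_(t < T) dot ((K - Kk kappa) *m x t)
      (ric_weight B R P *m ((K - Kk kappa) *m x t))
    <= L * (1 + L * LP L alpha) * (ps * D) ^+ 2 *
       (Omega L alpha gamma ^+ 2 * dot x0 x0) * (1 - bt ^+ 2)^-1.
  set c := _ * (_ * dot x0 x0) in hterm *.
  apply: (@le_trans _ _ (\sum_(t < T) c * (bt ^+ 2) ^+ t)).
    by apply: ler_sum => t _; exact: hterm.
  rewrite -mulr_sumr; apply: ler_wpM2l.
    by apply: mulr_ge0 => //; apply: mulr_ge0; [exact: sqr_ge0|exact: dot_ge0].
  by apply: geometric_sum_le; rewrite ?sqr_ge0// exprn_ilt1// ltW.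
have xP0 : 0 <= dot (x T) (P *m x T) by exact: psd_ge0.
rewrite sqr_norm2.
have b2 : 0 < 1 - bt ^+ 2 by rewrite subr_gt0 exprn_ilt1// ltW.
have hG : 2^-1 * (L * (1 + L * LP L alpha) * (ps * D) ^+ 2 *
       (Omega L alpha gamma ^+ 2 * dot x0 x0) * (1 - bt ^+ 2)^-1)
    <= Gamma L alpha gamma p * D * dot x0 x0.
  rewrite /Gamma /= -/bt; set O := Omega L alpha gamma ^+ 2.
  have O0 : 0 <= O by exact: sqr_ge0.
  have x00 := dot_ge0 x0; have gamma00 := gamma0; have L00 := L0.
  move: O O0 => O O0; move: (dot x0 x0) x00 => X X0.
  move: (Psi L alpha gamma p) P0 (LP L alpha) LP0 => q P0 lp LP0.
  have w0 : 0 <= O * L * q * (1 - bt ^+ 2)^-1 * D * X.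
    by rewrite !mulr_ge0 ?invr_ge0// ltW.
  (* The loss is of second order in Psi delta^kappa. One factor delta^kappa is bounded by 1, and the
     bracket of [Gamma] dominates what is left. *)
  have w1 : 2^-1 * ((1 + L * lp) * q * D) <=
      (1 + L * lp) * (2 * lp * L ^+ 2 / gamma + q) + 2 * L * lp.
    have e0 : 0 <= (1 + L * lp) * q.
      by rewrite mulr_ge0 ?addr_ge0 ?mulr_ge0// ltW.
    have e1 : (1 + L * lp) * q * D <= (1 + L * lp) * q.
      by rewrite ler_piMr.
    have e2 : 0 <= (1 + L * lp) * (2 * lp * L ^+ 2 / gamma).
      by rewrite !mulr_ge0 ?addr_ge0 ?mulr_ge0 ?exprn_ge0 ?invr_ge0// ltW.
    have e3 : 0 <= 2 * L * lp by rewrite !mulr_ge0// ltW.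
    rewrite [(1 + _) * (_ + q)]mulrDr; lra.
  have := ler_wpM2l w0 w1; lra.
lra.
Qed.

End NetworkLQR.

Theorem theorem5p3 (F : realType) (N : nat) (hN : (0 < N)%N)
    (e : rel 'I_N) (e_sym : symmetric e) (e_irr : irreflexive e)
    (nx nu : 'I_N -> nat)
    (A_ : forall i j : 'I_N, 'M[F]_(nx i, nx j))
    (B_ : forall i j : 'I_N, 'M[F]_(nx i, nu j))
    (Q_ : forall i j : 'I_N, 'M[F]_(nx i, nx j))
    (R_ : forall i j : 'I_N, 'M[F]_(nu i, nu j))
    (Q_sym : forall i j : 'I_N, Q_ i j = (Q_ j i)^T)
    (R_sym : forall i j : 'I_N, R_ i j = (R_ j i)^T)
    (A_sparse : graph_sparse e A_) (B_sparse : graph_sparse e B_)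
    (Q_sparse : graph_sparse e Q_) (R_sparse : graph_sparse e R_)
    (L0 gamma0 alpha0 : F) (hL0 : 1 < L0)
    (hgamma0 : 0 < gamma0 < 1) (halpha0 : 0 < alpha0 < 1)
    (Pi : {set {set 'I_N}}) (hPi : finset.partition Pi [set: 'I_N]) (D : nat) :
  let A := \mxblock_(i, j) A_ i j in
  let B := \mxblock_(i, j) B_ i j in
  let Q := \mxblock_(i, j) Q_ i j in
  let R := \mxblock_(i, j) R_ i j in
  let alpha := alpha0 in
  let gamma := gamma0 in
  let L := L0 * D%:R in
  let U1 := condU1 Pi B_ Q_ R_ in
  let U2 := condU2 L0 Pi A_ B_ Q_ R_ in
  let U3 := condU3 gamma0 Pi R_ in
  let U4 := condU4 L0 alpha0 Pi A_ B_ in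
  let U5 := condU5 L0 alpha0 Pi A_ Q_ in
  let DD := condD e Pi D in
  [/\ (U1 -> U2 -> DD ->
        [/\ mxnorm2 A <= L, mxnorm2 B <= L, mxnorm2 Q <= L & mxnorm2 R <= L]),
      (U1 -> U3 -> psd (R - gamma%:M)),
      (U1 -> U2 -> U4 -> DD -> stabilizable L alpha A B),
      (U1 -> U2 -> U5 -> DD -> psd Q /\ detectable L alpha A (psd_sqrt Q)) &
      (U1 -> U2 -> U3 -> U4 -> U5 -> DD ->
        forall p : nat -> F, subexponential p ->
        (forall (i : 'I_N) (d : nat),
            #|[set j : 'I_N | gdist e i j == Some d]|%:R <= p d) ->
        let K := Kstar A B Q R in
        let Kk := truncate e K in
        let rho := rho L alpha gamma in
        let Upsilon := Upsilon L alpha gamma in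
        let delta := delta L alpha gamma in
        let Psi := Psi L alpha gamma p in
        let beta := beta L alpha gamma in
        let Omega := Omega L alpha gamma in
        let kappabar := kappabar L alpha gamma p in
        let Gamma := Gamma L alpha gamma p in
        let J := cost A B Q R in
        [/\ [/\ 0 < rho < 1, 1 <= Upsilon &
              forall i j : 'I_N,
                mxnorm2 (submxblock K i j) <= Upsilon * expgdist rho e i j],
            0 < delta < 1 /\
              (forall kappa : nat, mxnorm2 (K - Kk kappa) <= Psi * delta ^+ kappa),
            0 < beta < 1 /\
              (forall kappa : nat, kappabar <= kappa%:R ->
                stable Omega beta (A - B *m Kk kappa)) &
            forall kappa : nat, kappabar <= kappa%:R ->
              forall x0,
                let Jk := J (fun x => - (Kk kappa *m x)) x0 in
                let Js := J (fun x => - (K *m x)) x0 in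
                [/\ Jk \is a fin_num, Js \is a fin_num &
                    (Jk - Js <=
                      (Gamma * delta ^+ kappa * norm2 x0 ^+ 2)%:E)%E]])].
Proof.
move=> A B Q R alpha gamma L U1 U2 U3 U4 U5 DD.
have /andP[gamma_gt0 gamma_lt1] := hgamma0.
have /andP[alpha_gt0 alpha_lt1] := halpha0.
have hB : U1 -> forall S T, S \in Pi -> T \in Pi -> S != T -> cblock B_ S T = 0.
  by move=> u1 S T SP TP ST; case: (u1 S T SP TP ST).
have hQ : U1 -> forall S T, S \in Pi -> T \in Pi -> S != T -> cblock Q_ S T = 0.
  by move=> u1 S T SP TP ST; case: (u1 S T SP TP ST).
have hR : U1 -> forall S T, S \in Pi -> T \in Pi -> S != T -> cblock R_ S T = 0.
  by move=> u1 S T SP TP ST; case: (u1 S T SP TP ST).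
have a : U2 -> DD ->
    [/\ mxnorm2 A <= L, mxnorm2 B <= L, mxnorm2 Q <= L & mxnorm2 R <= L].
  move=> u2 dd; split; apply: (cluster_norm e_sym hN hPi dd hL0) => // S T SP TP;
    by case: (u2 S T SP TP).
have b : U1 -> U3 -> psd (R - gamma%:M).
  by move=> u1 u3; apply: (cluster_psd hPi) => //; exact: hR.
have c : U1 -> U4 -> DD -> stabilizable L alpha A B.
  move=> u1 u4 dd.
  by apply: (cluster_stabilizable e_sym hN hPi dd hL0) => //; [exact: ltW|exact: hB].
have d : U1 -> U5 -> DD -> psd Q /\ detectable L alpha A (psd_sqrt Q).
  move=> u1 u5 dd.
  by apply: (cluster_detectable e_sym hN hPi dd hL0) => //; [exact: ltW|exact: hQ].
split=> [_ u2 dd||u1 _|u1 _|u1 u2 u3 u4 u5 dd p hp hcount];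
  [exact: a|exact: b|exact: c|exact: d|].
move=> K Kk rho Upsilon delta Psi beta Omega kappabar Gamma J.
have L_gt1 : 1 < L.
  apply: (lt_le_trans hL0); rewrite ler_peMr//.
    by apply: ltW; rewrite (lt_trans _ hL0).
  by rewrite ler1n (cluster_degree_gt0 hN hPi dd).
have [nA nB nQ nR] := a u2 dd; have psdR := b u1 u3.
have st := c u1 u4 dd; have [psdQ dt] := d u1 u5 dd.
have [hdelta _] := delta_bounds L_gt1 alpha_gt0 alpha_lt1 gamma_gt0 gamma_lt1.
split.
- split; [|exact: Upsilon_ge1|move=> i j; exact: (gain_block_decay e_sym)].
  by apply/andP; split; [exact: rho_gt0|exact: rho_lt1].
- by split => // kappa; exact: (gain_truncation hN e_sym).
- by split; [exact: beta_bounds|move=> kappa; exact: (truncated_stable hN e_sym)].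
- move=> kappa hk x0 Jk Js.
  (* Both costs are compared with <x0, P x0> / 2, which cancels in the difference. *)
  have [fs ls] : Js \is a fin_num /\ ((2^-1 * dot x0 (Pstar A B Q R *m x0))%:E <= Js)%E.
    exact: (optimal_cost_bounds L_gt1 alpha_gt0 alpha_lt1 gamma_gt0 gamma_lt1).
  have [fk lk] : Jk \is a fin_num /\ (Jk <= (2^-1 * dot x0 (Pstar A B Q R *m x0)
      + Gamma * delta ^+ kappa * norm2 x0 ^+ 2)%:E)%E.
    exact: (truncated_cost_bounds hN e_sym).
  split=> //; rewrite -(fineK fs) -(fineK fk) -EFinB lee_fin.
  move: ls lk; rewrite -(fineK fs) -(fineK fk) !lee_fin => ls lk.
  by rewrite lerBlDr (le_trans lk)// addrC lerD2l.
Qed.
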